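(* Let $\mathcal M^Q$ be the Fraïssé limit of the class $K_Q$; for $n<\omega$ let $\mathcal M_n$ be the $L_{\mathrm{feq}}$-substructure of $\mathcal M^Q$ picked out by the predicates $(Q_n,R_n)$; let $\mathcal M=\bigcup_{n<\omega}\mathcal M_n$ (a model of $T^*_{\mathrm{feq}}$); let $\mathcal H$ be the collection of all substructures of $\mathcal M$ isomorphic to some $\mathcal M_n$, $n<\omega$; and let $\mathcal H'=\{\mathcal M_n:n<\omega\}\subseteq\mathcal H$. Then $\mathcal H'$ is a nice filtration of $\mathcal H$ and thus approximates $\mathcal M$ (that is, $\mathcal H$ is a nice collection, and $\mathcal H'$ is a directed system satisfying conditions (1) and (3)–(7) of the context).
   Context: **The theory and the construction.** $L_{\mathrm{feq}}$ is the two-sorted language with an object sort, a parameter sort, and one ternary relation $E_x(y,z)$ ($x$ a parameter, $y,z$ objects). Write $M=(A,B)$ with $A$ the objects and $B$ the parameters; for $b\in B$, $A_b$ is the set $A$ with the binary relation $E_b$. $K_{\mathrm{feq}}$ is the class of finite $L_{\mathrm{feq}}$-structures $(A,B)$ such that each $A_b$ ($b\in B$) is an equivalence relation; $T^*_{\mathrm{feq}}$ is the theory of its Fraïssé limit (the generic parameterized equivalence relation; each $E_p$ has infinitely many classes, all infinite). $K_n\subseteq K_{\mathrm{feq}}$ is the class of those $(A,B)$ in which each $A_b$ has at most $n$ classes. Let $L_Q=L_{\mathrm{feq}}\cup\{Q_i,R_i\}_{i<\omega}$ with $Q_i,R_i$ unary predicates. $(Q_n,R_n)$ *imposes $K_n$-structure*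 on $M=(A,B)$ if $Q_n^M\subseteq A$, $R_n^M\subseteq B$, and for every $b\in R_n^M$ the set $Q_n^M$ meets at most $n$ classes of $E_b$. $K_Q$ is the class of finite $L_Q$-structures $M$ with $M\restriction L_{\mathrm{feq}}\in K_{\mathrm{feq}}$ such that for all $i<\omega$, $Q_i^M\subseteq Q_{i+1}^M$, $R_i^M\subseteq R_{i+1}^M$ and $(Q_i,R_i)$ imposes $K_i$-structure on $M$. (The paper shows that $K_Q$ is a Fraïssé class, that $\mathcal M_n$ is a copy of the Fraïssé limit of $K_n$, and that these structures have simple theories.) **Approximation.** Let $\mathcal M$ be a structure in a language $\mathcal L$ and $\mathcal H$ a directed system (under inclusion) of substructures of $\mathcal M$; $\bar A=\mathrm{acl}^{\mathcal M}(A)$. For a formula $\psi$ and $a\in M$, $\psi(a)$ is *eventually true* in $\mathcal H$ if there is $\mathcal N\in\mathcal H$ containing $a$ with $\mathcal N'\models\psi(a)$ for all $\mathcal N'\in\mathcal H$, $\mathcal N'\supseteq\mathcal N$. A formula or finite partial type $\pi(x,b)$ *eventually forks* (resp. eventually does not fork) over $C\subseteq M$ if there is $\mathcal N\in\mathcal H$ containing $b$ such that for all $\mathcal N\subseteq\mathcal N'\in\mathcal H$, $\pi(x,b)$ forks (resp. does not fork) over $C\cap N'$ in $\mathcal N'$. For $A,B,C\subseteq M$, $A\perp^{\lim}_C B$ means: for each finite tuple $a\in A$ there is $\mathcal N\in\mathcal H$ containing $a$ such that for all $\mathcal N\subseteq\mathcal N'\in\mathcal H$, $\mathrm{tp}^{\mathcal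 N'}(a/(\bar B\cup\bar C)\cap N')$ does not fork over $\bar C\cap N'$ in $\mathcal N'$. Conditions: (1) Covering: $\bigcup\mathcal H=\mathcal M$. (2) Automorphism invariance: $\mathcal H$ is closed under automorphisms of $\mathcal M$. (3) Convergence of truth value: if $\mathcal M\models\psi(a)$ then $\psi(a)$ is eventually true in $\mathcal H$. (4) Stabilization of non-forking: for every formula or finite partial type $\pi(x,y)$, tuple $b$ and set $C$, $\pi(x,b)$ either eventually forks or eventually does not fork over $C$. (5) Strong finite character: if $A\not\perp^{\lim}_C B$ then there are a parameter-free formula $\varphi(x,y,z)$ and $a\in A$, $b\in\bar B$, $c\in\bar C$ with $\mathcal M\models\varphi(a,b,c)$ and $\varphi(x,b,c)$ eventually forking over $\bar C$ in $\mathcal H$. (6) Stabilization of algebraic closure: if $\bar A=A$ there is $\mathcal N_{\mathrm{alg}}\in\mathcal H$ such that $A\cap N=\mathrm{acl}^{\mathcal N}(A\cap N)$ for all $\mathcal N\in\mathcal H$ with $\mathcal N\supseteq\mathcal N_{\mathrm{alg}}$. (7) Homogeneity: for $\mathcal N\in\mathcal H$, $A\subset M$ and $a,b\in M$ (lying in $N$, so that the conclusion makes sense), if $a\equiv^{\mathcal M}_A b$ then $a\equiv^{\mathcal N}_{A\cap N}b$. **Niceness.** Let $\mathcal H$ be a (not necessarily directed) collection of substructures of $\mathcal M$ satisfying (1) and (2). $\mathcal H'\subseteq\mathcal H$ is a *nice filtration* of $\mathcal H$ if $\mathcal H'$ is a directed system satisfying (1) and (3)–(7). $\mathcal H$ is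 *filtration invariant* if the relation $\perp^{\lim}$ computed in any two nice filtrations of $\mathcal H$ is the same. $\mathcal H$ is *nice* if it is filtration invariant and the class of nice filtrations of $\mathcal H$ is nonempty and closed under automorphisms of $\mathcal M$. When $\mathcal H$ is nice, a nice filtration of it is said to approximate $\mathcal M$ (condition (2) being dropped).
   Formalization: K_Q as stated lacks joint embedding (because of Q_0, R_0) and amalgamation, so it has no Fraïssé limit; here the indices of Q_i, R_i and M_n start at 1, and the Fraïssé limit of K_Q is taken in the weak (generic) sense: countable, of age K_Q, weakly injective. *)

(* Defs.v *)
From Stdlib Require Import List RelationClasses ClassicalEpsilon Lia.
Import ListNotations.

Set Implicit Arguments.
Unset Strict Implicit.

(** * Many-sorted relational first-order logic *)

Record language := Language {
  sort : Type;
  rel : Type;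
  arity : rel -> list sort
}.

(* A context (list of sorts) is the type of a finite tuple of variables. *)
Inductive var (S : Type) : list S -> S -> Type :=
| vz s G : var (s :: G) s
| vs s t G : var G s -> var (t :: G) s.

Fixpoint tuple (S : Type) (T : S -> Type) (G : list S) : Type :=
  match G with
  | [] => unit
  | s :: G' => (T s * tuple T G')%type
  end.

Fixpoint tnth (S : Type) (T : S -> Type) (G : list S) (s : S) (x : var G s) :
    tuple T G -> T s :=
  match x in var G s return tuple T G -> T s with
  | vz _ _ => fun a => fst a
  | vs _ y => fun a => tnth y (snd a)
  end.

Fixpoint tapp (S : Type) (T : S -> Type) (G D : list S) :
    tuple T G -> tuple T D -> tuple T (G ++ D) :=
  match G return tuple T G -> tuple T D -> tuple T (G ++ D) with
  | [] => fun _ b => b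
  | _ :: _ => fun a b => (fst a, tapp (snd a) b)
  end.

Fixpoint tmap (S : Type) (T U : S -> Type) (f : forall s, T s -> U s)
    (G : list S) : tuple T G -> tuple U G :=
  match G return tuple T G -> tuple U G with
  | [] => fun _ => tt
  | _ :: _ => fun a => (f _ (fst a), tmap f (snd a))
  end.

Fixpoint tall (S : Type) (T : S -> Type) (A : forall s, T s -> Prop)
    (G : list S) : tuple T G -> Prop :=
  match G return tuple T G -> Prop with
  | [] => fun _ => True
  | _ :: _ => fun a => A _ (fst a) /\ tall A (snd a)
  end.

(* The remaining connectives are definable, satisfaction being used
   classically. *)
Inductive form (L : language) : list (sort L) -> Type :=
| fbot G : form G
| feq G s : var G s -> var G s -> form G
| frel G (r : rel L) : tuple (var G) (arity r) -> form G
| fimp G : form G -> form G -> form G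
| fall G s : form (s :: G) -> form G.

Arguments form : clear implicits.

Record structure (L : language) := Structure {
  dom :> sort L -> Type;
  interp : forall r : rel L, tuple dom (arity r) -> Prop
}.

Fixpoint sat (L : language) (M : structure L) (G : list (sort L))
    (phi : form L G) : tuple M G -> Prop :=
  match phi in form _ G return tuple M G -> Prop with
  | fbot _ => fun _ => False
  | feq x y => fun a => tnth x a = tnth y a
  | frel xs => fun a => interp (tmap (fun _ x => tnth x a) xs)
  | fimp p q => fun a => sat p a -> sat q a
  | @fall _ _ s p => fun a => forall x : M s, sat p ((x, a) : tuple M (s :: _))
  end.

(** * Substructures, embeddings *)

(* The language being relational, every family of subsets carries a
   substructure. *)
Definition subset (L : language) (M : structure L) := forall s, M s -> Prop.

Definition subset_le (L : language) (M : structure L) (A B : subset M) : Prop :=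
  forall s x, A s x -> B s x.

Definition union (L : language) (M : structure L) (A B : subset M) : subset M :=
  fun s x => A s x \/ B s x.

Definition image (L : language) (M N : structure L) (f : forall s, M s -> N s)
    (A : subset M) : subset N :=
  fun s y => exists x, A s x /\ f s x = y.

Definition sub (L : language) (M : structure L) (A : subset M) : structure L :=
  {| dom := fun s => {x : M s | A s x};
     interp := fun r xs =>
       interp (tmap (fun s (x : {x : M s | A s x}) => proj1_sig x) xs) |}.

Definition sub_val (L : language) (M : structure L) (A : subset M) :
    forall s, sub A s -> M s :=
  fun s x => proj1_sig x.

(* [trace N A] is A ∩ N as a subset of the substructure N. *)
Definition trace (L : language) (M : structure L) (N A : subset M) :
    subset (sub N) :=
  fun s x => A s (proj1_sig x).

Arguments trace {L M} N A [s] x.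

(* The tuple a of M lies in N and, as a tuple of N, it satisfies P. *)
Definition within (L : language) (M : structure L) (N : subset M)
    (G : list (sort L)) (P : tuple (sub N) G -> Prop) (a : tuple M G) : Prop :=
  exists a' : tuple (sub N) G, tmap (@sub_val L M N) a' = a /\ P a'.

Definition embedding (L : language) (M N : structure L)
    (f : forall s, M s -> N s) : Prop :=
  (forall s x y, f s x = f s y -> x = y) /\
  (forall r xs, @interp L M r xs <-> interp (tmap f xs)).

Definition isomorphism (L : language) (M N : structure L)
    (f : forall s, M s -> N s) : Prop :=
  embedding f /\ forall s y, exists x, f s x = y.

Definition isomorphic (L : language) (M N : structure L) : Prop :=
  exists f : forall s, M s -> N s, isomorphism f.

Definition automorphism (L : language) (M : structure L)
    (f : forall s, M s -> M s) : Prop :=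
  isomorphism f.

Definition elementary (L : language) (M N : structure L)
    (f : forall s, M s -> N s) : Prop :=
  forall G (phi : form L G) (a : tuple M G), sat phi a <-> sat phi (tmap f a).

Definition models (L : language) (M : structure L) (T : form L [] -> Prop) :=
  forall phi, T phi -> sat (M := M) phi tt.

(** * Fraïssé limits *)

Definition finite_structure (L : language) (M : structure L) : Prop :=
  exists l : list {s : sort L & M s}, forall x, In x l.

Definition finite_subset (L : language) (M : structure L) (A : subset M) :=
  exists l : list {s : sort L & M s}, forall s x, A s x -> In (existT _ s x) l.

Definition countable_structure (L : language) (M : structure L) : Prop :=
  exists f : {s : sort L & M s} -> nat, forall x y, f x = f y -> x = y.

Definition has_age (L : language) (M : structure L) (K : structure L -> Prop) :=
  forall A : structure L,
    K A <-> finite_structure A /\ exists f : forall s, A s -> M s, embedding f.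

Definition ultrahomogeneous (L : language) (M : structure L) : Prop :=
  forall (X : subset M) (f : forall s, sub X s -> M s),
    finite_subset X -> embedding f ->
    exists g : forall s, M s -> M s,
      automorphism g /\ forall s (x : sub X s), g s (proj1_sig x) = f s x.

Definition weakly_injective (L : language) (M : structure L)
    (K : structure L -> Prop) : Prop :=
  forall X : subset M, finite_subset X ->
  exists Y : subset M, finite_subset Y /\ subset_le X Y /\
    forall (Z : structure L) (g : forall s, sub Y s -> Z s),
      K Z -> embedding g ->
      exists h : forall s, Z s -> M s, embedding h /\
        forall s (x : sub Y s), X s (proj1_sig x) -> h s (g s x) = proj1_sig x.

(* The Fraïssé limit of K, in the form (also called generic limit, or weak
   Fraïssé limit) that makes sense when K only has the weak, e.g. cofinal,
   amalgamation property.  Such a limit is unique up to isomorphism; it is the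
   usual one (countable, of age K, ultrahomogeneous) as soon as K has
   amalgamation, and [ultrahomogeneous_fraisse_limit] says that a usual limit is
   always one in this sense.  The weak form is needed for the class [KQ] below,
   which has cofinal amalgamation but not amalgamation: see
   [KQ_not_ultrahomogeneous]. *)
Definition fraisse_limit (L : language) (K : structure L -> Prop)
    (M : structure L) : Prop :=
  countable_structure M /\ has_age M K /\ weakly_injective M K.

Lemma tmap_comp (S : Type) (T U V : S -> Type) (f : forall s, T s -> U s)
    (g : forall s, U s -> V s) (G : list S) (a : tuple T G) :
  tmap g (tmap f a) = tmap (fun s x => g s (f s x)) a.
Proof. induction G; simpl; [reflexivity | now rewrite IHG]. Qed.

Lemma embedding_comp (L : language) (M N P : structure L)
    (f : forall s, M s -> N s) (g : forall s, N s -> P s) :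
  embedding f -> embedding g -> embedding (fun s x => g s (f s x)).
Proof.
intros [fi fr] [gi gr]; split.
- intros s x y H; apply fi, gi, H.
- intros r xs; rewrite (fr r xs), (gr r (tmap f xs)), tmap_comp; tauto.
Qed.

Lemma ultrahomogeneous_fraisse_limit (L : language) (K : structure L -> Prop)
    (M : structure L) :
  countable_structure M -> has_age M K -> ultrahomogeneous M ->
  fraisse_limit K M.
Proof.
intros Mc MK Mh; split; [exact Mc | split; [exact MK |]].
intros X Xf; exists X; split; [exact Xf | split; [intros s x H; exact H |]].
intros Z g KZ gE; destruct (proj1 (MK Z) KZ) as [_ [e eE]].
destruct (Mh X (fun s x => e s (g s x)) Xf (embedding_comp gE eE))
  as [a [[[ai ar] aS] aX]].
pose (b := fun s y => proj1_sig (constructive_indefinite_description _ (aS s y))).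
assert (bK : forall s y, a s (b s y) = y).
{ intros s y; unfold b.
  destruct (constructive_indefinite_description _ (aS s y)); assumption. }
assert (bE : embedding b).
{ split.
  - intros s x y H; rewrite <- (bK s x), <- (bK s y), H; reflexivity.
  - intros r xs; rewrite (ar r (tmap b xs)), tmap_comp.
    replace (tmap (fun s x => a s (b s x)) xs) with xs; [tauto |].
    generalize (arity r) xs; intros G t; induction G as [|s G IH]; simpl.
    + destruct t; reflexivity.
    + destruct t as [x t]; simpl; rewrite bK, <- IH; reflexivity. }
exists (fun s x => b s (e s x)); split; [exact (embedding_comp eE bE) |].
intros s x _; apply ai; rewrite bK, aX; reflexivity.
Qed.

(** * Algebraic closure, types, dividing and forking *)

Definition acl (L : language) (M : structure L) (A : subset M) : subset M :=
  fun s x =>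
    exists (G : list (sort L)) (phi : form L (s :: G)) (a : tuple M G),
      tall A a /\ sat phi ((x, a) : tuple M (s :: G)) /\
      exists l : list (M s),
        forall y, sat phi ((y, a) : tuple M (s :: G)) -> In y l.

(* a and b have the same type over A. *)
Definition same_type (L : language) (M : structure L) (A : subset M)
    (G : list (sort L)) (a b : tuple M G) : Prop :=
  forall (D : list (sort L)) (phi : form L (G ++ D)) (c : tuple M D),
    tall A c -> (sat phi (tapp a c) <-> sat phi (tapp b c)).

(* A formula phi(x, d), where x is a tuple of variables of sorts G and d a tuple
   of parameters from M. *)
Record pform (L : language) (M : structure L) (G : list (sort L)) := PForm {
  pctx : list (sort L);
  pphi : form L (G ++ pctx);
  pval : tuple M pctx
}.

Definition psat (L : language) (M : structure L) (G : list (sort L))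
    (chi : pform M G) (x : tuple M G) : Prop :=
  sat (pphi chi) (tapp x (pval chi)).

Definition pmap (L : language) (M N : structure L) (f : forall s, M s -> N s)
    (G : list (sort L)) (chi : pform M G) : pform N G :=
  PForm (pphi chi) (tmap f (pval chi)).

(* Partial types in the variables G over M. *)
Definition ptype (L : language) (M : structure L) (G : list (sort L)) :=
  pform M G -> Prop.

Definition tp (L : language) (M : structure L) (B : subset M)
    (G : list (sort L)) (a : tuple M G) : ptype M G :=
  fun chi => tall B (pval chi) /\ psat chi a.

(* pi(x, b), for a finite set pi of formulas in the variables (x, y). *)
Definition ptype_at (L : language) (M : structure L) (G D : list (sort L))
    (pi : list (form L (G ++ D))) (b : tuple M D) : ptype M G :=
  fun chi => exists phi, In phi pi /\ chi = PForm phi b.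

(* Dividing and forking are those of the theory of M: an arbitrary elementary
   extension plays the role of the monster model. *)
Definition divides (L : language) (M : structure L) (C : subset M)
    (G : list (sort L)) (chi : pform M G) : Prop :=
  exists (N : structure L) (f : forall s, M s -> N s) (k : nat)
      (d : nat -> tuple N (pctx chi)),
    elementary f /\
    (forall i, same_type (image f C) (d i) (tmap f (pval chi))) /\
    forall l : list nat, NoDup l -> length l = k ->
      ~ exists x : tuple N G, forall i, In i l -> psat (PForm (pphi chi) (d i)) x.

Definition forks (L : language) (M : structure L) (C : subset M)
    (G : list (sort L)) (p : ptype M G) : Prop :=
  exists (N : structure L) (f : forall s, M s -> N s)
      (ps : list (pform M G)) (ds : list (pform N G)),
    elementary f /\
    (forall chi, In chi ps -> p chi) /\
    (forall delta, In delta ds -> divides (image f C) delta) /\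
    forall x : tuple N G,
      (forall chi, In chi ps -> psat (pmap f chi) x) ->
      exists delta, In delta ds /\ psat delta x.

(** * Approximation of a structure by a system of substructures *)

Definition collection (L : language) (M : structure L) := subset M -> Prop.

Definition directed (L : language) (M : structure L) (H : collection M) : Prop :=
  (exists N, H N) /\
  forall N1 N2, H N1 -> H N2 ->
    exists N, H N /\ subset_le N1 N /\ subset_le N2 N.

(* For all large enough N in H containing a, P N. *)
Definition eventually (L : language) (M : structure L) (H : collection M)
    (G : list (sort L)) (a : tuple M G) (P : subset M -> Prop) : Prop :=
  exists N, H N /\ tall N a /\ forall N', H N' -> subset_le N N' -> P N'.

Definition eventually_true (L : language) (M : structure L) (H : collection M)
    (G : list (sort L)) (psi : form L G) (a : tuple M G) : Prop :=
  eventually H a (fun N => within (M := M) (N := N) (sat (M := sub N) psi) a).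

Definition eventually_forks (L : language) (M : structure L) (H : collection M)
    (C : subset M) (G D : list (sort L)) (pi : list (form L (G ++ D)))
    (b : tuple M D) : Prop :=
  eventually H b (fun N =>
    within (N := N) (fun b' => forks (trace N C) (ptype_at pi b')) b).

Definition eventually_does_not_fork (L : language) (M : structure L)
    (H : collection M) (C : subset M) (G D : list (sort L))
    (pi : list (form L (G ++ D))) (b : tuple M D) : Prop :=
  eventually H b (fun N =>
    within (N := N) (fun b' => ~ forks (trace N C) (ptype_at pi b')) b).

(* [indep_lim H A C B]: A is lim-independent from B over C. *)
Definition indep_lim (L : language) (M : structure L) (H : collection M)
    (A C B : subset M) : Prop :=
  forall (G : list (sort L)) (a : tuple M G), tall A a ->
    eventually H a (fun N =>
      within (N := N)
        (fun a' => ~ forks (trace N (acl C))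
                       (tp (trace N (union (acl B) (acl C))) a')) a).

Definition covering (L : language) (M : structure L) (H : collection M) : Prop :=
  forall s (x : M s), exists N, H N /\ N s x.

Definition automorphism_invariant (L : language) (M : structure L)
    (H : collection M) : Prop :=
  forall (f : forall s, M s -> M s) N, automorphism f -> H N -> H (image f N).

Definition truth_convergence (L : language) (M : structure L)
    (H : collection M) : Prop :=
  forall (G : list (sort L)) (psi : form L G) (a : tuple M G),
    sat psi a -> eventually_true H psi a.

Definition forking_stabilization (L : language) (M : structure L)
    (H : collection M) : Prop :=
  forall (G D : list (sort L)) (pi : list (form L (G ++ D))) (b : tuple M D)
      (C : subset M),
    eventually_forks H C pi b \/ eventually_does_not_fork H C pi b.

Definition strong_finite_character (L : language) (M : structure L)
    (H : collection M) : Prop :=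
  forall A B C : subset M, ~ indep_lim H A C B ->
    exists (G D E : list (sort L)) (phi : form L (G ++ (D ++ E)))
        (a : tuple M G) (b : tuple M D) (c : tuple M E),
      tall A a /\ tall (acl B) b /\ tall (acl C) c /\
      sat phi (tapp a (tapp b c)) /\
      eventually_forks H (acl C) [phi] (tapp b c).

Definition acl_stabilization (L : language) (M : structure L)
    (H : collection M) : Prop :=
  forall A : subset M, (forall s x, acl A x <-> A s x) ->
    exists N0, H N0 /\ forall N, H N -> subset_le N0 N ->
      forall s (x : sub N s), trace N A x <-> acl (trace N A) x.

Definition homogeneity (L : language) (M : structure L)
    (H : collection M) : Prop :=
  forall (N A : subset M) (G : list (sort L)) (a b : tuple (sub N) G), H N ->
    same_type A (tmap (@sub_val L M N) a) (tmap (@sub_val L M N) b) ->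
    same_type (trace N A) a b.

Definition nice_filtration (L : language) (M : structure L)
    (H H' : collection M) : Prop :=
  (forall N, H' N -> H N) /\
  directed H' /\ covering H' /\ truth_convergence H' /\
  forking_stabilization H' /\ strong_finite_character H' /\
  acl_stabilization H' /\ homogeneity H'.

Definition filtration_invariant (L : language) (M : structure L)
    (H : collection M) : Prop :=
  forall H1 H2, nice_filtration H H1 -> nice_filtration H H2 ->
    forall A B C, indep_lim H1 A C B <-> indep_lim H2 A C B.

Definition collection_image (L : language) (M : structure L)
    (f : forall s, M s -> M s) (H : collection M) : collection M :=
  fun N => exists N0, H N0 /\ N = image f N0.

Definition nice (L : language) (M : structure L) (H : collection M) : Prop :=
  covering H /\ automorphism_invariant H /\ filtration_invariant H /\
  (exists H', nice_filtration H H') /\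
  forall (H' : collection M) (f : forall s, M s -> M s),
    automorphism f -> nice_filtration H H' ->
    nice_filtration H (collection_image f H').

(* H' approximates M, as a nice filtration of the nice collection H. *)
Definition approximates (L : language) (M : structure L)
    (H H' : collection M) : Prop :=
  nice H /\ nice_filtration H H'.

(** * Parameterized equivalence relations *)

Inductive feq_sort := Obj | Par.

Definition Lfeq : language :=
  {| sort := feq_sort; rel := unit; arity := fun _ => [Par; Obj; Obj] |}.

(* E b y z is E_b(y, z). *)
Definition E (M : structure Lfeq) (b : M Par) (y z : M Obj) : Prop :=
  @interp Lfeq M tt (b, (y, (z, tt))).

Definition Kfeq (M : structure Lfeq) : Prop :=
  finite_structure M /\ forall b : M Par, Equivalence (E b).

Definition Tfeq (phi : form Lfeq []) : Prop :=
  forall F : structure Lfeq, fraisse_limit Kfeq F -> sat (M := F) phi tt.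

(* X meets at most n classes of R. *)
Definition meets_at_most (T : Type) (R : T -> T -> Prop) (X : T -> Prop)
    (n : nat) : Prop :=
  exists l : list T, length l <= n /\ forall x, X x -> exists y, In y l /\ R x y.

(* The indices of Q_i, R_i start at 1: [Q i] and [R i] are Q_{i+1} and R_{i+1},
   and come with the bound i+1.  A pair (Q_0, R_0) imposing K_0-structure would
   destroy joint embedding, a point of Q_0 and a point of R_0 being
   incompatible. *)
Inductive LQ_rel := EQ | Q (i : nat) | R (i : nat).

Definition LQ : language :=
  {| sort := feq_sort; rel := LQ_rel;
     arity := fun r => match r with
                       | EQ => [Par; Obj; Obj]
                       | Q _ => [Obj]
                       | R _ => [Par]
                       end |}.

Definition reduct (M : structure LQ) : structure Lfeq :=
  @Structure Lfeq (dom M) (fun _ => @interp LQ M EQ).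

Definition inQ (M : structure LQ) (i : nat) (x : M Obj) : Prop :=
  @interp LQ M (Q i) (x, tt).

Definition inR (M : structure LQ) (i : nat) (b : M Par) : Prop :=
  @interp LQ M (R i) (b, tt).

(* (X, Y) imposes K_n-structure on M. *)
Definition imposes (M : structure Lfeq) (X : M Obj -> Prop) (Y : M Par -> Prop)
    (n : nat) : Prop :=
  forall b, Y b -> meets_at_most (E b) X n.

Definition KQ (M : structure LQ) : Prop :=
  Kfeq (reduct M) /\
  forall i, (forall x : M Obj, inQ i x -> inQ (S i) x) /\
            (forall b : M Par, inR i b -> inR (S i) b) /\
            imposes (M := reduct M) (@inQ M i) (@inR M i) (S i).

Lemma finite_sub (L : language) (M : structure L) (A : subset M) :
  finite_subset A -> finite_structure (sub A).
Proof.
intros [l Hl].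
exists (flat_map (fun u : {s : sort L & M s} =>
  match excluded_middle_informative (A (projT1 u) (projT2 u)) with
  | left h => [existT (fun s => sub A s) (projT1 u) (exist _ (projT2 u) h)]
  | right _ => []
  end) l).
intros [s [x h]]; apply in_flat_map; exists (existT _ s x); split.
- apply Hl, h.
- simpl; destruct (excluded_middle_informative (A s x)) as [h' | n].
  + rewrite (proof_irrelevance _ h' h); left; reflexivity.
  + destruct (n h).
Qed.

(* The obstruction to amalgamation: over a parameter of R_1 and two inequivalent
   points outside Q_1, either point, but not both, may become equivalent to a
   point of Q_1. *)
Definition KQ_obstruction : structure LQ :=
  @Structure LQ (fun s => match s with Obj => option bool | Par => unit end)
    (fun r =>
       match r with
       | EQ => fun xs : unit * (option bool * (option bool * unit)) =>
           (fst (snd xs) = Some false <-> fst (snd (snd xs)) = Some false)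
       | Q i => fun xs : option bool * unit => i = 0 -> fst xs = None
       | R _ => fun _ => True
       end).

Lemma KQ_obstruction_KQ : KQ KQ_obstruction.
Proof.
split; [split |].
- exists [existT (dom KQ_obstruction) Par tt;
          existT (dom KQ_obstruction) Obj None;
          existT (dom KQ_obstruction) Obj (Some true);
          existT (dom KQ_obstruction) Obj (Some false)].
  intros [[|] x]; [destruct x as [[|]|] | destruct x]; simpl; tauto.
- intros b; split; red; unfold E; simpl; tauto.
- intros i; split; [| split]; simpl.
  + intros x _ H; discriminate.
  + exact (fun _ H => H).
  + intros b _; destruct i as [|i].
    * exists [None]; split; [simpl; lia |].
      intros x Hx; exists None; specialize (Hx eq_refl); simpl in Hx;
      subst x; split; [left; reflexivity |].
      unfold E; simpl; tauto.
    * exists [None; Some false]; split; [simpl; lia |].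
      intros [[|]|] _; unfold E; simpl;
        [exists None | exists (Some false) | exists None]; simpl;
        intuition discriminate.
Qed.

Lemma KQ_not_ultrahomogeneous (M : structure LQ) :
  has_age M KQ -> ~ ultrahomogeneous M.
Proof.
intros MK Mh.
destruct (proj1 (MK _) KQ_obstruction_KQ) as [_ [f [fi fr]]].
pose (q := f Obj None); pose (c := f Obj (Some true)).
pose (d := f Obj (Some false)); pose (b := f Par tt).
assert (KF : forall Y : subset M, finite_subset Y -> KQ (sub Y)).
{ intros Y HY; apply MK; split; [apply finite_sub, HY |].
  exists (@sub_val _ M Y); split; [| simpl; tauto].
  intros s [x hx] [y hy]; simpl; intros <-.
  rewrite (proof_irrelevance _ hx hy); reflexivity. }
assert (Erefl : forall x, @E (reduct M) b x x).
{ intros x; pose (Y := (fun s : feq_sort => match s return M s -> Prop with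
      Obj => fun y => y = x | Par => fun y => y = b end) : subset M).
  destruct (KF Y) as [[_ KE] _].
  - exists [existT _ Obj x; existT _ Par b].
    intros [|] y Hy; simpl in Hy; subst; simpl; tauto.
  - destruct (KE (exist _ b eq_refl)) as [r _ _].
    exact (r (exist (fun y => y = x) x eq_refl)). }
assert (cd : c <> d) by (intros H; discriminate (fi Obj _ _ H)).
assert (ncd : ~ @E (reduct M) b c d).
{ intros H; assert (H' := proj2 (fr EQ (tt, (Some true, (Some false, tt)))) H).
  simpl in H'; intuition discriminate. }
assert (ndc : ~ @E (reduct M) b d c).
{ intros H; assert (H' := proj2 (fr EQ (tt, (Some false, (Some true, tt)))) H).
  simpl in H'; intuition discriminate. }
assert (qc : @E (reduct M) b c q).
{ apply (proj1 (fr EQ (tt, (Some true, (None, tt))))); simpl.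
  intuition discriminate. }
assert (qQ : inQ 0 q) by (apply (proj1 (fr (Q 0) (None, tt))); simpl; tauto).
assert (cdQ : forall i, inQ i c <-> inQ i d).
{ intros i; assert (H1 := fr (Q i) (Some true, tt)).
  assert (H2 := fr (Q i) (Some false, tt)).
  change ((i = 0 -> Some true = None) <-> inQ i c) in H1.
  change ((i = 0 -> Some false = None) <-> inQ i d) in H2.
  rewrite <- H1, <- H2; intuition discriminate. }
(* exchange c and d, fixing b *)
pose (X := (fun s : feq_sort => match s return M s -> Prop with
    Obj => fun y => y = c \/ y = d | Par => fun y => y = b end) : subset M).
pose (g := fun s : feq_sort => match s return @sub LQ M X s -> M s with
    | Obj => fun y => if excluded_middle_informative (proj1_sig y = c) then d else c
    | Par => fun y => proj1_sig y end).
assert (gc : forall h, g Obj (exist _ c h) = d).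
{ intros h; simpl; destruct (excluded_middle_informative (c = c)); tauto. }
assert (gd : forall h, g Obj (exist _ d h) = c).
{ intros h; simpl; destruct (excluded_middle_informative (d = c)); [|tauto].
  congruence. }
assert (gE : @embedding LQ (sub X) M g).
{ split.
  - intros [|] [x hx] [y hy]; simpl in hx, hy.
    + destruct hx as [-> | ->], hy as [-> | ->]; rewrite ?gc, ?gd; intros H;
        try (destruct cd; congruence); f_equal; apply proof_irrelevance.
    + simpl; intros <-; f_equal; apply proof_irrelevance.
  - intros [| i | i] xs.
    + destruct xs as [[p hp] [[x hx] [[y hy] []]]].
      change (@E (reduct M) p x y
        <-> @E (reduct M) p (g Obj (exist _ x hx)) (g Obj (exist _ y hy))).
      simpl in hp, hx, hy; subst p.
      destruct hx as [-> | ->], hy as [-> | ->]; rewrite ?gc, ?gd;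
        split; intros H; try apply Erefl; tauto.
    + destruct xs as [[x hx] []].
      change (inQ i x <-> inQ i (g Obj (exist _ x hx))).
      simpl in hx; destruct hx as [-> | ->]; rewrite ?gc, ?gd;
        specialize (cdQ i); tauto.
    + destruct xs as [[x hx] []]; simpl; tauto. }
destruct (Mh X g) as [a [[[ai ar] _] aX]].
{ exists [existT _ Obj c; existT _ Obj d; existT _ Par b].
  intros [|] y Hy; simpl in Hy; [destruct Hy|]; subst; simpl; tauto. }
{ exact gE. }
assert (ac : a Obj c = d) by (rewrite <- (gc (or_introl eq_refl)); 
  exact (aX Obj (exist _ c (or_introl eq_refl)))).
assert (ab : a Par b = b) by (exact (aX Par (exist _ b eq_refl))).
pose (q' := a Obj q).
assert (qd : @E (reduct M) b d q').
{ rewrite <- ac, <- ab; apply (proj1 (ar EQ (b, (c, (q, tt))))), qc. }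
assert (qQ' : inQ 0 q') by (apply (proj1 (ar (Q 0) (q, tt))), qQ).
assert (bR : inR 0 b) by (apply (proj1 (fr (R 0) (tt, tt))); exact I).
pose (Y := (fun s : feq_sort => match s return M s -> Prop with
    Obj => fun y => y = c \/ y = d \/ y = q \/ y = q' | Par => fun y => y = b end)
  : subset M).
destruct (KF Y) as [[_ KE] KY].
{ exists [existT _ Obj c; existT _ Obj d; existT _ Obj q; existT _ Obj q';
          existT _ Par b].
  intros [|] y Hy; simpl in Hy; intuition; subst; simpl; tauto. }
destruct (KY 0) as [_ [_ KI]].
pose (b0 := exist (Y Par) b eq_refl : sub Y Par).
assert (hc : Y Obj c) by (simpl; tauto).
assert (hd : Y Obj d) by (simpl; tauto).
assert (hq : Y Obj q) by (simpl; tauto).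
assert (hq' : Y Obj q') by (simpl; tauto).
destruct (KI b0 bR) as [l [ll Hl]].
destruct (Hl (exist _ q hq) qQ) as [y [y1 y2]].
destruct (Hl (exist _ q' hq') qQ') as [z [z1 z2]].
assert (yz : y = z).
{ destruct l as [|u [|v l]]; simpl in *; [tauto | | lia].
  destruct y1 as [<-|[]], z1 as [<-|[]]; reflexivity. }
subst z; destruct (KE b0) as [Kr Ks Kt].
apply ncd.
change (@E (reduct (sub Y)) b0 (exist _ c hc) (exist _ d hd)).
apply Kt with (exist _ q hq : sub Y Obj); [exact qc |].
apply Kt with y; [exact y2 |]; apply Ks.
apply Kt with (exist _ q' hq' : sub Y Obj); [exact qd | exact z2].
Qed.

(** * The structures M_n and their union *)

Definition level (MQ : structure LQ) (n : nat) : subset (reduct MQ) :=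
  fun s => match s return MQ s -> Prop with
           | Obj => @inQ MQ n
           | Par => @inR MQ n
           end.

(* As for Q and R, [M_ MQ n] is M_{n+1}. *)
Definition M_ (MQ : structure LQ) (n : nat) : structure Lfeq :=
  sub (@level MQ n).

Definition Mlim (MQ : structure LQ) : structure Lfeq :=
  sub (M := reduct MQ) (fun s x => exists n, level n x).

(* The substructure M_n of [Mlim MQ]. *)
Definition part (MQ : structure LQ) (n : nat) : subset (Mlim MQ) :=
  fun s x => @level MQ n s (proj1_sig x).

Definition copies (MQ : structure LQ) : collection (Mlim MQ) :=
  fun N => exists n, isomorphic (sub N) (M_ MQ n).

Definition parts (MQ : structure LQ) : collection (Mlim MQ) :=
  fun N => exists n, N = @part MQ n.

(* Main.v *)
From Stdlib Require Import List Lia Arith FinFun Cantor Eqdep Classical ClassicalEpsilon RelationClasses.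
Require Import Defs.
Import ListNotations.

(* Call a structure generic when every E_b is an equivalence relation with a fixed
   number of classes (n or infinity) and all compatible one-point extensions are
   realized: an object in prescribed classes, a parameter inducing a prescribed
   coloring.  Back and forth gives quantifier elimination, in a form that also
   compares two generic structures whose numbers of classes are both large with
   respect to the formula.  The structures M_n and M are generic, with n and
   infinitely many classes; this gives truth convergence and homogeneity.

   In a countable generic structure with finitely many classes, algebraic closure is
   trivial and the only source of forking is equality.  Indeed, if x satisfies
   phi(x, d) and x meets d inside C, then, given a sequence d_i of conjugates of d
   over C, Ramsey's theorem thins it out until the d_i only share constant
   coordinates and, the classes being finitely many, until conjugates x_i of x over
   d_i agree on the classes of the shared parameters; one x' then satisfies any
   finite number of the phi(x', d_i).  So pi(x, b) does not fork over C exactly when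
   it has a solution x with x and b meeting inside C, which is a first-order property
   of b, and lim-independence of A and B over C just says that A and acl B meet inside
   acl C.

   All of this only uses that the members of the system are copies of the M_n.  Hence
   every directed covering subset of H is a nice filtration, and all of them define
   the same lim-independence. *)

Set Implicit Arguments.
Unset Strict Implicit.

(** * Variables and tuples *)

(** Dividing and forking quantify over all elementary extensions, of any cardinality. This is why
    genericity is a scheme of first-order conditions, which passes to such extensions, and why
    constructions in them proceed through finite tuples. Countability enters when dividing or
    infinitely many conjugates have to be exhibited: a countable structure with infinitely many
    copies of each point is then mapped into M.

    The bound on the number of classes cannot be dropped in the analysis of forking. With infinitely
    many classes, E_b(x, a) divides over b, as the conjugates of a over b may lie in distinct
    classes, although x can be kept away from a and b. The description of forking thus holds in the
    M_n and fails in M.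

    In the limit of K_Q the difficulty is weak injectivity: an extension by one point has to be
    prescribed over a finite set larger than the one of interest, whose other elements are not under
    control, and a point in a new class of a parameter must respect the class bounds of all higher
    levels at once. *)

(** Inversion of a variable of a nonempty context. The return type is computed from the context, so
    that no equality between sorts arises. *)
Definition var_case (S : Type) (t : S) (G : list S)
    (P : forall s, var (t :: G) s -> Prop)
    (hz : P t (vz t G)) (hs : forall s (w : var G s), P s (vs t w)) :
    forall s v, P s v :=
  fun s v =>
    match v as v' in var D s'
      return match D return var D s' -> Prop with
             | [] => fun _ => True
             | t' :: G' => fun v' =>
                 forall P : forall s, var (t' :: G') s -> Prop,
                   P t' (vz t' G') -> (forall s w, P s (vs t' w)) -> P s' v'
             end v'
    with
    | vz _ _ => fun _ hz _ => hz
    | vs _ w => fun _ _ hs => hs _ w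
    end P hz hs.

Definition var_nil (S : Type) (s : S) (v : var [] s) : False :=
  match v in var D _ return match D with [] => False | _ => True end with
  | vz _ _ => I
  | vs _ _ => I
  end.

(** The length bound limits the number of classes that a tuple can meet, as [forth] requires. *)
Lemma var_finite (S : Type) (G : list S) (s : S) :
  exists l : list (var G s), (forall v, In v l) /\ length l <= length G.
Proof.
induction G as [|t G [l [Hl Ll]]].
- exists []; split; [intros v; destruct (var_nil v) | simpl; lia].
- destruct (classic (t = s)) as [<- | n].
  + exists (vz t G :: map (fun w => vs t w) l); split.
    * intros v.
      (* The equation [e] leaves the sort of the variable free, as [var_case] demands. *)
      assert (H : forall s' (v : var (t :: G) s') (e : s' = t),
        (forall w : var G t, In w l) ->
        In (eq_rect s' (var (t :: G)) v t e) (vz t G :: map (fun w => vs t w) l)).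
      { intros s' v'; apply (var_case (P := fun s' v' => forall e : s' = t,
          (forall w : var G t, In w l) ->
          In (eq_rect s' (var (t :: G)) v' t e) (vz t G :: map (fun w => vs t w) l))).
        - intros e _; rewrite (proof_irrelevance _ e eq_refl); now left.
        - intros s0 w e H; subst s0; right; apply (in_map (fun w => vs t w)), H. }
      exact (H t v eq_refl Hl).
    * simpl; rewrite length_map; lia.
  + exists (map (fun w => vs t w) l); split.
    * intros v; revert l Hl Ll n.
      apply (var_case (P := fun s v => forall l : list (var G s),
        (forall w, In w l) -> length l <= length G -> t <> s ->
        In v (map (fun w => vs t w) l))).
      -- intros l _ _ n; now destruct n.
      -- intros s' w l Hl _ _; apply (in_map (fun w => vs t w)), Hl.
    * rewrite length_map; simpl; lia.
Qed.

Lemma tuple_ext (S : Type) (T : S -> Type) (G : list S) (a b : tuple T G) :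
  (forall s (v : var G s), tnth v a = tnth v b) -> a = b.
Proof.
induction G as [|t G IH]; simpl in *.
- now destruct a, b.
- destruct a as [x a], b as [y b]; intros H; f_equal.
  + exact (H _ (vz t G)).
  + apply IH; intros s v; exact (H _ (vs t v)).
Qed.

Lemma tuple_of (S : Type) (T : S -> Type) (G : list S)
    (F : forall s, var G s -> T s) :
  exists a : tuple T G, forall s (v : var G s), tnth v a = F s v.
Proof.
induction G as [|t G IH].
- exists tt; intros s v; destruct (var_nil v).
- destruct (IH (fun s v => F s (vs t v))) as [a Ha].
  exists (F t (vz t G), a).
  apply (var_case (P := fun s v => tnth v ((F t (vz t G), a) : tuple T (t :: G))
    = F s v)); [reflexivity | exact Ha].
Qed.

Lemma tnth_tmap (S : Type) (T U : S -> Type) (f : forall s, T s -> U s)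
    (G : list S) (s : S) (v : var G s) (a : tuple T G) :
  tnth v (tmap f a) = f s (tnth v a).
Proof. induction v; simpl; [reflexivity | apply IHv]. Qed.

Lemma tmap_id (S : Type) (T : S -> Type) (G : list S) (a : tuple T G) :
  tmap (fun s x => x) a = a.
Proof. apply tuple_ext; intros s v; apply tnth_tmap. Qed.

Lemma tmap_tapp (S : Type) (T U : S -> Type) (f : forall s, T s -> U s)
    (G D : list S) (a : tuple T G) (b : tuple T D) :
  tmap f (tapp a b) = tapp (tmap f a) (tmap f b).
Proof. induction G; simpl; [reflexivity | now rewrite IHG]. Qed.

Lemma tall_tnth (S : Type) (T : S -> Type) (A : forall s, T s -> Prop)
    (G : list S) (a : tuple T G) :
  tall A a <-> forall s (v : var G s), A s (tnth v a).
Proof.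
induction G as [|t G IH].
- split; [intros _ s v; destruct (var_nil v) | simpl; tauto].
- destruct a as [x a]; simpl; rewrite IH; split.
  + intros [H1 H2].
    apply (var_case (P := fun s v => A s (tnth v ((x, a) : tuple T (t :: G)))));
      assumption.
  + intros H; split; [exact (H _ (vz t G)) | intros s v; exact (H _ (vs t v))].
Qed.

Fixpoint varl (S : Type) (G D : list S) (s : S) (v : var G s) : var (G ++ D) s :=
  match v in var G s return var (G ++ D) s with
  | vz s G => vz s (G ++ D)
  | vs t w => vs t (varl D w)
  end.

Fixpoint varr (S : Type) (G D : list S) (s : S) (v : var D s) : var (G ++ D) s :=
  match G return var (G ++ D) s with
  | [] => v
  | t :: G' => vs t (varr G' v)
  end.

Lemma tnth_varl (S : Type) (T : S -> Type) (G D : list S) (s : S) (v : var G s)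
    (a : tuple T G) (b : tuple T D) :
  tnth (varl D v) (tapp a b) = tnth v a.
Proof. induction v; simpl; [reflexivity | apply IHv]. Qed.

Lemma tnth_varr (S : Type) (T : S -> Type) (G D : list S) (s : S) (v : var D s)
    (a : tuple T G) (b : tuple T D) :
  tnth (varr G v) (tapp a b) = tnth v b.
Proof. induction G; simpl; [reflexivity | apply IHG]. Qed.

Lemma var_app (S : Type) (G D : list S) (s : S) (v : var (G ++ D) s) :
  (exists w, v = varl D w) \/ (exists w, v = varr G w).
Proof.
induction G as [|t G IH]; simpl in *.
- right; now exists v.
- revert IH.
  apply (var_case (P := fun s v => (forall v : var (G ++ D) s,
      (exists w, v = varl D w) \/ (exists w, v = varr G w)) ->
      (exists w : var (t :: G) s, v = varl D w) \/
      (exists w, v = vs t (varr G w)))).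
  + intros _; left; now exists (vz t G).
  + intros s' w H; destruct (H w) as [[u ->] | [u ->]].
    * left; now exists (vs t u).
    * right; now exists u.
Qed.

(** * Partial isomorphisms *)

(** Partial isomorphisms are relations, so that one notion covers pairs of tuples, possibly with
    repetitions, graphs of embeddings and unions of chains. *)
Definition piso (M N : structure Lfeq) (r : forall s : feq_sort, M s -> N s -> Prop) :
    Prop :=
  (forall s x x' y y', r s x x' -> r s y y' -> (x = y <-> x' = y')) /\
  (forall p p' x x' y y', r Par p p' -> r Obj x x' -> r Obj y y' ->
    (E p x y <-> E p' x' y')).

Definition pairs (M N : structure Lfeq) (G : list feq_sort) (a : tuple M G)
    (a' : tuple N G) (s : feq_sort) (x : M s) (x' : N s) : Prop :=
  exists v : var G s, tnth v a = x /\ tnth v a' = x'.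

Lemma piso_sub (M N : structure Lfeq) (r r' : forall s : feq_sort, M s -> N s -> Prop) :
  piso r' -> (forall s x x', r s x x' -> r' s x x') -> piso r.
Proof.
intros [H1 H2] H; split; intros; [eapply H1 | eapply H2]; eauto.
Qed.

Lemma piso_flip (M N : structure Lfeq) (r : forall s : feq_sort, M s -> N s -> Prop) :
  piso r -> piso (fun s x x' => r s x' x).
Proof.
intros [H1 H2]; split; intros; symmetry; [eapply H1 | eapply H2]; eauto.
Qed.

(** Elimination principle for the pairs of a longer tuple: a relation [r] defined by cases on the
    sort tells what such a pair can be. *)
Lemma pairs_cons (M N : structure Lfeq) (G : list feq_sort) (a : tuple M G)
    (a' : tuple N G) (t : feq_sort) (x : M t) (x' : N t)
    (r : forall s : feq_sort, M s -> N s -> Prop) :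
  r t x x' -> (forall s y y', pairs a a' y y' -> r s y y') ->
  forall s y y',
    pairs ((x, a) : tuple M (t :: G)) ((x', a') : tuple N (t :: G)) y y' ->
    r s y y'.
Proof.
intros H1 H2 s y y' [v [<- <-]]; revert s v.
apply (var_case (P := fun s v => r s
  (tnth v ((x, a) : tuple M (t :: G))) (tnth v ((x', a') : tuple N (t :: G))))).
- exact H1.
- intros s w; apply H2; now exists w.
Qed.

Lemma pairs_cons_inv (M N : structure Lfeq) (G : list feq_sort) (a : tuple M G)
    (a' : tuple N G) (t : feq_sort) (x : M t) (x' : N t) s y y' :
  pairs a a' y y' ->
  pairs ((x, a) : tuple M (t :: G)) ((x', a') : tuple N (t :: G)) (s := s) y y'.
Proof. intros [v Hv]; now exists (vs t v). Qed.

Lemma pairs_tapp (M N : structure Lfeq) (G D : list feq_sort) (a : tuple M G)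
    (a' : tuple N G) (b : tuple M D) (b' : tuple N D) (s : feq_sort) x x' :
  pairs (tapp a b) (tapp a' b') (s := s) x x' <->
  pairs a a' x x' \/ pairs b b' x x'.
Proof.
split.
- intros [v [<- <-]]; destruct (var_app v) as [[w ->] | [w ->]].
  + left; exists w; now rewrite !tnth_varl.
  + right; exists w; now rewrite !tnth_varr.
- intros [[v [<- <-]] | [v [<- <-]]].
  + exists (varl D v); now rewrite !tnth_varl.
  + exists (varr G v); now rewrite !tnth_varr.
Qed.

(** * Generic structures *)

(* The predicate P stands for a number of classes, finite or infinite: P j means
   that there are more than j classes. *)
Definition fits (P : nat -> Prop) (M : structure Lfeq) : Prop :=
  (forall b : M Par, Equivalence (E b)) /\
  forall (b : M Par) (f : nat -> M Obj) (j : nat),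
    (forall i i', i < i' <= j -> ~ E b (f i) (f i')) -> P j.

(** The lists [av] make the realized points new. A parameter is prescribed by coloring objects with
    colors that satisfy [P], so that there are classes enough for the colors; [gen_class] and [fits]
    pin down the number of classes of every parameter. *)
Record generic (P : nat -> Prop) (N : structure Lfeq) : Prop := {
  gen_fits : fits P N;
  gen_obj : inhabited (N Obj);
  gen_zero : P 0;
  gen_class : forall (b : N Par) (f : nat -> N Obj) (j : nat), P j ->
    exists x, forall i, i < j -> ~ E b x (f i);
  gen_ext_obj : forall (bs : list (N Par)) (y : N Par -> N Obj)
      (av : list (N Obj)),
    exists x, ~ In x av /\ forall b, In b bs -> E b x (y b);
  gen_ext_par : forall (os : list (N Obj)) (c : N Obj -> nat)
      (av : list (N Par)),
    (forall x, P (c x)) ->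
    exists b, ~ In b av /\
      forall x y, In x os -> In y os -> (E b x y <-> c x = c y)
}.

Lemma class_reps (T : Type) (R : T -> T -> Prop) (l : list T) (t0 : T) :
  Equivalence R ->
  exists (k : nat) (f : nat -> T), k <= length l /\
    (forall i, i < k -> In (f i) l) /\
    (forall i i', i < i' < k -> ~ R (f i) (f i')) /\
    forall x, In x l -> exists i, i < k /\ R (f i) x.
Proof.
intros [Rr Rs Rt]; induction l as [|x l (k & f & H1 & H2 & H3 & H4)].
- exists 0, (fun _ => t0); simpl; repeat split; intros; lia || tauto.
- destruct (classic (exists i, i < k /\ R (f i) x)) as [Hx | Hx].
  + exists k, f; simpl; repeat split; auto.
    intros y [<- | Hy]; auto.
  + exists (S k), (fun i => if i =? k then x else f i); simpl; repeat split.
    * lia.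
    * intros i Hi; destruct (Nat.eqb_spec i k); [now left | right; apply H2; lia].
    * intros i i' Hi; destruct (Nat.eqb_spec i k); [lia |].
      destruct (Nat.eqb_spec i' k).
      -- intros H; apply Hx; exists i; split; [lia | exact H].
      -- apply H3; lia.
    * intros y [<- | Hy].
      -- exists k; rewrite Nat.eqb_refl; split; [lia | apply Rr].
      -- destruct (H4 y Hy) as [i [Hi Hr]]; exists i; split; [lia |].
         destruct (Nat.eqb_spec i k); [lia | exact Hr].
Qed.

(** Classes are numbered by representatives. A point of color [c x] comes with c x + 1 inequivalent
    points, which is how [fits] yields [P (c x)]. *)
Lemma class_index (T : Type) (R : T -> T -> Prop) (l : list T) :
  Equivalence R ->
  exists c : T -> nat,
    (forall x y, In x l -> In y l -> (c x = c y <-> R x y)) /\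
    forall x, In x l -> c x < length l /\
      exists f : nat -> T, forall i i', i < i' <= c x -> ~ R (f i) (f i').
Proof.
intros HR; destruct l as [|t0 l'].
{ exists (fun _ => 0); simpl; tauto. }
remember (t0 :: l') as l; clear Heql l'.
destruct (@class_reps T R l t0 HR) as (k & f & H1 & H2 & H3 & H4).
destruct HR as [Rr Rs Rt].
assert (H : forall x, exists i, In x l -> i < k /\ R (f i) x).
{ intros x; destruct (classic (In x l)) as [h | h].
  - destruct (H4 x h) as [i Hi]; now exists i.
  - exists 0; tauto. }
apply choice in H as [c Hc]; exists c; split.
- intros x y hx hy; destruct (Hc x hx) as [cx rx], (Hc y hy) as [cy ry]; split.
  + intros e; rewrite e in rx; apply Rt with (f (c y)); auto.
  + intros r; assert (R (f (c x)) (f (c y))) by (apply Rt with x; eauto).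
    destruct (Nat.lt_total (c x) (c y)) as [h | [h | h]]; [| exact h |].
    * destruct (H3 (c x) (c y)); [lia | assumption].
    * destruct (H3 (c y) (c x)); [lia | auto].
- intros x hx; destruct (Hc x hx); split; [lia |].
  exists f; intros; apply H3; lia.
Qed.

(** The tuple [a] meets at most [length G] classes of a parameter, hence only the values of [P] and
    [P'] up to that length matter. *)
Lemma forth (P P' : nat -> Prop) (Z N : structure Lfeq) (G : list feq_sort)
    (a : tuple Z G) (a' : tuple N G) (s : feq_sort) (x : Z s) :
  fits P Z -> generic P' N -> (forall j, j <= length G -> P j -> P' j) ->
  piso (pairs a a') ->
  exists x' : N s,
    piso (pairs ((x, a) : tuple Z (s :: G)) ((x', a') : tuple N (s :: G))).
Proof.
intros [ZE ZP] gN HP [He HE].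
destruct (classic (exists v : var G s, tnth v a = x)) as [[v Hv] | nx].
{ exists (tnth v a'); apply piso_sub with (r' := pairs a a'); [now split |].
  apply pairs_cons; [now exists v | auto]. }
destruct (var_finite G Obj) as [vo [Hvo Lvo]].
destruct (var_finite G Par) as [vp [Hvp Lvp]].
destruct (gen_fits gN) as [NE NP].
(* Any [x'] outside [a'] settles the equality half of [piso], for both sorts at once. *)
assert (fresh : forall x' : N s, (forall v : var G s, tnth v a' <> x') ->
  forall t (y : Z t) (y' : N t) (z : Z t) (z' : N t),
  pairs ((x, a) : tuple Z (s :: G)) ((x', a') : tuple N (s :: G)) y y' ->
  pairs ((x, a) : tuple Z (s :: G)) ((x', a') : tuple N (s :: G)) z z' ->
  (y = z <-> y' = z')).
{ intros x' nx' t y y' z z' [u [<- <-]] [v [<- <-]]; revert t u v.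
  apply (var_case (P := fun t u => forall v : var (s :: G) t,
    tnth u ((x, a) : tuple Z (s :: G)) = tnth v ((x, a) : tuple Z (s :: G)) <->
    tnth u ((x', a') : tuple N (s :: G)) = tnth v ((x', a') : tuple N (s :: G)))).
  - intros v; revert nx nx'; revert x x'; revert v.
    enough (H : forall t (v : var (s :: G) t) (e : t = s) (x : Z s) (x' : N s),
      ~ (exists v : var G s, tnth v a = x) ->
      (forall v : var G s, tnth v a' <> x') ->
      let v' := eq_rect t (var (s :: G)) v s e in
      (x = tnth v' ((x, a) : tuple Z (s :: G)) <->
       x' = tnth v' ((x', a') : tuple N (s :: G)))).
    { intros v; exact (H s v eq_refl). }
    apply (var_case (P := fun t v => forall (e : t = s) (x : Z s) (x' : N s),
      ~ (exists v : var G s, tnth v a = x) ->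
      (forall v : var G s, tnth v a' <> x') ->
      let v' := eq_rect t (var (s :: G)) v s e in
      (x = tnth v' ((x, a) : tuple Z (s :: G)) <->
       x' = tnth v' ((x', a') : tuple N (s :: G))))).
    + intros e; rewrite (proof_irrelevance _ e eq_refl); simpl; tauto.
    + intros t w e; subst t; simpl; intros x0 x0' n n'; split; intros h.
      * destruct n; exists w; auto.
      * destruct (n' w); auto.
  - intros t u v; revert u nx nx'; revert x x'; revert t v.
    apply (var_case (P := fun t v => forall (x : Z s) (x' : N s) (u : var G t),
      ~ (exists v : var G s, tnth v a = x) ->
      (forall v : var G s, tnth v a' <> x') ->
      (tnth u a = tnth v ((x, a) : tuple Z (s :: G)) <->
       tnth u a' = tnth v ((x', a') : tuple N (s :: G))))).
    + simpl; intros x0 x0' u n n'; split; intros h.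
      * destruct n; eauto.
      * destruct (n' u); auto.
    + simpl; intros t v x0 x0' u _ _; apply He; [now exists u | now exists v]. }
destruct s.
(* [y] represents the class of [b] that [x'] has to join: that of a coordinate of [a'] if [x] is
   equivalent to the matching coordinate of [a], and otherwise a class that [a'] misses. *)
- assert (H : forall b : N Par, exists y : N Obj, forall p : var G Par,
    tnth p a' = b -> forall u : var G Obj,
    E (tnth p a) (tnth u a) x <-> E b (tnth u a') y).
  { intros b; destruct (classic (exists p : var G Par, tnth p a' = b))
      as [[p Hp] | nb].
    2:{ destruct (gen_obj gN) as [o]; exists o; intros p Hp; destruct nb; eauto. }
    assert (Hb : forall q : var G Par, tnth q a' = b -> tnth q a = tnth p a).
    { intros q Hq; apply (He Par (tnth q a) (tnth q a') (tnth p a) (tnth p a'));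
        [now exists q | now exists p | congruence]. }
    destruct (ZE (tnth p a)) as [Zr Zs Zt], (NE b) as [Nr Ns Nt].
    destruct (classic (exists u : var G Obj, E (tnth p a) (tnth u a) x))
      as [[u Hu] | nu].
    - exists (tnth u a'); intros q Hq v; rewrite (Hb q Hq), <- Hp.
      rewrite <- (HE (tnth p a) (tnth p a') (tnth v a) (tnth v a')
        (tnth u a) (tnth u a'));
        [| now exists p | now exists v | now exists u].
      split; intros h; eauto.
    - assert (EqR : Equivalence (fun u v : var G Obj =>
          E (tnth p a) (tnth u a) (tnth v a))).
      { split; red; intros; eauto. }
      destruct vo as [|v0 vo'] eqn:Evo.
      { destruct (gen_obj gN) as [o]; exists o; intros q _ u; destruct (Hvo u). }
      rewrite <- Evo in *; clear Evo vo'.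
      destruct (@class_reps _ _ vo v0 EqR) as (k & f & H1 & H2 & H3 & H4).
      (* The [k] representatives and [x] are k + 1 inequivalent objects; since k is at most
         [length G], this carries over to [P']. *)
      assert (Pk : P k).
      { apply (ZP (tnth p a) (fun i => if i =? k then x else tnth (f i) a)).
        intros i i' Hi; destruct (Nat.eqb_spec i k); [lia |].
        destruct (Nat.eqb_spec i' k).
        - intros h; apply nu; eauto.
        - apply H3; lia. }
      apply HP in Pk; [| lia].
      destruct (gen_class gN b (fun i => tnth (f i) a') Pk) as [y Hy].
      exists y; intros q Hq v; rewrite (Hb q Hq); split; intros h;
        [destruct nu; eauto |].
      destruct (H4 v (Hvo v)) as [i [Hi r]].
      destruct (Hy i Hi).
      apply Ns, Nt with (tnth v a'); [| exact h].
      rewrite <- Hp; apply (HE (tnth p a) (tnth p a') (tnth (f i) a)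
        (tnth (f i) a') (tnth v a) (tnth v a'));
        [now exists p | now exists (f i) | now exists v | exact r]. }
  apply choice in H as [y Hy].
  destruct (gen_ext_obj gN (map (fun v => tnth v a') vp) y
    (map (fun v => tnth v a') vo)) as [x' [nx' Hx']].
  assert (Hf : forall v : var G Obj, tnth v a' <> x').
  { intros v h; apply nx'; rewrite <- h.
    apply (in_map (fun v => tnth v a')), Hvo. }
  assert (Hx : forall p u : var G _, E (tnth p a) (tnth u a) x <->
      E (tnth p a') (tnth u a') x').
  { intros p u; rewrite (Hy _ p eq_refl u).
    destruct (NE (tnth p a')) as [Nr Ns Nt].
    assert (E (tnth p a') x' (y (tnth p a')))
      by (apply Hx', (in_map (fun v => tnth v a')), Hvp).
    split; intros; eauto. }
  exists x'; split; [apply fresh, Hf |].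
  assert (Hpar : forall p p', pairs ((x, a) : tuple Z (Obj :: G))
      ((x', a') : tuple N (Obj :: G)) (s := Par) p p' -> pairs a a' p p').
  { intros o1 o2 Ho; refine (pairs_cons (r := fun s => match s return Z s -> N s -> Prop with
      | Obj => fun _ _ => True | Par => fun p p' => pairs a a' p p' end)
      _ _ Ho); [exact I |].
    intros [|] ? ?; auto. }
  assert (Hobj : forall o o', pairs ((x, a) : tuple Z (Obj :: G))
      ((x', a') : tuple N (Obj :: G)) (s := Obj) o o' ->
      (o = x /\ o' = x') \/ pairs a a' o o').
  { intros o1 o2 Ho; refine (pairs_cons (r := fun s => match s return Z s -> N s -> Prop with
      | Obj => fun o o' => (o = x /\ o' = x') \/ pairs a a' o o'
      | Par => fun _ _ => True end) _ _ Ho); [now left |].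
    intros [|] ? ?; auto. }
  intros p p' u u' v v' Rp Ru Rv.
  apply Hpar in Rp; apply Hobj in Ru; apply Hobj in Rv.
  assert (Rp' := Rp); destruct Rp' as [q [<- <-]].
  destruct (ZE (tnth q a)) as [Zr Zs Zt], (NE (tnth q a')) as [Nr Ns Nt].
  destruct Ru as [[-> ->] | Ru], Rv as [[-> ->] | Rv].
  + split; intros _; [apply Nr | apply Zr].
  + destruct Rv as [w [<- <-]]; specialize (Hx q w); split; intros h;
      [apply Ns, Hx, Zs, h | apply Zs, Hx, Ns, h].
  + destruct Ru as [w [<- <-]]; apply Hx.
  + now apply HE.
(* The classes of the new parameter on the objects of [a] become a coloring of the variables, to be
   copied on [a']. *)
- destruct (@class_index (var G Obj) (fun u v => E x (tnth u a) (tnth v a)) vo)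
    as [c [Hc1 Hc2]].
  { destruct (ZE x) as [Zr Zs Zt]; split; red; intros; eauto. }
  assert (H : forall y : N Obj, exists k, P' k /\
    forall u : var G Obj, tnth u a' = y -> k = c u).
  { intros y; destruct (classic (exists u : var G Obj, tnth u a' = y))
      as [[u Hu] | ny].
    - destruct (Hc2 u (Hvo u)) as [h [f Hf]]; exists (c u); split.
      + apply HP; [lia |]; apply (ZP x (fun i => tnth (f i) a)), Hf.
      + intros v Hv; apply Hc1; auto.
        replace (tnth u a) with (tnth v a).
        * destruct (ZE x) as [Zr _ _]; apply Zr.
        * apply (He Obj (tnth v a) (tnth v a') (tnth u a) (tnth u a'));
            [now exists v | now exists u | congruence].
    (* Objects outside [a'] get color 0, which [gen_zero] allows. *)
    - exists 0; split; [apply gN |]; intros u Hu; destruct ny; eauto. }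
  apply choice in H as [c' Hc'].
  destruct (gen_ext_par gN (map (fun v => tnth v a') vo) (c := c')
    (map (fun v => tnth v a') vp)) as [x' [nx' Hx']].
  { intros y; apply Hc'. }
  assert (Hf : forall v : var G Par, tnth v a' <> x').
  { intros v h; apply nx'; rewrite <- h.
    apply (in_map (fun v => tnth v a')), Hvp. }
  exists x'; split; [apply fresh, Hf |].
  assert (Hobj : forall p p', pairs ((x, a) : tuple Z (Par :: G))
      ((x', a') : tuple N (Par :: G)) (s := Obj) p p' -> pairs a a' p p').
  { intros o1 o2 Ho; refine (pairs_cons (r := fun s => match s return Z s -> N s -> Prop with
      | Par => fun _ _ => True | Obj => fun p p' => pairs a a' p p' end)
      _ _ Ho); [exact I |].
    intros [|] ? ?; auto. }
  assert (Hpar : forall o o', pairs ((x, a) : tuple Z (Par :: G))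
      ((x', a') : tuple N (Par :: G)) (s := Par) o o' ->
      (o = x /\ o' = x') \/ pairs a a' o o').
  { intros o1 o2 Ho; refine (pairs_cons (r := fun s => match s return Z s -> N s -> Prop with
      | Par => fun o o' => (o = x /\ o' = x') \/ pairs a a' o o'
      | Obj => fun _ _ => True end) _ _ Ho); [now left |].
    intros [|] ? ?; auto. }
  intros p p' u u' v v' Rp Ru Rv.
  apply Hpar in Rp; apply Hobj in Ru; apply Hobj in Rv.
  destruct Rp as [[-> ->] | Rp]; [| now apply HE].
  destruct Ru as [u0 [<- <-]], Rv as [v0 [<- <-]].
  rewrite Hx' by apply (in_map (fun v => tnth v a')), Hvo.
  rewrite (proj2 (Hc' _) u0 eq_refl), (proj2 (Hc' _) v0 eq_refl).
  symmetry; apply Hc1; auto.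
Qed.

(** * Quantifier elimination by back and forth *)

Fixpoint depth (L : language) (G : list (sort L)) (phi : form L G) : nat :=
  match phi with
  | fbot _ | feq _ _ | frel _ => 0
  | fimp p q => max (depth p) (depth q)
  | fall p => S (depth p)
  end.

(** A quantifier lowers the depth by one and lengthens the tuple by one, so [length G + depth phi]
    does not grow and bounds every tuple that [forth] has to extend. Agreement of [P] and [P'] below
    this bound is therefore enough. *)
Lemma back_and_forth (P P' : nat -> Prop) (M N : structure Lfeq) :
  generic P M -> generic P' N ->
  forall (G : list feq_sort) (phi : form Lfeq G) (a : tuple M G) (a' : tuple N G),
  (forall j, j < length G + depth phi -> (P j <-> P' j)) ->
  piso (pairs a a') -> (sat phi a <-> sat phi a').
Proof.
intros gM gN G phi.
induction phi as [G | G s u v | G r xs | G p IHp q IHq | G s p IHp];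
  simpl; intros a a' HP H.
- tauto.
- apply H; [now exists u | now exists v].
- destruct r, xs as [q [u [v []]]]; simpl.
  apply (proj2 H (tnth q a) (tnth q a') (tnth u a) (tnth u a') (tnth v a)
    (tnth v a')); [now exists q | now exists u | now exists v].
- rewrite (IHp a a'), (IHq a a'); auto; try tauto; intros; apply HP; lia.
- split; intros Hp x.
  + destruct (@forth P' P N M G a' a s x) as [y Hy].
    * apply gN.
    * exact gM.
    * intros j Hj; apply HP; lia.
    * apply piso_flip in H; apply (piso_sub H).
      intros t y y' [v [<- <-]]; now exists v.
    * apply piso_flip in Hy; apply (IHp (y, a) (x, a')); auto.
      -- intros j Hj; apply HP; simpl in Hj; lia.
      -- apply piso_sub with (1 := Hy).
         intros t z z' [v [<- <-]]; now exists v.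
  + destruct (@forth P P' M N G a a' s x) as [y Hy].
    * apply gM.
    * exact gN.
    * intros j Hj; apply HP; lia.
    * exact H.
    * apply (IHp (x, a) (y, a')); auto.
      intros j Hj; apply HP; simpl in Hj; lia.
Qed.

Lemma piso_sat (P : nat -> Prop) (M N : structure Lfeq)
    (r : forall s : feq_sort, M s -> N s -> Prop) :
  generic P M -> generic P N -> piso r ->
  forall (G : list feq_sort) (phi : form Lfeq G) (a : tuple M G) (a' : tuple N G),
  (forall s (v : var G s), r s (tnth v a) (tnth v a')) ->
  (sat phi a <-> sat phi a').
Proof.
intros gM gN Hr G phi a a' H; apply (back_and_forth gM gN); [tauto |].
apply (piso_sub Hr); intros s x x' [v [<- <-]]; apply H.
Qed.

Lemma embedding_E (M N : structure Lfeq) (f : forall s, M s -> N s) :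
  embedding f -> forall p x y, E p x y <-> E (f Par p) (f Obj x) (f Obj y).
Proof. intros [_ H] p x y; exact (H tt (p, (x, (y, tt)))). Qed.

Lemma embedding_piso (M N : structure Lfeq) (f : forall s, M s -> N s) :
  embedding f <-> piso (fun s x x' => x' = f s x).
Proof.
split.
- intros H; split.
  + intros s x x' y y' -> ->; split; [now intros -> | apply H].
  + intros p p' x x' y y' -> -> ->; now apply embedding_E.
- intros [H1 H2]; split.
  + intros s x y; apply (H1 s x _ y _ eq_refl eq_refl).
  + intros [] [p [x [y []]]]; exact (H2 p _ x _ y _ eq_refl eq_refl eq_refl).
Qed.

Lemma embedding_elementary (P : nat -> Prop) (M N : structure Lfeq)
    (f : forall s, M s -> N s) :
  generic P M -> generic P N -> embedding f -> elementary f.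
Proof.
intros gM gN Hf G phi a; apply embedding_piso in Hf.
apply (piso_sat gM gN Hf); intros s v; apply tnth_tmap.
Qed.

Lemma elementary_embedding (M N : structure Lfeq) (f : forall s, M s -> N s) :
  elementary f -> embedding f.
Proof.
intros H; split.
- intros s x y e.
  apply (H [s; s] (feq (vz s [s]) (vs s (vz s []))) (x, (y, tt))); exact e.
- intros [] [p [x [y []]]].
  exact (H [Par; Obj; Obj] (@frel Lfeq _ tt
    (vz Par [Obj; Obj], (vs Par (vz Obj [Obj]), (vs Par (vs Obj (vz Obj [])), tt))))
    (p, (x, (y, tt)))).
Qed.

(** * Countable structures embed into generic ones *)

(** Only forth steps are iterated, stage [n] placing the element of code [n]; thus [Z] may be any
    countable structure with no more classes than [P] allows. *)
Lemma countable_extend (P : nat -> Prop) (Z N : structure Lfeq)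
    (G : list feq_sort) (a : tuple Z G) (a' : tuple N G) :
  countable_structure Z -> fits P Z -> generic P N -> piso (pairs a a') ->
  exists h : forall s, Z s -> N s, embedding h /\
    forall s (v : var G s), h s (tnth v a) = tnth v a'.
Proof.
intros [code Hcode] HZ gN H0.
pose (rel := forall s : feq_sort, Z s -> N s -> Prop).
(* Stages are relations that come from finite tuples; hiding the tuples lets their union be
   formed. *)
pose (good := fun r : rel => exists (D : list feq_sort) (b : tuple Z D)
  (b' : tuple N D), piso (pairs b b') /\
    forall s x x', r s x x' <-> pairs b b' x x').
assert (step : forall (n : nat) (q : sig good), exists q' : sig good,
  (forall s x x', proj1_sig q s x x' -> proj1_sig q' s x x') /\
  forall s x, code (existT _ s x) = n -> exists x', proj1_sig q' s x x').
{ intros n [r (D & b & b' & Hb & Hr)]; simpl.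
  destruct (classic (exists u, code u = n)) as [[[s x] Hx] | nn].
  - destruct (@forth P P Z N D b b' s x HZ gN) as [x' Hx']; [tauto | exact Hb |].
    set (r' := pairs ((x, b) : tuple Z (s :: D)) ((x', b') : tuple N (s :: D))).
    assert (g : good r') by (exists (s :: D), (x, b), (x', b'); split; [exact Hx' | reflexivity]).
    exists (exist _ r' g); simpl; split.
    + intros t y y' h; apply pairs_cons_inv, Hr, h.
    + intros t y e; rewrite <- Hx in e; apply Hcode in e.
      (* Rewriting in a predicate on dependent pairs uses [e] without comparing second components of
         different types. *)
      pose (has := fun u : {s : feq_sort & Z s} =>
        exists z, r' (projT1 u) (projT2 u) z).
      enough (K : has (existT (fun s => Z s) t y)) by exact K.
      refine (eq_ind _ has _ _ (eq_sym e)); exists x'; now exists (vz s D).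
  - exists (exist _ r (ex_intro _ D (ex_intro _ b (ex_intro _ b' (conj Hb Hr))))).
    simpl; split; [auto |]; intros s x e; destruct nn; eauto. }
assert (step' : forall n, exists F : sig good -> sig good, forall q,
  (forall s x x', proj1_sig q s x x' -> proj1_sig (F q) s x x') /\
  forall s x, code (existT _ s x) = n -> exists x', proj1_sig (F q) s x x')
  by (intros n; exact (choice _ (step n))).
apply choice in step'.
destruct step' as [F HF].
assert (g0 : good (fun s => pairs a a' (s := s))).
{ exists G, a, a'; split; [exact H0 | reflexivity]. }
pose (st := nat_rect (fun _ => sig good) (exist _ _ g0) F).
assert (mono : forall m n, m <= n -> forall s x x',
  proj1_sig (st m) s x x' -> proj1_sig (st n) s x x').
{ intros m n Hmn; induction Hmn; auto.
  intros s x x' h; apply (proj1 (HF m0 (st m0))), IHHmn, h. }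
pose (r := fun s x x' => exists n, proj1_sig (st n) s x x').
assert (Hr : piso r).
{ assert (gd : forall n, piso (proj1_sig (st n))).
  { intros n; destruct (st n) as [q (D & b & b' & Hb & Hq)]; simpl.
    apply (piso_sub Hb); apply Hq. }
  split.
  - intros s x x' y y' [m Hx] [n Hy]; apply (gd (max m n)).
    + apply (mono m); [lia | exact Hx].
    + apply (mono n); [lia | exact Hy].
  - intros p p' x x' y y' [l Hp] [m Hx] [n Hy]; apply (gd (max l (max m n))).
    + apply (mono l); [lia | exact Hp].
    + apply (mono m); [lia | exact Hx].
    + apply (mono n); [lia | exact Hy]. }
assert (tot : forall s (x : Z s), exists x', r s x x').
{ intros s x; destruct (proj2 (HF _ (st (code (existT _ s x)))) s x eq_refl)
    as [x' Hx'].
  exists x', (S (code (existT _ s x))); exact Hx'. }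
pose (h := fun s x => proj1_sig (constructive_indefinite_description _ (tot s x))).
assert (Hh : forall s x, r s x (h s x)).
{ intros s x; unfold h; apply proj2_sig. }
exists h; split.
- apply embedding_piso, (piso_sub Hr); intros s x x' ->; apply Hh.
- intros s v; apply (proj1 Hr s (tnth v a) _ (tnth v a)); [apply Hh | | reflexivity].
  exists 0; now exists v.
Qed.

(** * Elementary extensions of generic structures *)

Implicit Types M : structure Lfeq.

(** The same formula has to work in every structure: a predicate that is uniform in this sense can
    be carried along elementary maps without writing formulas. *)
Definition definable (G : list feq_sort)
    (F : forall M : structure Lfeq, tuple M G -> Prop) : Prop :=
  exists phi : form Lfeq G, forall M (a : tuple M G), sat phi a <-> F M a.

Section Definable.
Variable G : list feq_sort.
Implicit Types F H : forall M, tuple M G -> Prop.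

(** Conditions that mention neither structure nor tuple, such as an order between indices or an
    equality of colors, are decided classically and may thus occur inside definable predicates. *)
Lemma def_const (Q : Prop) : definable (fun M (a : tuple M G) => Q).
Proof.
destruct (classic Q).
- exists (@fimp Lfeq _ (fbot _) (fbot _)); simpl; tauto.
- exists (fbot _); simpl; tauto.
Qed.

Lemma def_eq (s : feq_sort) (u v : var G s) :
  definable (fun M (a : tuple M G) => tnth u a = tnth v a).
Proof. exists (@feq Lfeq _ _ u v); simpl; tauto. Qed.

Lemma def_E (p : var G Par) (u v : var G Obj) :
  definable (fun M (a : tuple M G) => E (tnth p a) (tnth u a) (tnth v a)).
Proof. exists (@frel Lfeq _ tt (p, (u, (v, tt)))); simpl; tauto. Qed.

Lemma def_imp F H :
  definable F -> definable H -> definable (fun M a => F M a -> H M a).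
Proof.
intros [p Hp] [q Hq]; exists (fimp p q); intros M a; simpl.
rewrite (Hp M a), (Hq M a); tauto.
Qed.

Lemma def_not F : definable F -> definable (fun M a => ~ F M a).
Proof. intros HF; apply def_imp; [exact HF | apply def_const]. Qed.

Lemma def_and F H :
  definable F -> definable H -> definable (fun M a => F M a /\ H M a).
Proof.
intros HF HH.
destruct (def_not (def_imp HF (def_not HH))) as [p Hp].
exists p; intros M a; rewrite (Hp M a); tauto.
Qed.

Lemma def_iff F H :
  definable F -> definable H -> definable (fun M a => F M a <-> H M a).
Proof. intros HF HH; apply def_and; now apply def_imp. Qed.

Lemma def_ex (s : feq_sort) (F : forall M : structure Lfeq, tuple M G -> M s -> Prop) :
  definable (G := s :: G) (fun M a => F M (snd a) (fst a)) ->
  definable (fun M a => exists x, F M a x).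
Proof.
intros [p Hp].
exists (fimp (@fall Lfeq _ _ (fimp p (fbot _))) (fbot _)); intros M a; simpl.
split.
- intros h; apply NNPP; intros n; apply h; intros x hx; apply n; exists x.
  apply (Hp M (x, a)), hx.
- intros [x hx] h; apply (h x), (Hp M (x, a)), hx.
Qed.

Lemma def_list (A : Type) (l : list A)
    (F : A -> forall M : structure Lfeq, tuple M G -> Prop) :
  (forall x, definable (F x)) -> definable (fun M a => forall x, In x l -> F x M a).
Proof.
intros HF; induction l as [|x l IH].
- destruct (def_const True) as [p Hp]; exists p; intros M a; rewrite (Hp M a).
  simpl; tauto.
- destruct (def_and (HF x) IH) as [p Hp]; exists p; intros M a; rewrite (Hp M a).
  simpl; split; [intros [h1 h2] y [<- | hy]; auto | auto].
Qed.

Lemma def_var (D : list feq_sort) (s : feq_sort)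
    (F : var D s -> forall M : structure Lfeq, tuple M G -> Prop) :
  (forall v, definable (F v)) -> definable (fun M a => forall v, F v M a).
Proof.
intros HF; destruct (var_finite D s) as [l [Hl _]].
destruct (def_list l HF) as [p Hp]; exists p; intros M a; rewrite (Hp M a).
split; auto.
Qed.

End Definable.

Lemma def_exs (G D : list feq_sort)
    (F : forall M : structure Lfeq, tuple M (G ++ D) -> Prop) :
  definable F ->
  definable (fun M (b : tuple M D) => exists x : tuple M G, F M (tapp x b)).
Proof.
induction G as [|s G IH]; simpl; intros HF.
- destruct HF as [p Hp]; exists p; intros M a; rewrite (Hp M a).
  split; [now exists tt | now intros [[] h]].
- destruct (IH (fun M a => exists x : M s, F M (x, a))) as [p Hp].
  { apply def_ex; destruct HF as [p Hp]; exists p; intros M [x a]; apply Hp. }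
  exists p; intros M b; rewrite (Hp M b); split.
  + intros [x [y h]]; now exists (y, x).
  + intros [[y x] h]; now exists x, y.
Qed.

(** The universal closure of the formula is a sentence, so the tuples of [N] outside the image of
    [f] are covered too. *)
Lemma elementary_definable (M N : structure Lfeq) (f : forall s, M s -> N s)
    (G : list feq_sort) (F : forall M : structure Lfeq, tuple M G -> Prop) :
  elementary f -> definable F -> (forall a, F M a) -> forall a, F N a.
Proof.
intros Hf [p Hp] HM.
assert (cl : exists q : form Lfeq [], forall M : structure Lfeq,
  sat (M := M) q tt <-> forall a : tuple M G, sat p a).
{ clear; induction G as [|s G IH].
  - exists p; intros M; split; [now intros h [] | intros h; apply h].
  - destruct (IH (@fall Lfeq _ _ p)) as [q Hq]; exists q; intros M.
    rewrite Hq; simpl; split; [intros h [x a]; apply h | intros h a x; apply h]. }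
destruct cl as [q Hq]; intros a; apply Hp; revert a; apply Hq.
apply (Hf [] q tt), Hq; intros a; apply Hp, HM.
Qed.

(** Gathers finite sets of elements into one tuple, so that a formula can speak of them. *)
Lemma context_of (M : structure Lfeq) (os : list (M Obj)) (bs : list (M Par)) :
  exists (G : list feq_sort) (a : tuple M G),
    (forall x, In x os <-> exists v : var G Obj, tnth v a = x) /\
    (forall b, In b bs <-> exists v : var G Par, tnth v a = b).
Proof.
assert (nil : forall s (x : M s) (v : var [] s), tnth v (tt : tuple M []) = x -> False).
{ intros s x v; destruct (var_nil v). }
assert (same : forall s (x : M s) G (a : tuple M G) y,
  (exists v : var (s :: G) s, tnth v ((x, a) : tuple M (s :: G)) = y) <->
  x = y \/ exists v : var G s, tnth v a = y).
{ intros s x G a y; split.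
  - intros [v Hv]; enough (H : pairs ((x, a) : tuple M (s :: G))
      ((x, a) : tuple M (s :: G)) y y).
    + clear Hv; assert (K := pairs_cons (r := fun t (z _ : M t) =>
        (exists e : s = t, eq_rect s M x t e = z) \/ exists v : var G t, tnth v a = z)
        (t := s) (x := x) (x' := x) (a := a) (a' := a)).
      destruct (K (or_introl (ex_intro _ eq_refl eq_refl))
        (fun t z z' h => or_intror (match h with ex_intro _ w (conj h1 _) =>
           ex_intro _ w h1 end)) s y y H) as [[e He] | h]; [left | now right].
      rewrite <- He, (proof_irrelevance _ e eq_refl); reflexivity.
    + now exists v.
  - intros [<- | [v Hv]]; [now exists (vz s G) | now exists (vs s v)]. }
assert (diff : forall s t (x : M s) G (a : tuple M G) (y : M t), s <> t ->
  (exists v : var (s :: G) t, tnth v ((x, a) : tuple M (s :: G)) = y) <->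
  exists v : var G t, tnth v a = y).
{ intros s t x G a y n; split; [| intros [v Hv]; now exists (vs s v)].
  intros [v Hv].
  assert (K := pairs_cons (r := fun t (z _ : M t) =>
    s <> t -> exists v : var G t, tnth v a = z)
    (t := s) (x := x) (x' := x) (a := a) (a' := a)).
  apply (K (fun n => match n eq_refl with end)
    (fun t z z' h _ => match h with ex_intro _ w (conj h1 _) =>
           ex_intro _ w h1 end) t y y); [now exists v | exact n]. }
induction os as [|x os IH].
- induction bs as [|b bs IH].
  + exists [], tt; split; intros z; (split; [intros [] | intros [v Hv]; destruct (nil _ _ _ Hv)]).
  + destruct IH as (G & a & H1 & H2); exists (Par :: G), (b, a); split; intros z.
    * rewrite diff by discriminate; apply H1.
    * rewrite same, <- H2; simpl; tauto.
- destruct IH as (G & a & H1 & H2); exists (Obj :: G), (x, a); split; intros z.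
  + rewrite same, <- H1; simpl; tauto.
  + rewrite diff by discriminate; apply H2.
Qed.

(** For lists of fixed size, each clause is a first-order condition on a tuple collecting the
    elements involved. The functions [y] and [c] only matter on that tuple and become functions of
    the variables; [P] is decided outside the language. *)
Lemma generic_elementary (P : nat -> Prop) (M N : structure Lfeq)
    (f : forall s, M s -> N s) :
  elementary f -> generic P M -> generic P N.
Proof.
intros Hf gM; assert (up := fun G F => @elementary_definable M N f G F Hf).
destruct (gen_fits gM) as [ME MP].
assert (NE : forall b : N Par, Equivalence (E b)).
{ assert (H : forall a : tuple N [Par; Obj; Obj; Obj],
    let b := fst a in let x := fst (snd a) in
    let y := fst (snd (snd a)) in let z := fst (snd (snd (snd a))) in
    E b x x /\ (E b x y -> E b y x) /\ (E b x y -> E b y z -> E b x z)).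
  { pose (vb := vz Par [Obj; Obj; Obj]).
    pose (vx := vs Par (vz Obj [Obj; Obj])).
    pose (vy := vs Par (vs Obj (vz Obj [Obj]))).
    pose (vw := vs Par (vs Obj (vs Obj (vz Obj [])))).
    apply (up _ (fun M (a : tuple M [Par; Obj; Obj; Obj]) =>
      let b := fst a in let x := fst (snd a) in
      let y := fst (snd (snd a)) in let z := fst (snd (snd (snd a))) in
      E b x x /\ (E b x y -> E b y x) /\ (E b x y -> E b y z -> E b x z))).
    - repeat first [apply def_and | apply def_imp].
      + apply (def_E vb vx vx).
      + apply (def_E vb vx vy).
      + apply (def_E vb vy vx).
      + apply (def_E vb vx vy).
      + apply (def_E vb vy vw).
      + apply (def_E vb vx vw).
    - intros [b [x [y [z []]]]]; simpl; destruct (ME b) as [r s t].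
      repeat split; eauto. }
  intros b; split; red.
  - intros x; exact (proj1 (H (b, (x, (x, (x, tt)))))).
  - intros x y; exact (proj1 (proj2 (H (b, (x, (y, (x, tt))))))).
  - intros x y z; exact (proj2 (proj2 (H (b, (x, (y, (z, tt))))))). }
assert (o0 : inhabited (N Obj)).
{ destruct (gen_obj gM) as [o]; constructor; exact (f Obj o). }
constructor; auto.
(* If [P j] fails, no j + 1 objects of [M] are pairwise inequivalent for a parameter, and [N]
   inherits this. *)
- split; [exact NE |]; intros b g j Hg; apply NNPP; intros nP.
  destruct (@context_of N (map g (seq 0 (S j))) [b]) as (G & a & H1 & H2).
  destruct (proj1 (H2 b) (or_introl eq_refl)) as [p Hp].
  assert (H : forall i, exists v : var G Obj, i <= j -> tnth v a = g i).
  { intros i; destruct (le_lt_dec i j) as [h | h].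
    - destruct (proj1 (H1 (g i))) as [v Hv]; [| now exists v].
      apply in_map, in_seq; lia.
    - destruct (proj1 (H1 (g 0))) as [v Hv]; [now left |].
      exists v; intros h'; lia. }
  apply choice in H as [v Hv].
  assert (K : forall a : tuple N G, (forall i, In i (seq 0 (S j)) -> forall i',
      In i' (seq 0 (S j)) ->
      i < i' -> ~ E (tnth p a) (tnth (v i) a) (tnth (v i') a)) -> False).
  { apply (up G (fun M a => (forall i, In i (seq 0 (S j)) -> forall i',
      In i' (seq 0 (S j)) ->
      i < i' -> ~ E (tnth p a) (tnth (v i) a) (tnth (v i') a)) -> False)).
    - apply def_imp; [| apply def_const].
      apply def_list; intros i; apply def_list; intros i'.
      apply def_imp; [apply def_const | apply def_not, def_E].
    - intros a0 h; apply nP, (MP (tnth p a0) (fun i => tnth (v i) a0)).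
      intros i i' Hi; apply h; rewrite ?in_seq; lia. }
  apply (K a); intros i Hi i' Hi' Hii; rewrite in_seq in Hi, Hi'.
  rewrite Hp, !Hv by lia; apply Hg; lia.
- apply gM.
- intros b g j Pj.
  destruct (@context_of N (map g (seq 0 (S j))) [b]) as (G & a & H1 & H2).
  destruct (proj1 (H2 b) (or_introl eq_refl)) as [p Hp].
  assert (H : forall i, exists v : var G Obj, i <= j -> tnth v a = g i).
  { intros i; destruct (le_lt_dec i j) as [h | h].
    - destruct (proj1 (H1 (g i))) as [v Hv]; [| now exists v].
      apply in_map, in_seq; lia.
    - destruct (proj1 (H1 (g 0))) as [v Hv]; [now left |].
      exists v; intros h'; lia. }
  apply choice in H as [v Hv].
  assert (K : forall a : tuple N G, exists x, forall i, In i (seq 0 j) ->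
    ~ E (tnth p a) x (tnth (v i) a)).
  { apply (up G (fun M a => exists x, forall i, In i (seq 0 j) ->
    ~ E (tnth p a) x (tnth (v i) a))).
    - apply def_ex, def_list; intros i.
      apply def_not, (def_E (vs Obj p) (vz Obj G) (vs Obj (v i))).
    - intros a0; destruct (gen_class gM (tnth p a0) (fun i => tnth (v i) a0) Pj)
        as [x Hx].
      exists x; intros i Hi; apply Hx; rewrite in_seq in Hi; lia. }
  destruct (K a) as [x Hx]; exists x; intros i Hi.
  rewrite <- Hp, <- Hv by lia; apply Hx, in_seq; lia.
- intros bs y av; destruct o0 as [o].
  destruct (@context_of N (o :: map y bs ++ av) bs) as (G & a & H1 & H2).
  assert (H : forall p : var G Par, exists v : var G Obj,
    tnth v a = y (tnth p a)).
  { intros p; apply H1; right; apply in_app_iff; left; apply in_map, H2.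
    now exists p. }
  apply choice in H as [v Hv].
  (* The premise says that the representative depends on the parameter and not on the variable
     naming it; with it, the condition holds for all tuples of [M]. *)
  assert (K : forall a : tuple N G,
    (forall p q : var G Par, tnth p a = tnth q a -> tnth (v p) a = tnth (v q) a) ->
    exists x, (forall u : var G Obj, ~ tnth u a = x) /\
      forall p, E (tnth p a) x (tnth (v p) a)).
  { apply (up G (fun M a => (forall p q : var G Par,
      tnth p a = tnth q a -> tnth (v p) a = tnth (v q) a) ->
      exists x, (forall u : var G Obj, ~ tnth u a = x) /\
      forall p, E (tnth p a) x (tnth (v p) a))).
    - apply def_imp.
      + apply def_var; intros p; apply def_var; intros q.
        apply def_imp; apply def_eq.
      + apply def_ex, def_and; apply def_var; intros u.
        * apply def_not, (def_eq (vs Obj u) (vz Obj G)).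
        * apply (def_E (vs Obj u) (vz Obj G) (vs Obj (v u))).
    - intros a0 h.
      assert (H : forall b : M Par, exists z : M Obj, forall p : var G Par,
        tnth p a0 = b -> z = tnth (v p) a0).
      { intros b; destruct (classic (exists p : var G Par, tnth p a0 = b))
          as [[p Hp] | n].
        - exists (tnth (v p) a0); intros q Hq; apply h; congruence.
        - destruct (gen_obj gM) as [o']; exists o'; intros p Hp; destruct n; eauto. }
      apply choice in H as [z Hz].
      destruct (var_finite G Obj) as [vo [Hvo _]].
      destruct (var_finite G Par) as [vp [Hvp _]].
      destruct (gen_ext_obj gM (map (fun v => tnth v a0) vp) z
        (map (fun v => tnth v a0) vo)) as [x [nx Hx]].
      exists x; split.
      + intros u Hu; apply nx; rewrite <- Hu; apply (in_map (fun v => tnth v a0)), Hvo.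
      + intros p; rewrite <- (Hz _ p eq_refl).
        apply Hx, (in_map (fun v => tnth v a0)), Hvp. }
  destruct (K a) as [x [nx Hx]].
  { intros p q e; rewrite !Hv; congruence. }
  exists x; split.
  + intros Hi; destruct (proj1 (H1 x)) as [u Hu].
    * right; apply in_app_iff; now right.
    * exact (nx u Hu).
  + intros b Hb; destruct (proj1 (H2 b) Hb) as [p <-]; rewrite <- Hv; apply Hx.
- intros os c av Pc.
  destruct (@context_of N os av) as (G & a & H1 & H2).
  (* Colors attached to variables make sense in [M] as well. *)
  pose (d := fun v : var G Obj => c (tnth v a)).
  assert (K : forall a : tuple N G,
    (forall u v : var G Obj, tnth u a = tnth v a -> d u = d v) ->
    exists b, (forall p : var G Par, ~ tnth p a = b) /\
      forall u v, E b (tnth u a) (tnth v a) <-> d u = d v).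
  { apply (up G (fun M a =>
      (forall u v : var G Obj, tnth u a = tnth v a -> d u = d v) ->
      exists b, (forall p : var G Par, ~ tnth p a = b) /\
      forall u v, E b (tnth u a) (tnth v a) <-> d u = d v)).
    - apply def_imp.
      + apply def_var; intros p; apply def_var; intros q.
        apply def_imp; [apply def_eq | apply def_const].
      + apply def_ex, def_and; apply def_var; intros u.
        * apply def_not, (def_eq (vs Par u) (vz Par G)).
        * apply def_var; intros v; apply def_iff; [| apply def_const].
          apply (def_E (vz Par G) (vs Par u) (vs Par v)).
    - intros a0 h.
      assert (H : forall x : M Obj, exists k, P k /\ forall u : var G Obj,
        tnth u a0 = x -> k = d u).
      { intros x; destruct (classic (exists u : var G Obj, tnth u a0 = x))
          as [[u Hu] | n].
        - exists (d u); split; [apply Pc |]; intros v Hv; apply h; congruence.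
        - exists 0; split; [apply gM |]; intros p Hp; destruct n; eauto. }
      apply choice in H as [k Hk].
      destruct (var_finite G Obj) as [vo [Hvo _]].
      destruct (var_finite G Par) as [vp [Hvp _]].
      destruct (gen_ext_par gM (map (fun v => tnth v a0) vo) (c := k)
        (map (fun v => tnth v a0) vp)) as [b [nb Hb]].
      { intros x; apply Hk. }
      exists b; split.
      + intros u Hu; apply nb; rewrite <- Hu; apply (in_map (fun v => tnth v a0)), Hvp.
      + intros u v.
        rewrite <- (proj2 (Hk (tnth u a0)) u eq_refl).
        rewrite <- (proj2 (Hk (tnth v a0)) v eq_refl).
        apply Hb; apply (in_map (fun v => tnth v a0)), Hvo. }
  destruct (K a) as [b [nb Hb]].
  { intros u v e; unfold d; congruence. }
  exists b; split.
  + intros Hi; destruct (proj1 (H2 b) Hi) as [p Hp]; exact (nb p Hp).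
  + intros x y Hx Hy; destruct (proj1 (H1 x) Hx) as [u <-].
    destruct (proj1 (H1 y) Hy) as [v <-]; apply Hb.
Qed.

(** * Ramsey's theorem for pairs *)

Definition increasing (h : nat -> nat) : Prop := forall i j, i < j -> h i < h j.

Lemma increasing_step (h : nat -> nat) : (forall i, h i < h (S i)) -> increasing h.
Proof.
intros H i j Hij; induction Hij; [apply H |]; specialize (H m); lia.
Qed.

Definition unbounded (A : nat -> Prop) : Prop := forall n, exists m, n <= m /\ A m.

Lemma unbounded_enum (A : nat -> Prop) :
  unbounded A -> exists h, increasing h /\ forall i, A (h i).
Proof.
intros H.
assert (H' : forall n, exists m, n < m /\ A m) by (intros n; apply (H (S n))).
apply choice in H' as [g Hg].
exists (fun i => nat_rect (fun _ => nat) (g 0) (fun _ m => g m) i); split.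
- apply increasing_step; intros i; simpl; apply Hg.
- intros [|i]; simpl; apply Hg.
Qed.

Definition homogeneous (R : nat -> nat -> Prop) (h : nat -> nat) : Prop :=
  (forall i j, i < j -> R (h i) (h j)) \/ (forall i j, i < j -> ~ R (h i) (h j)).

(** Each step picks an element of the current unbounded set and keeps the later elements to which it
    relates in a constant way, recorded by a boolean. One boolean is recorded infinitely often. *)
Lemma ramsey_pairs (R : nat -> nat -> Prop) :
  exists h, increasing h /\ homogeneous R h.
Proof.
assert (step : forall A : sig unbounded, exists q : nat * bool * sig unbounded,
  proj1_sig A (fst (fst q)) /\
  forall m, proj1_sig (snd q) m -> proj1_sig A m /\ fst (fst q) < m /\
    (R (fst (fst q)) m <-> snd (fst q) = true)).
{ intros [A HA]; destruct (HA 0) as [a [_ Ha]].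
  destruct (classic (unbounded (fun m => A m /\ a < m /\ R a m))) as [U | U].
  - exists (a, true, exist _ _ U); simpl; split; [exact Ha | tauto].
  - assert (V : unbounded (fun m => A m /\ a < m /\ ~ R a m)).
    { intros n; apply NNPP; intros h; apply U; intros n'.
      destruct (HA (n + n' + S a)) as [m [Hm Am]].
      exists m; split; [lia |]; repeat split; [assumption | lia |].
      apply NNPP; intros nR; apply h; exists m.
      repeat split; [lia | assumption | lia | assumption]. }
    exists (a, false, exist _ _ V); simpl; split; [exact Ha |].
    intros m (H1 & H2 & H3); split; [exact H1 |]; split; [exact H2 |]; split; [tauto | discriminate]. }
apply choice in step as [F HF].
assert (U0 : unbounded (fun _ => True)) by (intros n; now exists n).
pose (st := nat_rect (fun _ => sig unbounded) (exist _ _ U0) (fun _ A => snd (F A))).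
pose (a := fun n => fst (fst (F (st n)))).
pose (c := fun n => snd (fst (F (st n)))).
assert (sub : forall i j, i <= j -> forall m,
  proj1_sig (st j) m -> proj1_sig (st i) m).
{ intros i j Hij; induction Hij; auto; intros k Hk.
  apply IHHij, (HF (st m)), Hk. }
assert (Ha : forall i j, i < j -> a i < a j /\ (R (a i) (a j) <-> c i = true)).
{ intros i j Hij.
  exact (proj2 (proj2 (HF (st i)) (a j) (sub (S i) j Hij _ (proj1 (HF (st j)))))). }
assert (U : exists b, unbounded (fun n => c n = b)).
{ destruct (classic (unbounded (fun n => c n = true))) as [U | U]; [eauto |].
  exists false; intros n; apply NNPP; intros h; apply U; intros n'.
  exists (n + n'); split; [lia |].
  destruct (c (n + n')) eqn:e; [reflexivity |].
  destruct h; exists (n + n'); split; [lia | exact e]. }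
destruct U as [b U]; apply unbounded_enum in U as [h [Hh Hb]].
exists (fun i => a (h i)); split.
- intros i j Hij; apply Ha, Hh, Hij.
- destruct b; [left | right]; intros i j Hij;
    destruct (Ha (h i) (h j) (Hh i j Hij)) as [_ K]; rewrite K, Hb; auto.
Qed.

Lemma ramsey_list (Rs : list (nat -> nat -> Prop)) :
  exists h, increasing h /\ forall R, In R Rs -> homogeneous R h.
Proof.
induction Rs as [|R Rs [h [Hh H]]].
- exists (fun i => i); split; [now intros i j | intros R []].
- destruct (ramsey_pairs (fun i j => R (h i) (h j))) as [g [Hg H']].
  exists (fun i => h (g i)); split; [intros i j Hij; apply Hh, Hg, Hij |].
  intros R' [<- | HR]; [exact H' |].
  destruct (H R' HR) as [K | K]; [left | right]; intros i j Hij; apply K, Hg, Hij.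
Qed.

(** * Amalgamation inside a generic structure *)

(** Each choice also avoids the values already chosen, which gives injectivity on [l]. *)
Lemma choose_fresh (T U : Type) (u0 : U) (l : list T) (av : list U)
    (Q : T -> U -> Prop) :
  (forall t av', exists u, ~ In u av' /\ Q t u) ->
  exists g : T -> U,
    (forall t, In t l -> ~ In (g t) av /\ Q t (g t)) /\
    forall t t', In t l -> In t' l -> g t = g t' -> t = t'.
Proof.
intros H; induction l as [|t l (g & H1 & H2)].
- exists (fun _ => u0); simpl; tauto.
- destruct (classic (In t l)) as [ht | ht].
  + exists g; split; [intros t' [<- | h]; auto |].
    intros t1 t2 [<- | h1] [<- | h2]; auto.
  + destruct (H t (av ++ map g l)) as [u [nu Qu]].
    rewrite in_app_iff in nu.
    exists (fun t' => if excluded_middle_informative (t' = t) then u else g t').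
    split.
    * intros t' Ht'; destruct (excluded_middle_informative (t' = t)) as [-> | n].
      -- split; [tauto | exact Qu].
      -- destruct Ht' as [<- | Ht']; [tauto | auto].
    * intros t1 t2 h1 h2.
      destruct (excluded_middle_informative (t1 = t)) as [-> | n1],
        (excluded_middle_informative (t2 = t)) as [-> | n2]; auto.
      -- destruct h2 as [<- | h2]; [tauto |].
         intros ->; destruct nu; right; apply in_map, h2.
      -- destruct h1 as [<- | h1]; [tauto |].
         intros <-; destruct nu; right; apply in_map, h1.
      -- destruct h1 as [<- | h1]; [tauto |]; destruct h2 as [<- | h2]; [tauto |].
         auto.
Qed.

(* Sorts of variables elaborate to [feq_sort] or to [sort Lfeq], which congruence
   does not identify. *)
Ltac congr := change (sort Lfeq) with feq_sort in *; congruence.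

(* The hypotheses say that (x_i, d_i) and (x0, d0) have the same type, that the d_i
   only meet in common coordinates, and that the x_i agree on the classes of the
   parameters shared by the d_i. *)
Lemma amalgam (P : nat -> Prop) (W : structure Lfeq) (l : list nat) (i0 : nat)
    (D G : list feq_sort) (d0 : tuple W D) (d : nat -> tuple W D)
    (x0 : tuple W G) (x : nat -> tuple W G) (av : forall s : feq_sort, list (W s)) :
  generic P W -> In i0 l ->
  (forall i, In i l -> piso (pairs (tapp x0 d0) (tapp (x i) (d i)))) ->
  (forall i j s (u v : var D s), In i l -> In j l ->
    tnth u (d i) = tnth v (d j) -> tnth u d0 = tnth v d0) ->
  (forall i j (p q : var D Par) (t : var G Obj), In i l -> In j l ->
    tnth p (d i) = tnth q (d j) ->
    E (tnth p (d i)) (tnth t (x i)) (tnth t (x j))) ->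
  (forall i j s (t : var G s) (u : var D s), In i l -> In j l ->
    tnth t x0 = tnth u d0 -> tnth u (d i) = tnth u (d j)) ->
  exists x' : tuple W G,
    (forall i, In i l -> piso (pairs (tapp x0 d0) (tapp x' (d i)))) /\
    forall s (t : var G s),
      (exists u, tnth t x0 = tnth u d0) \/ ~ In (tnth t x') (av s).
Proof.
intros gW Hi0 Hiso Hd Hx Hc.
destruct (gen_fits gW) as [WE _].
destruct (var_finite D Obj) as [dO [HdO _]], (var_finite D Par) as [dp [Hdp _]].
destruct (var_finite G Obj) as [go [Hgo _]], (var_finite G Par) as [gp [Hgp _]].
assert (isoD : forall i s (u v : var D s), In i l ->
  (tnth u d0 = tnth v d0 <-> tnth u (d i) = tnth v (d i))).
{ intros i s u v Hi; apply (proj1 (Hiso i Hi)); apply pairs_tapp; right;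
    [now exists u | now exists v]. }
assert (isoG : forall i s (u v : var G s), In i l ->
  (tnth u x0 = tnth v x0 <-> tnth u (x i) = tnth v (x i))).
{ intros i s u v Hi; apply (proj1 (Hiso i Hi)); apply pairs_tapp; left;
    [now exists u | now exists v]. }
assert (isoGD : forall i s (t : var G s) (v : var D s), In i l ->
  (tnth t x0 = tnth v d0 <-> tnth t (x i) = tnth v (d i))).
{ intros i s u v Hi; apply (proj1 (Hiso i Hi)); apply pairs_tapp;
    [left; now exists u | right; now exists v]. }
pose (old := fun (s : feq_sort) (w : W s) => exists u, w = tnth u d0).
(* A value shared by [x0] and [d0] must follow the coordinate of [d i], which by [Hc] is the same
   for all [i]; outside [d0] the choice [g0] is free. *)
assert (ext : forall (s : feq_sort) (g0 : W s -> W s), exists g : W s -> W s,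
  (forall w (u : var D s) i, w = tnth u d0 -> (exists t : var G s, w = tnth t x0) ->
     In i l -> g w = tnth u (d i)) /\
  forall w, ~ old s w -> g w = g0 w).
{ intros s g0.
  assert (H : forall w : W s, exists w',
    (forall (u : var D s) i, w = tnth u d0 -> (exists t : var G s, w = tnth t x0) ->
       In i l -> w' = tnth u (d i)) /\ (~ old s w -> w' = g0 w)).
  { intros w; destruct (classic (old s w)) as [[u Hu] | n].
    - exists (tnth u (d i0)); split; [| intros n; destruct n; now exists u].
      intros v i Hv [t Ht] Hi; transitivity (tnth v (d i0)).
      + apply isoD; [exact Hi0 | congr].
      + apply Hc with t; [exact Hi0 | exact Hi | congr].
    - exists (g0 w); split; [| reflexivity].
      intros u i Hu; destruct n; now exists u. }
  apply choice in H as [g Hg]; exists g; split.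
  - intros w u i H1 H2 H3; now apply Hg.
  - intros w; apply Hg. }
pose (ds := fun (s : feq_sort) (vs : list (var D s)) =>
  flat_map (fun i => map (fun u => tnth u (d i)) vs) l).
assert (inds : forall s (vs : list (var D s)) u i, In u vs -> In i l ->
  In (tnth u (d i)) (ds s vs)).
{ intros s vs u i Hu Hi; apply in_flat_map; exists i; split; [exact Hi |].
  now apply (in_map (fun u => tnth u (d i))). }
pose (spec := fun (s : feq_sort) (vs : list (var D s)) (g : W s -> W s) =>
  (forall (t : var G s) (u : var D s) i, tnth t x0 = tnth u d0 -> In i l ->
     g (tnth t x0) = tnth u (d i)) /\
  (forall t : var G s, ~ old s (tnth t x0) -> ~ In (g (tnth t x0)) (av s)) /\
  (forall t t' : var G s, g (tnth t x0) = g (tnth t' x0) -> tnth t x0 = tnth t' x0) /\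
  (forall (t : var G s) (u : var D s) i, In i l -> g (tnth t x0) = tnth u (d i) ->
     tnth t x0 = tnth u d0)).
assert (build : forall s (vs : list (var D s)) (ts : list (var G s))
    (Q : W s -> W s -> Prop), (forall v, In v vs) -> (forall t, In t ts) ->
  (forall w av', exists w', ~ In w' av' /\ (~ old s w -> Q w w')) ->
  exists g, spec s vs g /\
    forall t : var G s, ~ old s (tnth t x0) -> Q (tnth t x0) (g (tnth t x0))).
{ intros s vs ts Q Hvs Hts HQ.
  destruct (classic (exists t : var G s, True)) as [[t0 _] | nt].
  2:{ exists (fun w => w); split; [| intros t; destruct nt; now exists t].
      repeat split; intros t; destruct nt; now exists t. }
  destruct (@choose_fresh (W s) (W s) (tnth t0 x0) (map (fun t => tnth t x0) ts)
    (av s ++ ds s vs) (fun w w' => ~ old s w -> Q w w') HQ) as (g0 & H1 & H2).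
  assert (Hin : forall t : var G s, In (tnth t x0) (map (fun t => tnth t x0) ts)).
  { intros t; now apply (in_map (fun t => tnth t x0)). }
  destruct (ext s g0) as (g & H3 & H4).
  assert (A1 : forall (t : var G s) (u : var D s) i, tnth t x0 = tnth u d0 ->
    In i l -> g (tnth t x0) = tnth u (d i)).
  { intros t u i e Hi; apply H3; [exact e | now exists t | exact Hi]. }
  assert (A2 : forall (t : var G s) (u : var D s) i, In i l ->
    g (tnth t x0) = tnth u (d i) -> tnth t x0 = tnth u d0).
  { intros t u i Hi e; destruct (classic (old s (tnth t x0))) as [[v Hv] | n].
    - rewrite (A1 t v i Hv Hi) in e; rewrite Hv; now apply (isoD i).
    - rewrite H4 in e by exact n; destruct (H1 _ (Hin t)) as [K _]; destruct K.
      rewrite e, in_app_iff; right; now apply inds. }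
  exists g; split; [repeat split |].
  - exact A1.
  - intros t n h; rewrite H4 in h by exact n; apply (H1 _ (Hin t)).
    rewrite in_app_iff; now left.
  - intros t t' e.
    destruct (classic (old s (tnth t' x0))) as [[v Hv] | n'].
    + rewrite (A1 t' v i0 Hv Hi0) in e; rewrite Hv; now apply (A2 t v i0).
    + destruct (classic (old s (tnth t x0))) as [[v Hv] | n].
      * rewrite (A1 t v i0 Hv Hi0) in e; rewrite Hv; symmetry.
        now apply (A2 t' v i0).
      * rewrite !H4 in e by assumption; now apply H2.
  - exact A2.
  - intros t n; rewrite H4 by exact n; now apply (H1 _ (Hin t)). }
(* Objects are placed before parameters. For each parameter of [d i], the image joins the class of
   the matching coordinate of [x i]; by [Hx], two indices sharing a parameter ask for the same
   class. *)
destruct (build Obj dO go (fun w w' => forall (t : var G Obj) i (p : var D Par),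
    In i l -> w = tnth t x0 -> E (tnth p (d i)) w' (tnth t (x i)))) as (g & gS & gE);
  [exact HdO | exact Hgo | |].
{ intros w av'.
  assert (H : forall b : W Par, exists y : W Obj,
    forall (t : var G Obj) i (p : var D Par), In i l -> w = tnth t x0 ->
      tnth p (d i) = b -> E b y (tnth t (x i))).
  { intros b; destruct (classic (exists (t : var G Obj) i (p : var D Par),
      In i l /\ w = tnth t x0 /\ tnth p (d i) = b))
      as [(t & i & p & H1 & H2 & H3) | n].
    - exists (tnth t (x i)); intros t' i' p' H1' H2' H3'.
      replace (tnth t' (x i')) with (tnth t (x i')).
      + rewrite <- H3; apply (Hx i i' p p' t); auto; congr.
      + apply isoG; [exact H1' | congr].
    - destruct (gen_obj gW) as [o]; exists o; intros t i p H1 H2 H3; destruct n.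
      now exists t, i, p. }
  apply choice in H as [y Hy].
  destruct (gen_ext_obj gW (ds Par dp) y av') as [w' [nw Hw]].
  exists w'; split; [exact nw |]; intros _ t i p Hi e.
  destruct (WE (tnth p (d i))) as [_ _ Wt].
  apply Wt with (y (tnth p (d i))).
  - apply Hw, inds; auto.
  - now apply Hy with (p := p). }
destruct gS as (g1 & g2 & g3 & g4).
assert (gE' : forall (t : var G Obj) i (p : var D Par), In i l ->
  E (tnth p (d i)) (g (tnth t x0)) (tnth t (x i))).
{ intros t i p Hi; destruct (classic (old Obj (tnth t x0))) as [[u Hu] | n].
  - rewrite (g1 t u i Hu Hi), <- (proj1 (isoGD i Obj t u Hi) Hu).
    destruct (WE (tnth p (d i))) as [Wr _ _]; apply Wr.
  - now apply gE. }
(* [cor] traces the objects of [x'] and of all the [d i] back to [x0] and [d0]. It is single-valued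
   in this direction, so a coloring pulls back along it. *)
pose (cor := fun w' w : W Obj =>
  (exists t : var G Obj, w' = g (tnth t x0) /\ w = tnth t x0) \/
  (exists (u : var D Obj) i, In i l /\ w' = tnth u (d i) /\ w = tnth u d0)).
assert (corF : forall w' w1 w2, cor w' w1 -> cor w' w2 -> w1 = w2).
{ intros w' w1 w2 [(t & H1 & ->) | (u & i & Hi & H1 & ->)]
    [(t' & H2 & ->) | (u' & i' & Hi' & H2 & ->)].
  - apply g3; congr.
  - apply (g4 t u' i'); [exact Hi' | congr].
  - symmetry; apply (g4 t' u i); [exact Hi | congr].
  - apply (Hd i i' Obj u u'); auto; congr. }
(* A new parameter copies through [cor] the classes of [p], for all [d i] simultaneously. *)
destruct (build Par dp gp (fun p p' => forall w1 w2 w1' w2', cor w1' w1 ->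
    cor w2' w2 -> (E p w1 w2 <-> E p' w1' w2'))) as (h & hS & hE);
  [exact Hdp | exact Hgp | |].
{ intros p av'.
  destruct (@class_index (W Obj) (E p) (map (fun t => tnth t x0) go ++
    map (fun u => tnth u d0) dO) (WE p)) as [c [Hc1 Hc2]].
  assert (inC : forall w' w, cor w' w -> In w (map (fun t => tnth t x0) go ++
    map (fun u => tnth u d0) dO)).
  { intros w' w [(t & _ & ->) | (u & i & _ & _ & ->)]; apply in_app_iff.
    - left; apply (in_map (fun t => tnth t x0)), Hgo.
    - right; apply (in_map (fun t => tnth t d0)), HdO. }
  assert (H : forall w' : W Obj, exists k, P k /\ forall w, cor w' w -> k = c w).
  { intros w'; destruct (classic (exists w, cor w' w)) as [[w Hw] | n].
    - exists (c w); split.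
      + destruct (Hc2 w (inC _ _ Hw)) as [_ [f Hf]].
        exact (proj2 (gen_fits gW) p f (c w) Hf).
      + intros w2 H2; now rewrite (corF _ _ _ Hw H2).
    - exists 0; split; [apply gW |]; intros w Hw; destruct n; eauto. }
  apply choice in H as [c' Hc'].
  destruct (gen_ext_par gW (map (fun t => g (tnth t x0)) go ++ ds Obj dO) (c := c')
    av') as [p' [np Hp]].
  { intros w'; apply Hc'. }
  assert (inC' : forall w' w, cor w' w ->
    In w' (map (fun t => g (tnth t x0)) go ++ ds Obj dO)).
  { intros w' w [(t & -> & _) | (u & i & Hi & -> & _)]; apply in_app_iff.
    - left; apply (in_map (fun t => g (tnth t x0))), Hgo.
    - right; now apply inds. }
  exists p'; split; [exact np |]; intros _ w1 w2 w1' w2' C1 C2.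
  rewrite (Hp w1' w2') by eauto.
  rewrite (proj2 (Hc' w1') w1 C1), (proj2 (Hc' w2') w2 C2).
  symmetry; apply Hc1; eauto. }
destruct hS as (h1 & h2 & h3 & h4).
pose (gh := fun s : feq_sort => match s return W s -> W s with
  | Obj => g | Par => h end).
destruct (tuple_of (fun s (t : var G s) => gh s (tnth t x0))) as [x' Hx'].
exists x'; split.
- intros i Hi; split.
  + assert (K : forall s (t : var G s) (u : var D s),
      tnth t x0 = tnth u d0 <-> tnth t x' = tnth u (d i)).
    { intros s t u; rewrite Hx'; destruct s; simpl; split; intros e; auto.
      - now apply (g4 t u i).
      - now apply (h4 t u i). }
    intros s w w' z z' Hw Hz; apply pairs_tapp in Hw; apply pairs_tapp in Hz.
    destruct Hw as [[t [<- <-]] | [t [<- <-]]], Hz as [[u [<- <-]] | [u [<- <-]]].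
    * rewrite !Hx'; destruct s; simpl; split; intros e; try congr; auto.
    * apply K.
    * specialize (K s u t); split; intros e; symmetry; apply K; auto.
    * apply isoD, Hi.
  + assert (C : forall w w', pairs (tapp x0 d0) (tapp x' (d i)) (s := Obj) w w' ->
      cor w' w).
    { intros w w' Hw; apply pairs_tapp in Hw as [[t [<- <-]] | [u [<- <-]]].
      - left; exists t; now rewrite Hx'.
      - right; now exists u, i. }
    (* For a parameter of [d i], an object of [x'] may be replaced by the equivalent one of [x i],
       to which [Hiso] applies. *)
    assert (K : forall (q : var D Par) w w',
      pairs (tapp x0 d0) (tapp x' (d i)) (s := Obj) w w' ->
      exists z, pairs (tapp x0 d0) (tapp (x i) (d i)) (s := Obj) w z /\
        E (tnth q (d i)) w' z).
    { intros q w w' Hw; apply pairs_tapp in Hw as [[t [<- <-]] | [u [<- <-]]].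
      - exists (tnth t (x i)); split; [apply pairs_tapp; left; now exists t |].
        rewrite Hx'; apply gE', Hi.
      - exists (tnth u (d i)); split; [apply pairs_tapp; right; now exists u |].
        destruct (WE (tnth q (d i))) as [Wr _ _]; apply Wr. }
    assert (L : forall (q : var D Par) w w' z z',
      pairs (tapp x0 d0) (tapp x' (d i)) (s := Obj) w w' ->
      pairs (tapp x0 d0) (tapp x' (d i)) (s := Obj) z z' ->
      (E (tnth q d0) w z <-> E (tnth q (d i)) w' z')).
    { intros q w w' z z' Hw Hz; destruct (K q _ _ Hw) as [w1 [Hw1 Ew]].
      destruct (K q _ _ Hz) as [z1 [Hz1 Ez]].
      rewrite (proj2 (Hiso i Hi) (tnth q d0) (tnth q (d i)) w w1 z z1);
        [| apply pairs_tapp; right; now exists q | exact Hw1 | exact Hz1].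
      destruct (WE (tnth q (d i))) as [Wr Ws Wt]; split; intros r.
      - apply Wt with w1; [exact Ew |]; apply Wt with z1; auto.
      - apply Wt with w'; [auto |]; apply Wt with z'; auto. }
    intros p p' w w' z z' Hp Hw Hz; apply pairs_tapp in Hp.
    destruct Hp as [[t [<- <-]] | [q [<- <-]]]; [| now apply L].
    rewrite Hx'; simpl.
    destruct (classic (old Par (tnth t x0))) as [[q Hq] | n].
    * rewrite (h1 t q i Hq Hi), Hq; now apply L.
    * apply hE; auto.
- intros s t; destruct (classic (old s (tnth t x0))) as [o | n]; [now left | right].
  rewrite Hx'; destruct s; simpl; auto.
Qed.

(** * Dividing and forking in generic structures *)

Lemma forth_tuple (P : nat -> Prop) (W : structure Lfeq) (D G : list feq_sort)
    (d0 d : tuple W D) (x0 : tuple W G) :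
  generic P W -> piso (pairs d0 d) ->
  exists x : tuple W G, piso (pairs (tapp x0 d0) (tapp x d)).
Proof.
intros gW Hd; induction G as [|s G IH]; [now exists tt |].
destruct x0 as [w x0], (IH x0) as [x Hx].
destruct (@forth P P W W (G ++ D) (tapp x0 d0) (tapp x d) s w) as [y Hy];
  [apply gW | exact gW | auto | exact Hx |].
now exists (y, x).
Qed.

Lemma same_type_piso (M : structure Lfeq) (A : subset M) (G D : list feq_sort)
    (a b : tuple M G) (c : tuple M D) :
  same_type A a b -> tall A c -> piso (pairs (tapp a c) (tapp b c)).
Proof.
intros H Hc; split.
- intros s x x' y y' [u [<- <-]] [v [<- <-]].
  exact (H D (@feq Lfeq _ _ u v) c Hc).
- intros p p' x x' y y' [q [<- <-]] [u [<- <-]] [v [<- <-]].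
  exact (H D (@frel Lfeq _ tt (q, (u, (v, tt)))) c Hc).
Qed.

Lemma piso_same_type (P : nat -> Prop) (M : structure Lfeq) (A : subset M)
    (G : list feq_sort) (a b : tuple M G) :
  generic P M ->
  (forall (D : list feq_sort) (c : tuple M D), tall A c ->
    piso (pairs (tapp a c) (tapp b c))) ->
  same_type A a b.
Proof.
intros gM H D phi c Hc; apply (piso_sat gM gM (H D c Hc)).
intros s v; now exists v.
Qed.

Lemma same_type_piso_nil (M : structure Lfeq) (A : subset M) (G : list feq_sort)
    (a b : tuple M G) :
  same_type A a b -> piso (pairs a b).
Proof.
intros H; apply (piso_sub (same_type_piso (D := []) (c := tt) H I)).
intros s x x' h; apply pairs_tapp; now left.
Qed.

Lemma same_type_fixed (M : structure Lfeq) (A : subset M) (G : list feq_sort)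
    (a b : tuple M G) (s : feq_sort) (v : var G s) :
  same_type A a b -> A s (tnth v a) -> tnth v b = tnth v a.
Proof.
intros H Hv.
destruct (@same_type_piso M A G [s] a b (tnth v a, tt) H (conj Hv I)) as [K _].
apply (K s (tnth v a) _ (tnth v a) (tnth v a)); [| | reflexivity];
  apply pairs_tapp.
- left; now exists v.
- right; now exists (vz s []).
Qed.

Lemma not_divides (P : nat -> Prop) (M : structure Lfeq) (C : subset M)
    (G : list feq_sort) (chi : pform M G) (x : tuple M G) :
  generic P M -> (exists j, ~ P j) -> psat chi x ->
  (forall s (t : var G s) (u : var (pctx chi) s),
    tnth t x = tnth u (pval chi) -> C s (tnth t x)) ->
  ~ divides C chi.
Proof.
intros gM [j0 nP] Hx HC (W & f & k & d & Hf & Hd & Hk).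
assert (gW := generic_elementary Hf gM).
assert (fI : embedding f) by now apply elementary_embedding.
destruct chi as [D phi d0]; unfold psat in Hx; simpl in *.
pose (fd := tmap f d0); pose (fx := tmap f x); fold fd in Hd.
assert (H : forall i, exists y : tuple W G, piso (pairs (tapp fx fd) (tapp y (d i)))).
{ intros i; apply forth_tuple with P; [exact gW |].
  apply (piso_sub (piso_flip (same_type_piso_nil (Hd i)))).
  intros s z z' [v [<- <-]]; now exists v. }
apply choice in H as [y Hy].
destruct (gen_fits gW) as [WE WP].
destruct (var_finite D Obj) as [vo [Hvo _]], (var_finite D Par) as [vp [Hvp _]].
destruct (var_finite G Obj) as [go [Hgo _]].
(* Finitely many relations are made homogeneous: coincidences between coordinates of [d i] and
   [d j], and, for each parameter of [d i], equivalence of [y i] and [y j] coordinate by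
   coordinate. *)
pose (eqs := fun (s : feq_sort) (vs : list (var D s)) => flat_map (fun u =>
  map (fun v i j => tnth u (d i) = tnth v (d j)) vs) vs).
pose (cls := flat_map (fun p => map (fun t i j =>
  E (tnth p (d i)) (tnth t (y i)) (tnth t (y j))) go) vp).
destruct (ramsey_list (eqs Obj vo ++ eqs Par vp ++ cls)) as [h [Hh hom]].
assert (homE : forall s (u v : var D s),
  homogeneous (fun i j => tnth u (d i) = tnth v (d j)) h).
{ intros s u v; apply hom; rewrite !in_app_iff; destruct s; [left | right; left];
    apply in_flat_map; exists u; split; auto;
    apply (in_map (fun v i j => tnth u (d i) = tnth v (d j))); auto. }
assert (homC : forall p t, homogeneous (fun i j =>
  E (tnth p (d i)) (tnth t (y i)) (tnth t (y j))) h).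
{ intros p t; apply hom; rewrite !in_app_iff; right; right.
  apply in_flat_map; exists p; split; auto.
  apply (in_map (fun t i j => E (tnth p (d i)) (tnth t (y i)) (tnth t (y j)))); auto. }
(* Homogeneity only compares increasing indices; other pairs are reached through a later index and
   through index 0, which is kept as a pivot. Hence the restriction to positive indices. *)
assert (low : forall s (u v : var D s) i j, i < j ->
  tnth u (d (h i)) = tnth v (d (h j)) ->
  forall m n, 0 < m -> 0 < n -> tnth u (d (h m)) = tnth v (d (h n))).
{ intros s u v i j Hij e m n Hm Hn.
  destruct (homE s u v) as [K | K]; [| destruct (K i j Hij e)].
  transitivity (tnth v (d (h (S (m + n))))); [apply K; lia |].
  transitivity (tnth u (d (h 0))); [symmetry; apply K; lia | apply K, Hn]. }
assert (const : forall s (u v : var D s) i j, i <> j ->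
  tnth u (d (h i)) = tnth v (d (h j)) ->
  forall m n, 0 < m -> 0 < n -> tnth u (d (h m)) = tnth v (d (h n))).
{ intros s u v i j Hij e m n Hm Hn.
  destruct (Nat.lt_total i j) as [L | [L | L]]; [| lia |].
  - now apply (low s u v i j).
  - symmetry in e; symmetry; now apply (low s v u j i). }
assert (isoD : forall i s (u v : var D s), tnth u (d i) = tnth v (d i) ->
  tnth u fd = tnth v fd).
{ intros i s u v; apply (proj1 (Hy i)); apply pairs_tapp; right;
    [now exists u | now exists v]. }
(* One index more than [k] keeps the list nonempty even if [k] is 0. *)
pose (l := map h (seq 1 (S k))).
destruct (@amalgam P W l (h 1) D G fd d fx y (fun s => [])) as (x' & Hx' & _).
- exact gW.
- now left.
- intros i _; apply Hy.
- intros i j s u v Hi Hj e; apply in_map_iff in Hi as [m [<- Hm]].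
  apply in_map_iff in Hj as [n [<- Hn]]; apply in_seq in Hm, Hn.
  apply (isoD (h m)); destruct (Nat.eq_dec m n) as [<- | nmn]; [exact e |].
  apply (const s u v m n nmn e); lia.
- intros i j p q t Hi Hj e; apply in_map_iff in Hi as [m [<- Hm]].
  apply in_map_iff in Hj as [n [<- Hn]]; apply in_seq in Hm, Hn.
  destruct (WE (tnth p (d (h m)))) as [Wr Ws Wt].
  destruct (Nat.eq_dec m n) as [<- | nmn]; [apply Wr |].
  assert (cst : forall a b, 0 < a -> 0 < b -> tnth p (d (h a)) = tnth p (d (h b))).
  { intros a b Ha Hb; transitivity (tnth q (d (h (S (a + b)))));
      [| symmetry]; apply (const Par p q m n nmn e); lia. }
  destruct (homC p t) as [K | K].
  + destruct (Nat.lt_total m n) as [L | [L | L]]; [now apply K | lia |].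
    rewrite (cst m n) by lia.
    destruct (WE (tnth p (d (h n)))) as [_ Ws' _]; now apply Ws', K.
  (* Otherwise one fixed parameter would have infinitely many classes. *)
  + destruct nP.
    apply (WP (tnth p (d (h 1))) (fun i => tnth t (y (h (S i))))).
    intros i i' Hi; rewrite (cst 1 (S i)) by lia; apply K; lia.
(* A coordinate common to [x] and [d0] lies in [C], so conjugation over [C] fixes it. *)
- intros i j s t u _ _ e.
  assert (Hu : image (M := M) (N := W) f C (tnth u fd)).
  { exists (tnth u d0); split; [| symmetry; apply tnth_tmap].
    unfold fd, fx in e; rewrite !tnth_tmap in e; apply fI in e.
    rewrite <- e; now apply HC with u. }
  assert (st : forall i, tnth u (d i) = tnth u fd).
  { intros i'; apply (same_type_fixed (A := image (M := M) (N := W) f C)); [| exact Hu].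
    intros E0 psi c Hc; symmetry; now apply Hd. }
  now rewrite !st.
- pose (l' := map h (seq 1 k)).
  apply (Hk l').
  + unfold l'; apply Injective_map_NoDup; [| apply seq_NoDup].
    intros m n e; destruct (Nat.lt_total m n) as [L | [L | L]]; [| exact L |];
      apply Hh in L; lia.
  + unfold l'; now rewrite length_map, length_seq.
  + exists x'; intros i Hi; unfold psat; simpl.
    assert (Hi' : In i l).
    { apply in_map_iff in Hi as [m [<- Hm]]; apply in_map, in_seq.
      apply in_seq in Hm; lia. }
    apply (piso_sat gW gW (Hx' i Hi') phi (a := tapp fx fd)).
    * intros s v; now exists v.
    * unfold fx, fd; rewrite <- tmap_tapp; now apply Hf.
Qed.

(** Finitely many dividing formulas cannot cover the type: [amalgam], used with a single index,
    moves the solution [x] over the parameters of [ps] to an [x'] whose other coordinates avoid all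
    parameters of [ds]. Then [x'] meets the parameters of any formula of [ds] inside the image of
    [C] only, and [not_divides] applies. *)
Lemma not_forks (P : nat -> Prop) (M : structure Lfeq) (C : subset M)
    (G : list feq_sort) (p : ptype M G) (x : tuple M G) :
  generic P M -> (exists j, ~ P j) ->
  (forall chi, p chi -> psat chi x /\
    forall s (t : var G s) (u : var (pctx chi) s),
      tnth t x = tnth u (pval chi) -> C s (tnth t x)) ->
  ~ forks C p.
Proof.
intros gM fP Hp (W & f & ps & ds & Hf & Hps & Hds & Hcov).
assert (gW := generic_elementary Hf gM).
assert (fI : embedding f) by now apply elementary_embedding.
assert (HL : forall s : feq_sort, exists L : list (M s),
  (forall (chi : pform M G) (u : var (pctx chi) s), In chi ps -> In (tnth u (pval chi)) L) /\
  forall w, In w L -> exists (chi : pform M G) (u : var (pctx chi) s),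
    In chi ps /\ w = tnth u (pval chi)).
{ intros s; clear - ps; induction ps as [|chi qs [L [H1 H2]]].
  - exists []; simpl; split; [tauto | intros w []].
  - destruct (var_finite (pctx chi) s) as [vs [Hvs _]].
    exists (map (fun u => tnth u (pval chi)) vs ++ L); split.
    + intros chi' u [<- | h]; apply in_app_iff.
      * left; apply (in_map (fun u => tnth u (pval chi))), Hvs.
      * right; now apply H1.
    + intros w h; apply in_app_iff in h as [h | h].
      * apply in_map_iff in h as [u [<- _]]; exists chi, u; split; [now left | auto].
      * destruct (H2 w h) as (chi' & u & h1 & h2); exists chi', u; split;
          [now right | exact h2]. }
destruct (HL Obj) as (LO & LO1 & LO2), (HL Par) as (LP & LP1 & LP2).
destruct (@context_of M LO LP) as (D & e & HO & HP).
assert (e1 : forall (chi : pform M G) (s : feq_sort) (u : var (pctx chi) s), In chi ps ->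
  exists v : var D s, tnth v e = tnth u (pval chi)).
{ intros chi [|] u h; [apply HO, LO1, h | apply HP, LP1, h]. }
assert (e2 : forall (s : feq_sort) (v : var D s), exists (chi : pform M G) (u : var (pctx chi) s),
  In chi ps /\ tnth v e = tnth u (pval chi)).
{ intros [|] v; [apply LO2, HO | apply LP2, HP]; now exists v. }
assert (HA : forall s : feq_sort, exists L : list (W s),
  forall (delta : pform W G) (u : var (pctx delta) s), In delta ds -> In (tnth u (pval delta)) L).
{ intros s; clear - ds; induction ds as [|chi qs [L H1]].
  - exists []; simpl; tauto.
  - destruct (var_finite (pctx chi) s) as [vs [Hvs _]].
    exists (map (fun u => tnth u (pval chi)) vs ++ L).
    intros chi' u [<- | h]; apply in_app_iff.
    + left; apply (in_map (fun u => tnth u (pval chi))), Hvs.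
    + right; now apply H1. }
destruct (HA Obj) as [AO HAO], (HA Par) as [AP HAP].
pose (av := fun s : feq_sort => match s return list (W s) with Obj => AO | Par => AP end).
destruct (@amalgam P W [0] 0 D G (tmap f e) (fun _ => tmap f e) (tmap f x)
  (fun _ => tmap f x) av) as (x' & Hx' & Hav).
- exact gW.
- now left.
- intros i _; split.
  + intros s w w' z z' [u [<- <-]] [v [<- <-]]; tauto.
  + intros q q' w w' z z' [t [<- <-]] [u [<- <-]] [v [<- <-]]; tauto.
- auto.
- intros; apply (proj1 (gen_fits gW)).
- auto.
- specialize (Hx' 0 (or_introl eq_refl)).
  destruct (Hcov x') as [delta [Hdel Hsat]].
  + intros chi Hchi; unfold psat; simpl.
    apply (piso_sat gW gW Hx' (pphi chi) (a := tmap f (tapp x (pval chi)))).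
    * intros s v; apply pairs_tapp; rewrite tnth_tmap.
      destruct (var_app v) as [[w ->] | [w ->]].
      -- left; exists w; now rewrite !tnth_varl, tnth_tmap.
      -- right; destruct (e1 chi s w Hchi) as [v' Hv']; exists v'.
         rewrite !tnth_varr, !tnth_tmap; split; exact (f_equal (f s) Hv').
    * apply Hf, Hp, Hps, Hchi.
  + apply (@not_divides P W (image (M := M) (N := W) f C) G delta x' gW fP Hsat); [| now apply Hds].
    intros s t u Htu.
    destruct (Hav s t) as [[v Hv] | n].
    * rewrite !tnth_tmap in Hv; apply fI in Hv.
      destruct (e2 s v) as (chi & w & Hchi & Hw).
      exists (tnth t x); split.
      -- apply (proj2 (Hp chi (Hps chi Hchi)) s t w); congr.
      -- transitivity (f s (tnth v e)); [exact (f_equal (f s) Hv) |].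
         apply (proj1 Hx' s (f s (tnth v e)) _ (f s (tnth t x)) _);
           [| | exact (f_equal (f s) (eq_sym Hv))]; apply pairs_tapp.
         ++ right; exists v; split; apply tnth_tmap.
         ++ left; exists t; split; [apply tnth_tmap | reflexivity].
    * destruct n; rewrite Htu; destruct s; simpl; auto.
Qed.

(* The clones of M embed back into M, which provides, without compactness, an
   elementary extension of M in which an element outside C has infinitely many
   conjugates over C. *)
Definition clones (M : structure Lfeq) : structure Lfeq :=
  {| dom := fun s => (M s * nat)%type;
     interp := fun r xs => interp (tmap (fun s (x : M s * nat) => fst x) xs) |}.

Lemma clones_fits (P : nat -> Prop) (M : structure Lfeq) :
  fits P M -> fits P (clones M).
Proof.
intros [ME MP]; split.
- intros [b i]; destruct (ME b) as [r s t]; split; red.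
  + intros [x k]; apply r.
  + intros [x k] [y m]; apply s.
  + intros [x k] [y m] [z n]; apply t.
- intros [b i] f j H; apply (MP b (fun k => fst (f k))), H.
Qed.

Lemma clones_countable (M : structure Lfeq) :
  countable_structure M -> countable_structure (clones M).
Proof.
intros [code H].
exists (fun q => Cantor.to_nat (code (existT (fun s => M s) (projT1 q) (fst (projT2 q))),
  snd (projT2 q))).
intros [s [x i]] [t [y j]] e; apply (f_equal Cantor.of_nat) in e.
rewrite !Cantor.cancel_of_to in e; simpl in e; injection e as e1 e2.
apply H in e1; subst j.
exact (f_equal (fun u => existT (dom (clones M)) (projT1 u) (projT2 u, i)) e1).
Qed.

Definition is_elt (M : structure Lfeq) (G : list feq_sort) (s : feq_sort)
    (t : var G s) (b : M s) : pform M G :=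
  @PForm Lfeq M G [s] (@feq Lfeq _ _ (varl [s] t) (varr G (vz s []))) (b, tt).

Lemma psat_is_elt (M : structure Lfeq) (G : list feq_sort) (s : feq_sort)
    (t : var G s) (b : M s) (x : tuple M G) :
  psat (is_elt t b) x <-> tnth t x = b.
Proof.
unfold psat; simpl; rewrite tnth_varl, tnth_varr; reflexivity.
Qed.

(** Sending each point to its clone of index 0 is an elementary map of [M] into itself. The clones
    of [b] are distinct conjugates over the image of [C], and a coordinate cannot equal two of
    them. *)
Lemma divides_is_elt (P : nat -> Prop) (M : structure Lfeq) (C : subset M)
    (G : list feq_sort) (s : feq_sort) (t : var G s) (b : M s) :
  generic P M -> countable_structure M -> ~ C s b -> divides C (is_elt t b).
Proof.
intros gM cM nC.
destruct (@countable_extend P (clones M) M [] tt tt) as (h & Hh & _).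
- now apply clones_countable.
- apply clones_fits, gM.
- exact gM.
- split.
  + intros s' x x' y y' [v _]; destruct (var_nil v).
  + intros p p' x x' y y' [v _]; destruct (var_nil v).
- pose (f := fun (s : feq_sort) (x : M s) => h s (x, 0)).
  assert (hp := proj1 (embedding_piso h) Hh).
  assert (Hf : elementary (M := M) (N := M) f).
  { apply (embedding_elementary gM gM), embedding_piso; split.
    - intros s' x x' y y' -> ->; unfold f; split; [now intros -> |].
      intros e; apply Hh in e; congruence.
    - intros p p' x x' y y' -> -> ->.
      exact (proj2 hp (p, 0) _ (x, 0) _ (y, 0) _ eq_refl eq_refl eq_refl). }
  exists M, f, 2, (fun i => (h s (b, i), tt)); split; [exact Hf |]; split.
  + intros i; apply (piso_same_type gM); intros D c Hc.
    (* The partial isomorphism that fixes the clones of index 0 of [C] and takes the clone [i] of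
       [b] to its clone 0. *)
    pose (orig := fun (s' : feq_sort) (z : M s' * nat) (x x' : M s') =>
      exists z0 : M s' * nat, fst z = fst z0 /\ x = h s' z /\ x' = h s' z0 /\
      ((exists y, C s' y /\ z = (y, 0) /\ z0 = (y, 0)) \/
       exists e : s = s', z = eq_rect s (fun s => (M s * nat)%type) (b, i) s' e /\
         z0 = eq_rect s (fun s => (M s * nat)%type) (b, 0) s' e)).
    apply (piso_sub (r' := fun s' x x' => exists z, orig s' z x x')).
    * split.
      -- intros s' x x' y y' (z & z0 & _ & -> & -> & Hz) (w & w0 & _ & -> & -> & Hw).
         assert (K : z = w <-> z0 = w0).
         { destruct Hz as [(y & Cy & -> & ->) | (e & Hz & Hz0)],
             Hw as [(y' & Cy' & -> & ->) | (e' & Hw & Hw0)].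
           - tauto.
           - subst s'; simpl in Hw, Hw0; subst w w0.
             split; intros K; injection K; intros; subst; contradiction.
           - subst s'; simpl in Hz, Hz0; subst z z0.
             split; intros K; injection K; intros; subst; contradiction.
           - rewrite (proof_irrelevance _ e e') in Hz, Hz0; subst; tauto. }
         split; intros e.
         ++ apply Hh in e; f_equal; now apply K.
         ++ apply Hh in e; f_equal; now apply K.
      -- intros p p' x x' y y' (z1 & w1 & e1 & -> & -> & _)
           (z2 & w2 & e2 & -> & -> & _) (z3 & w3 & e3 & -> & -> & _).
         rewrite <- !(embedding_E Hh); unfold E; simpl; now rewrite e1, e2, e3.
    * intros s' x x' Hx; apply pairs_tapp in Hx as [[v [<- <-]] | [v [<- <-]]].
      -- change (tmap f (pval (is_elt t b))) with ((h s (b, 0), tt) : tuple M [s]).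
         revert s' v; apply (var_case (P := fun s' v => exists z, orig s' z
           (tnth v ((h s (b, i), tt) : tuple M [s]))
           (tnth v ((h s (b, 0), tt) : tuple M [s])))).
         ++ exists (b, i), (b, 0); repeat split; right; now exists eq_refl.
         ++ intros s' v; destruct (var_nil v).
      -- rewrite tall_tnth in Hc; destruct (Hc s' v) as [y [Cy Hy]].
         exists (y, 0), (y, 0); repeat split; [exact (eq_sym Hy) | exact (eq_sym Hy) |].
         left; now exists y.
  + intros l nd len [x Hx].
    destruct l as [|i [|j [|]]]; try discriminate.
    assert (Hi := Hx i (or_introl eq_refl)).
    assert (Hj := Hx j (or_intror (or_introl eq_refl))).
    apply (psat_is_elt t (h s (b, i)) x) in Hi.
    apply (psat_is_elt t (h s (b, j)) x) in Hj.
    rewrite Hi in Hj; apply Hh in Hj; injection Hj as <-.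
    inversion nd as [|? ? n]; apply n; now left.
Qed.

(** The disjuncts that witness forking equate a coordinate with an element outside [C], and [M]
    itself serves as the extension. *)
Lemma forks_elts (P : nat -> Prop) (M : structure Lfeq) (C : subset M)
    (G : list feq_sort) (p : ptype M G) (ps : list (pform M G))
    (os : list (var G Obj * M Obj)) (bs : list (var G Par * M Par)) :
  generic P M -> countable_structure M ->
  (forall chi, In chi ps -> p chi) ->
  (forall q, In q os -> ~ C Obj (snd q)) -> (forall q, In q bs -> ~ C Par (snd q)) ->
  (forall x : tuple M G, (forall chi, In chi ps -> psat chi x) ->
    (exists q, In q os /\ tnth (fst q) x = snd q) \/
    (exists q, In q bs /\ tnth (fst q) x = snd q)) ->
  forks C p.
Proof.
intros gM cM Hps Ho Hb Hx.
exists M, (fun s x => x), ps, (map (fun q => is_elt (fst q) (snd q)) os ++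
  map (fun q => is_elt (fst q) (snd q)) bs).
assert (id : forall s b, ~ C s b -> ~ image (M := M) (N := M) (fun s x => x) C b).
{ intros s b n [y [Cy ->]]; contradiction. }
repeat split.
- now rewrite tmap_id.
- now rewrite tmap_id.
- exact Hps.
- intros delta Hd; apply in_app_iff in Hd as [Hd | Hd];
    apply in_map_iff in Hd as [q [<- Hq]];
    apply divides_is_elt with P; auto.
- intros x Hsat; destruct (Hx x) as [[q [Hq e]] | [q [Hq e]]].
  + intros chi Hchi; specialize (Hsat chi Hchi).
    unfold psat in *; simpl in Hsat; rewrite tmap_id in Hsat; exact Hsat.
  + exists (is_elt (fst q) (snd q)); split; [| now apply psat_is_elt].
    apply in_app_iff; left.
    now apply (in_map (fun q => is_elt (fst q) (snd q))).
  + exists (is_elt (fst q) (snd q)); split; [| now apply psat_is_elt].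
    apply in_app_iff; right.
    now apply (in_map (fun q => is_elt (fst q) (snd q))).
Qed.

(** If each solution shares with [b] an element outside [C], the finitely many possible coincidences
    form a covering disjunction for [forks_elts]. Conversely, a solution without such a coincidence
    is what [not_forks] asks for. *)
Lemma forks_ptype_at (P : nat -> Prop) (M : structure Lfeq) (C : subset M)
    (G D : list feq_sort) (pi : list (form Lfeq (G ++ D))) (b : tuple M D) :
  generic P M -> countable_structure M -> (exists j, ~ P j) ->
  (forks C (ptype_at pi b) <->
   ~ exists x : tuple M G, (forall phi, In phi pi -> sat phi (tapp x b)) /\
       forall s (t : var G s) (u : var D s), ~ C s (tnth u b) ->
         tnth t x <> tnth u b).
Proof.
intros gM cM fP; split.
- intros Hf [x [Hx HC]]; revert Hf.
  apply (@not_forks P M C G (ptype_at pi b) x gM fP).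
  intros chi [phi [Hphi ->]]; split; [now apply Hx |]; simpl.
  intros s t u e; rewrite e; apply NNPP; intros n; exact (HC s t u n e).
- intros H.
  assert (L : forall s : feq_sort, exists l : list (var G s * M s),
    (forall q, In q l -> ~ C s (snd q)) /\
    forall (t : var G s) (u : var D s), ~ C s (tnth u b) -> In (t, tnth u b) l).
  { intros s; destruct (var_finite G s) as [gs [Hgs _]].
    destruct (var_finite D s) as [us [Hus _]].
    exists (filter (fun q => if excluded_middle_informative (C s (snd q))
      then false else true)
      (list_prod gs (map (fun u => tnth u b) us))); split.
    - intros q Hq; apply filter_In in Hq as [_ Hq].
      destruct (excluded_middle_informative (C s (snd q))); [discriminate | auto].
    - intros t u n; apply filter_In; split.
      + apply in_prod; [apply Hgs | apply (in_map (fun u => tnth u b)), Hus].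
      + simpl; destruct (excluded_middle_informative (C s (tnth u b))); tauto. }
  destruct (L Obj) as (os & Ho1 & Ho2), (L Par) as (bs & Hb1 & Hb2).
  apply (@forks_elts P M C G (ptype_at pi b) (map (fun phi => PForm phi b) pi) os bs);
    auto.
  + intros chi Hchi; apply in_map_iff in Hchi as [phi [<- Hphi]]; now exists phi.
  + intros x Hx; apply NNPP; intros n; apply H; exists x; split.
    * intros phi Hphi; apply (Hx (PForm phi b)).
      now apply (in_map (fun phi => @PForm Lfeq M G D phi b)).
    * intros s t u nC e; apply n; destruct s; [left | right];
        exists (t, tnth u b); split; auto.
Qed.

(** The formula naming a coordinate of [a] that lies in [B] belongs to the type, and divides if the
    coordinate is outside [C]. *)
Lemma forks_tp (P : nat -> Prop) (M : structure Lfeq) (C B : subset M)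
    (G : list feq_sort) (a : tuple M G) :
  generic P M -> countable_structure M -> (exists j, ~ P j) ->
  (forks C (tp B a) <->
   exists s (t : var G s), B s (tnth t a) /\ ~ C s (tnth t a)).
Proof.
intros gM cM fP; split.
- intros Hf; apply NNPP; intros n; revert Hf.
  apply (@not_forks P M C G (tp B a) a gM fP).
  intros chi [HB Hs]; split; [exact Hs |].
  intros s t u e; apply NNPP; intros nC; apply n; exists s, t; split; [| exact nC].
  rewrite e; now apply tall_tnth.
- intros (s & t & HB & nC).
  assert (Htp : tp B a (is_elt t (tnth t a))).
  { split; [now split | now apply psat_is_elt]. }
  assert (Hsat : forall x : tuple M G,
    (forall chi, In chi [is_elt t (tnth t a)] -> psat chi x) -> tnth t x = tnth t a).
  { intros x Hx; apply psat_is_elt, Hx; now left. }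
  assert (Hin : forall chi, In chi [is_elt t (tnth t a)] -> tp B a chi).
  { intros chi [<- | []]; exact Htp. }
  destruct s.
  + apply (@forks_elts P M C G (tp B a) [is_elt t (tnth t a)] [(t, tnth t a)] []);
      [exact gM | exact cM | exact Hin | | |].
    * intros q [<- | []]; exact nC.
    * intros q [].
    * intros x Hx; left; exists (t, tnth t a); split; [now left | now apply Hsat].
  + apply (@forks_elts P M C G (tp B a) [is_elt t (tnth t a)] [] [(t, tnth t a)]);
      [exact gM | exact cM | exact Hin | | |].
    * intros q [].
    * intros q [<- | []]; exact nC.
    * intros x Hx; right; exists (t, tnth t a); split; [now left | now apply Hsat].
Qed.

(** The clones of [M] embed into [M] with the clone 0 of each parameter sent to that parameter; a
    solution outside [A] then has infinitely many clones, all of them solutions. *)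
Lemma acl_generic (P : nat -> Prop) (M : structure Lfeq) (A : subset M)
    (s : feq_sort) (x : M s) :
  generic P M -> countable_structure M -> (acl A x <-> A s x).
Proof.
intros gM cM; split.
- intros (G & phi & a & HA & Hphi & l & Hl); apply NNPP; intros nA.
  rewrite tall_tnth in HA.
  destruct (@countable_extend P (clones M) M G
    (tmap (U := clones M) (fun s (y : M s) => (y, 0)) a) a) as (h & Hh & ha).
  + now apply clones_countable.
  + apply clones_fits, gM.
  + exact gM.
  + split.
    * intros t y y' z z' [u [<- <-]] [v [<- <-]]; rewrite !tnth_tmap.
      split; intros e; [exact (f_equal fst e) | exact (f_equal (fun w => (w, 0)) e)].
    * intros p p' y y' z z' [q [<- <-]] [u [<- <-]] [v [<- <-]].
      rewrite !tnth_tmap; reflexivity.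
  + assert (K : forall i, In (h s (x, i)) l).
    { intros i; apply Hl.
      (* Fixes [a] and moves [x] to its clone [i]; this is a partial isomorphism because [x], being
         outside [A], differs from the coordinates of [a]. *)
      pose (r := fun (t : feq_sort) (y y' : M t) =>
        (exists v : var G t, y = tnth v a /\ y' = h t (tnth v a, 0)) \/
        (exists e : s = t, y = eq_rect s M x t e /\
           y' = eq_rect s M (h s (x, i)) t e)).
      assert (Hr : piso r).
      { split.
        - intros t y y' z z' [(v & -> & ->) | (e & He & He')]
            [(w & -> & ->) | (e1 & He1 & He1')].
          + split; intros e; [now rewrite e |]; apply Hh in e; congruence.
          + subst t; simpl in He1, He1'; subst z z'; split; intros e.
            * destruct nA; rewrite <- e; apply HA.
            * apply Hh in e; injection e; intros _ e'; destruct nA; rewrite <- e'; apply HA.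
          + subst t; simpl in He, He'; subst y y'; split; intros e.
            * destruct nA; rewrite e; apply HA.
            * apply Hh in e; injection e; intros _ e'; destruct nA; rewrite e'; apply HA.
          + rewrite (proof_irrelevance _ e e1) in He, He'; subst; tauto.
        - assert (HE := embedding_E Hh).
          assert (lift : forall t y y', r t y y' -> exists k, y' = h t (y, k)).
          { intros t y y' [(v & -> & ->) | (e & He & He')]; [now exists 0 |].
            subst t; simpl in He, He'; subst; now exists i. }
          intros p p' y y' z z' Rp Ry Rz.
          destruct (lift _ _ _ Rp) as [k1 ->], (lift _ _ _ Ry) as [k2 ->],
            (lift _ _ _ Rz) as [k3 ->].
          rewrite <- HE; reflexivity. }
      apply (piso_sat gM gM Hr phi (a := (x, a))); [| exact Hphi].
      apply (var_case (P := fun t v => r t (tnth v ((x, a) : tuple M (s :: G)))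
        (tnth v ((h s (x, i), a) : tuple M (s :: G))))).
      - right; now exists eq_refl.
      - intros t v; left; exists v; split; [reflexivity |]; simpl.
        specialize (ha t v); rewrite tnth_tmap in ha; exact (eq_sym ha). }
    assert (len : length (map (fun i => h s (x, i)) (seq 0 (S (length l)))) <= length l).
    { apply NoDup_incl_length.
      - apply Injective_map_NoDup; [| apply seq_NoDup].
        intros i j e; apply Hh in e; congruence.
      - intros y Hy; apply in_map_iff in Hy as [i [<- _]]; apply K. }
    rewrite length_map, length_seq in len; lia.
- intros HA.
  exists [s], (@feq Lfeq [s; s] s (vz s [s]) (vs s (vz s []))), (x, tt).
  split; [now split |]; split; [reflexivity |].
  exists [x]; intros y Hy; left; symmetry; exact Hy.
Qed.

(** * Isomorphisms and substructures *)

Lemma embedding_of_E (M N : structure Lfeq) (f : forall s, M s -> N s) :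
  (forall s x y, f s x = f s y -> x = y) ->
  (forall p x y, E p x y <-> E (f Par p) (f Obj x) (f Obj y)) -> embedding f.
Proof.
intros H1 H2; split; [exact H1 | intros [] [p [x [y []]]]; exact (H2 p x y)].
Qed.

Lemma isomorphic_sym (M N : structure Lfeq) : isomorphic M N -> isomorphic N M.
Proof.
intros [f [Hf sur]].
pose (g := fun s y => proj1_sig (constructive_indefinite_description _ (sur s y))).
assert (fg : forall s y, f s (g s y) = y).
{ intros s y; unfold g; apply proj2_sig. }
exists g; split; [apply embedding_of_E |].
- intros s x y e; rewrite <- (fg s x), <- (fg s y), e; reflexivity.
- intros p x y; rewrite (embedding_E Hf), !fg; reflexivity.
- intros s x; exists (f s x); apply Hf, fg.
Qed.

Lemma isomorphic_trans (M N K : structure Lfeq) :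
  isomorphic M N -> isomorphic N K -> isomorphic M K.
Proof.
intros [f [Hf sf]] [g [Hg sg]]; exists (fun s x => g s (f s x)); split.
- now apply embedding_comp.
- intros s z; destruct (sg s z) as [y <-], (sf s y) as [x <-]; now exists x.
Qed.

Lemma isomorphism_elementary (M N : structure Lfeq) (f : forall s, M s -> N s) :
  isomorphism f -> elementary f.
Proof.
intros [Hf sf] G phi.
induction phi as [G | G s u v | G r xs | G p IHp q IHq | G s p IHp]; simpl; intros a.
- tauto.
- rewrite !tnth_tmap; split; [now intros -> | apply Hf].
- destruct r, xs as [q [u [v []]]]; simpl; rewrite !tnth_tmap.
  exact (embedding_E Hf (tnth q a) (tnth u a) (tnth v a)).
- rewrite IHp, IHq; tauto.
- split; intros H x.
  + destruct (sf s x) as [y <-]; apply (IHp (y, a)), H.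
  + apply (IHp (x, a)), H.
Qed.

Lemma generic_isomorphic (P : nat -> Prop) (M N : structure Lfeq) :
  isomorphic M N -> generic P N -> generic P M.
Proof.
intros H gN; apply isomorphic_sym in H as [f Hf].
apply (generic_elementary (isomorphism_elementary Hf) gN).
Qed.

Lemma countable_injective (M N : structure Lfeq) (f : forall s, M s -> N s) :
  (forall s x y, f s x = f s y -> x = y) ->
  countable_structure N -> countable_structure M.
Proof.
intros Hf [code Hc].
exists (fun q => code (existT _ (projT1 q) (f (projT1 q) (projT2 q)))).
intros [s x] [t y] e; apply Hc in e; simpl in e.
assert (st : s = t) by exact (f_equal (@projT1 _ _) e); subst t; f_equal.
apply Hf, (inj_pair2 _ _ _ _ _ e).
Qed.

Lemma sub_val_injective (L : language) (M : structure L) (A : subset M) s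
    (x y : sub A s) : sub_val x = sub_val y -> x = y.
Proof.
destruct x as [x hx], y as [y hy]; simpl; intros <-; f_equal.
apply proof_irrelevance.
Qed.

Lemma tuple_sub (M : structure Lfeq) (N : subset M) (G : list feq_sort)
    (a : tuple M G) :
  tall N a -> exists a' : tuple (sub N) G, tmap (@sub_val Lfeq M N) a' = a.
Proof.
rewrite tall_tnth; intros H.
destruct (tuple_of (T := sub N) (fun s v => exist _ (tnth v a) (H s v)))
  as [a' Ha'].
exists a'; apply tuple_ext; intros s v; rewrite tnth_tmap, Ha'; reflexivity.
Qed.

Lemma finite_lists (D : feq_sort -> Type)
    (l : list {s : feq_sort & D s}) :
  exists (os : list (D Obj)) (bs : list (D Par)),
    (forall x, In (existT _ Obj x) l -> In x os) /\
    (forall b, In (existT _ Par b) l -> In b bs).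
Proof.
induction l as [|[[|] x] l (os & bs & H1 & H2)].
- now exists [], [].
- exists (x :: os), bs; split.
  + intros y [e | h]; [left; apply (inj_pair2 _ _ _ _ _ e) | right; auto].
  + intros b [e | h]; [discriminate | auto].
- exists os, (x :: bs); split.
  + intros b [e | h]; [discriminate | auto].
  + intros y [e | h]; [left; apply (inj_pair2 _ _ _ _ _ e) | right; auto].
Qed.

(** * Extension properties of the limit of K_Q *)

Definition of_lists (D : feq_sort -> Type) (os : list (D Obj)) (bs : list (D Par))
    (s : feq_sort) : D s -> Prop :=
  match s with Obj => fun x => In x os | Par => fun b => In b bs end.

Lemma of_lists_finite (M : structure LQ) (os : list (M Obj)) (bs : list (M Par)) :
  finite_subset (M := M) (of_lists os bs).
Proof.
exists (map (existT (fun s : sort LQ => M s) Obj) os ++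
  map (existT (fun s : sort LQ => M s) Par) bs).
intros [|] x Hx; apply in_app_iff; [left | right];
  apply (in_map (existT (fun s : sort LQ => M s) _)), Hx.
Qed.

Lemma lift_list (T : Type) (Y : T -> Prop) (l : list T) :
  (forall y, In y l -> Y y) -> exists l' : list (sig Y), map (@proj1_sig _ _) l' = l.
Proof.
induction l as [|x l IH]; intros H; [now exists [] |].
destruct IH as [l' <-]; [intros y Hy; apply H; now right |].
now exists (exist _ x (H x (or_introl eq_refl)) :: l').
Qed.

Lemma color_reps (T : Type) (c : T -> nat) (k : nat) :
  exists l : list T, length l <= k /\
    forall x, c x < k -> exists y, In y l /\ c x = c y.
Proof.
induction k as [|k [l [Hl H]]].
- exists []; split; [auto | intros x; lia].
- destruct (classic (exists x, c x = k)) as [[x0 Hx0] | n].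
  + exists (x0 :: l); split; [simpl; lia |]; intros x Hx.
    destruct (Nat.eq_dec (c x) k) as [e | e].
    * exists x0; split; [now left | congruence].
    * destruct (H x) as [y [Hy ey]]; [lia |]; exists y; split; [now right | auto].
  + exists l; split; [lia |]; intros x Hx; apply H.
    destruct (Nat.eq_dec (c x) k) as [e | e]; [destruct n; eauto | lia].
Qed.

Lemma least_nat (A : nat -> Prop) :
  (exists n, A n) -> exists n, A n /\ forall m, m < n -> ~ A m.
Proof.
intros [n Hn]; revert Hn; induction n as [n IH] using lt_wf_ind; intros Hn.
destruct (classic (exists m, m < n /\ A m)) as [[m [Hm Am]] | h].
- now apply (IH m).
- exists n; split; [exact Hn |]; intros m Hm Am; apply h; eauto.
Qed.

(** The new object [None] enters the predicates Q at index [n]; [cls b] is the trace on [Y] of its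
    class for [b], empty if the class is new. *)
Definition add_obj (MQ : structure LQ) (Y : subset MQ) (n : nat)
    (cls : MQ Par -> MQ Obj -> Prop) : structure LQ :=
  @Structure LQ
    (fun s => match s with
              | Obj => option {x : MQ Obj | Y Obj x}
              | Par => {b : MQ Par | Y Par b}
              end)
    (fun r =>
       match r with
       | EQ => fun xs : {b : MQ Par | Y Par b} *
             (option {x : MQ Obj | Y Obj x} * (option {x : MQ Obj | Y Obj x} * unit)) =>
           match fst (snd xs), fst (snd (snd xs)) with
           | Some x, Some y =>
               @E (reduct MQ) (proj1_sig (fst xs)) (proj1_sig x) (proj1_sig y)
           | Some x, None | None, Some x => cls (proj1_sig (fst xs)) (proj1_sig x)
           | None, None => True
           end
       | Q i => fun xs : option {x : MQ Obj | Y Obj x} * unit =>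
           match fst xs with Some x => inQ i (proj1_sig x) | None => n <= i end
       | R i => fun xs : {b : MQ Par | Y Par b} * unit => inR i (proj1_sig (fst xs))
       end).

Definition add_par (MQ : structure LQ) (Y : subset MQ) (n : nat)
    (c : MQ Obj -> nat) : structure LQ :=
  @Structure LQ
    (fun s => match s with
              | Obj => {x : MQ Obj | Y Obj x}
              | Par => option {b : MQ Par | Y Par b}
              end)
    (fun r =>
       match r with
       | EQ => fun xs : option {b : MQ Par | Y Par b} *
             ({x : MQ Obj | Y Obj x} * ({x : MQ Obj | Y Obj x} * unit)) =>
           match fst xs with
           | Some b => @E (reduct MQ) (proj1_sig b) (proj1_sig (fst (snd xs)))
               (proj1_sig (fst (snd (snd xs))))
           | None => c (proj1_sig (fst (snd xs))) = c (proj1_sig (fst (snd (snd xs))))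
           end
       | Q i => fun xs : {x : MQ Obj | Y Obj x} * unit => inQ i (proj1_sig (fst xs))
       | R i => fun xs : option {b : MQ Par | Y Par b} * unit =>
           match fst xs with Some b => inR i (proj1_sig b) | None => n <= i end
       end).

Section Limit.
Variable MQ : structure LQ.
Hypothesis age : has_age MQ KQ.
Hypothesis inj : weakly_injective MQ KQ.
Local Notation Eq := (@E (reduct MQ)).

Lemma KQ_sub (Y : subset MQ) : finite_subset Y -> KQ (sub Y).
Proof.
intros HY; apply age; split; [apply finite_sub, HY |].
exists (@sub_val _ MQ Y); split; [intros s x y; apply sub_val_injective |].
simpl; tauto.
Qed.

Lemma limit_equivalence (b : MQ Par) : Equivalence (Eq b).
Proof.
assert (H : forall x y z : MQ Obj, Eq b x x /\ (Eq b x y -> Eq b y x) /\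
  (Eq b x y -> Eq b y z -> Eq b x z)).
{ intros x y z.
  destruct (KQ_sub (of_lists_finite [x; y; z] [b])) as [[_ KE] _].
  destruct (KE (exist (of_lists [x; y; z] [b] (s := Par)) b (or_introl eq_refl)))
    as [r s t].
  pose (x' := exist (of_lists [x; y; z] [b] (s := Obj)) x (or_introl eq_refl)).
  pose (y' := exist (of_lists [x; y; z] [b] (s := Obj)) y
    (or_intror (or_introl eq_refl))).
  pose (z' := exist (of_lists [x; y; z] [b] (s := Obj)) z
    (or_intror (or_intror (or_introl eq_refl)))).
  split; [exact (r x') | split; [exact (s x' y') | exact (t x' y' z')]]. }
split; red.
- intros x; exact (proj1 (H x x x)).
- intros x y; exact (proj1 (proj2 (H x y x))).
- intros x y z; exact (proj2 (proj2 (H x y z))).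
Qed.

Lemma inQ_mono (i j : nat) (x : MQ Obj) : i <= j -> inQ i x -> inQ j x.
Proof.
intros Hij Hx; induction Hij as [|j _ IH]; [exact Hx |].
destruct (KQ_sub (of_lists_finite [x] [])) as [_ K].
destruct (K j) as [K1 _].
exact (K1 (exist (of_lists [x] [] (s := Obj)) x (or_introl eq_refl)) IH).
Qed.

Lemma inR_mono (i j : nat) (b : MQ Par) : i <= j -> inR i b -> inR j b.
Proof.
intros Hij Hb; induction Hij as [|j _ IH]; [exact Hb |].
destruct (KQ_sub (of_lists_finite [] [b])) as [_ K].
destruct (K j) as [_ [K1 _]].
exact (K1 (exist (of_lists [] [b] (s := Par)) b (or_introl eq_refl)) IH).
Qed.

Lemma limit_imposes (Y : subset MQ) (i : nat) (b : MQ Par) :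
  finite_subset Y -> Y Par b -> inR i b ->
  exists l : list {x : MQ Obj | Y Obj x}, length l <= S i /\
    forall x, Y Obj x -> inQ i x -> exists y, In y l /\ Eq b x (proj1_sig y).
Proof.
intros HY Yb Rb; destruct (KQ_sub HY) as [_ K]; destruct (K i) as [_ [_ KI]].
destruct (KI (exist _ b Yb) Rb) as [l [Hl H]].
exists l; split; [exact Hl |]; intros x Yx Qx.
destruct (H (exist _ x Yx) Qx) as [y [Hy e]]; now exists y.
Qed.

Lemma finite_sub_lists (Y : subset MQ) : finite_subset Y ->
  exists (os : list {x : MQ Obj | Y Obj x}) (bs : list {b : MQ Par | Y Par b}),
    (forall x, In x os) /\ forall b, In b bs.
Proof.
intros HY; destruct (finite_sub HY) as [l Hl].
destruct (@finite_lists (fun s => {x : MQ s | Y s x}) l) as (os & bs & H1 & H2).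
exists os, bs; split; intros x; [apply H1, Hl | apply H2, Hl].
Qed.

(** Conditions bear on the set [Y] given by weak injectivity, the conclusion on [X]. At a level [i]
    containing the new point and [b], the bound of i + 1 classes survives if the point joins the
    class of a point of that level, or if the points of that level in [Y] meet at most [i]
    classes. *)
Lemma extend_obj (X : subset MQ) : finite_subset X ->
  exists Y : subset MQ, finite_subset Y /\ subset_le X Y /\
  forall (n : nat) (cls : MQ Par -> MQ Obj -> Prop),
  (forall b z z', Y Par b -> Y Obj z -> Y Obj z' -> cls b z ->
     (cls b z' <-> Eq b z z')) ->
  (forall b i, Y Par b -> n <= i -> inR i b ->
     (exists z, Y Obj z /\ inQ i z /\ cls b z) \/
     (exists l : list (MQ Obj), length l <= i /\ (forall y, In y l -> Y Obj y) /\
        forall z, Y Obj z -> inQ i z -> exists y, In y l /\ Eq b z y)) ->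
  exists x : MQ Obj, (forall i, inQ i x <-> n <= i) /\ ~ X Obj x /\
    forall b z, X Par b -> X Obj z -> (Eq b x z <-> cls b z).
Proof.
intros HX; destruct (inj HX) as (Y & HY & XY & Hext).
exists Y; split; [exact HY | split; [exact XY |]]; intros n cls Hcls Hbound.
pose (Z := add_obj Y n cls).
pose (g := fun s : feq_sort => match s return sub Y s -> Z s with
  | Obj => fun x => Some x | Par => fun b => b end).
assert (KZ : KQ Z).
{ destruct (finite_sub_lists HY) as (os & bs & Hos & Hbs).
  assert (ZE : forall b : Z Par, Equivalence (@E (reduct Z) b)).
  { intros [b Yb]; destruct (limit_equivalence b) as [Er Es Et].
    split; red; unfold E; simpl.
    - intros [x |]; [apply Er | exact I].
    - intros [x |] [y |]; auto; apply Es.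
    - intros [[x Yx] |] [[y Yy] |] [[z Yz] |]; simpl; auto; intros H1 H2.
      + now apply Et with y.
      + apply (Hcls b y x); auto.
      + now apply (Hcls b x z).
      + now apply (Hcls b y z). }
  split; [split; [| exact ZE] |].
  - exists (existT (dom Z) Obj None :: map (fun x => existT (dom Z) Obj (Some x)) os ++
      map (fun b => existT (dom Z) Par b) bs).
    intros [[|] x]; [destruct x as [x |] |].
    + right; apply in_app_iff; left.
      apply (in_map (fun x => existT (dom Z) Obj (Some x))), Hos.
    + now left.
    + right; apply in_app_iff; right.
      apply (in_map (fun x => existT (dom Z) Par x)), Hbs.
  - intros i; split; [| split].
    + intros [[x Yx] |]; unfold inQ; simpl; [apply inQ_mono; lia | lia].
    + intros [b Yb]; unfold inR; simpl; apply inR_mono; lia.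
    + intros [b Yb] Rb; unfold inR in Rb; simpl in Rb.
      destruct (limit_imposes HY Yb Rb) as [l [Hl H]].
      assert (old : forall x : {x : MQ Obj | Y Obj x}, inQ i (proj1_sig x) ->
        exists y, In y (map Some l) /\
          @E (reduct Z) (exist _ b Yb) (Some x) y).
      { intros [x Yx] Qx; destruct (H x Yx Qx) as [y [Hy e]].
        exists (Some y); split; [now apply in_map | exact e]. }
      destruct (le_lt_dec n i) as [Hi | Hi].
      * destruct (Hbound b i Yb Hi Rb) as [(z & Yz & Qz & cz) | (l' & Hl' & Yl' & H')].
        -- exists (map Some l); split; [rewrite length_map; exact Hl |].
           intros [x |] Qx; [now apply old |].
           destruct (H z Yz Qz) as [[y Yy] [Hy e]].
           exists (Some (exist _ y Yy)); split; [now apply in_map |].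
           apply (Hcls b z y Yb Yz Yy cz), e.
        -- destruct (lift_list Yl') as [l'' <-].
           exists (None :: map Some l''); simpl; rewrite length_map in *; split; [lia |].
           intros [[x Yx] |] Qx.
           ++ destruct (H' x Yx Qx) as [y [Hy e]].
              apply in_map_iff in Hy as [y' [<- Hy']].
              exists (Some y'); split; [right; now apply in_map | exact e].
           ++ exists None; split; [now left | exact I].
      * exists (map Some l); split; [rewrite length_map; exact Hl |].
        intros [x |] Qx; [now apply old | unfold inQ in Qx; simpl in Qx; lia]. }
destruct (Hext Z g KZ) as [h [[hi hr] hX]].
{ split.
  - intros [|] x y; simpl; [congruence | auto].
  - intros [| i | i] xs.
    + destruct xs as [p [x [y []]]]; simpl; reflexivity.
    + destruct xs as [x []]; simpl; reflexivity.
    + destruct xs as [x []]; simpl; reflexivity. }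
exists (h Obj None); split; [| split].
- intros i; symmetry; exact (hr (Q i) (None, tt)).
- intros Xn; assert (e := hX Obj (exist _ _ (XY Obj _ Xn)) Xn).
  apply hi in e; discriminate.
- intros b z Xb Xz.
  assert (eb := hX Par (exist _ b (XY Par b Xb)) Xb).
  assert (ez := hX Obj (exist _ z (XY Obj z Xz)) Xz).
  assert (K := hr EQ (exist _ b (XY Par b Xb), (None,
    (Some (exist _ z (XY Obj z Xz)), tt)))).
  simpl in K, eb, ez; rewrite eb, ez in K; symmetry; exact K.
Qed.

(** The new parameter is bound by the class condition from level [n] on, where n + 1 classes are
    allowed: any coloring with the colors 0 to n is admissible. *)
Lemma extend_par (X : subset MQ) : finite_subset X ->
  forall (n : nat) (c : MQ Obj -> nat), (forall x, c x <= n) ->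
  exists b : MQ Par, inR n b /\ ~ X Par b /\
    forall x y, X Obj x -> X Obj y -> (Eq b x y <-> c x = c y).
Proof.
intros HX n c Hc; destruct (inj HX) as (Y & HY & XY & Hext).
pose (Z := add_par Y n c).
pose (g := fun s : feq_sort => match s return sub Y s -> Z s with
  | Obj => fun x => x | Par => fun b => Some b end).
assert (KZ : KQ Z).
{ destruct (finite_sub_lists HY) as (os & bs & Hos & Hbs).
  assert (ZE : forall b : Z Par, Equivalence (@E (reduct Z) b)).
  { intros [[b Yb] |].
    - destruct (limit_equivalence b) as [Er Es Et].
      split; red; unfold E; simpl.
      + intros x; apply Er.
      + intros x y; apply Es.
      + intros x y z; apply Et.
    - split; red; unfold E; simpl; intros; congruence. }
  split; [split; [| exact ZE] |].
  - exists (existT (dom Z) Par None :: map (fun x => existT (dom Z) Obj x) os ++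
      map (fun b => existT (dom Z) Par (Some b)) bs).
    intros [[|] x]; [| destruct x as [x |]].
    + right; apply in_app_iff; left.
      apply (in_map (fun x => existT (dom Z) Obj x)), Hos.
    + right; apply in_app_iff; right.
      apply (in_map (fun x => existT (dom Z) Par (Some x))), Hbs.
    + now left.
  - intros i; split; [| split].
    + intros [x Yx]; unfold inQ; simpl; apply inQ_mono; lia.
    + intros [[b Yb] |]; unfold inR; simpl; [apply inR_mono; lia | lia].
    + intros [[b Yb] |] Rb; unfold inR in Rb; simpl in Rb.
      * destruct (limit_imposes HY Yb Rb) as [l [Hl H]].
        exists l; split; [exact Hl |]; intros [x Yx] Qx; exact (H x Yx Qx).
      * destruct (@color_reps (Z Obj) (fun x => c (proj1_sig x)) (S n)) as [l [Hl H]].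
        exists l; split; [simpl in *; lia |]; intros x _.
        destruct (H x (le_n_S _ _ (Hc _))) as [y [Hy e]]; now exists y. }
destruct (Hext Z g KZ) as [h [[hi hr] hX]].
{ split.
  - intros [|] x y; simpl; [auto | congruence].
  - intros [| i | i] xs.
    + destruct xs as [p [x [y []]]]; simpl; reflexivity.
    + destruct xs as [x []]; simpl; reflexivity.
    + destruct xs as [x []]; simpl; reflexivity. }
exists (h Par None); split; [| split].
- apply (hr (R n) (None, tt)); simpl; auto.
- intros Xn; assert (e := hX Par (exist _ _ (XY Par _ Xn)) Xn).
  apply hi in e; discriminate.
- intros x y Xx Xy.
  assert (ex := hX Obj (exist _ x (XY Obj x Xx)) Xx).
  assert (ey := hX Obj (exist _ y (XY Obj y Xy)) Xy).
  assert (K := hr EQ (None, (exist _ x (XY Obj x Xx),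
    (exist _ y (XY Obj y Xy), tt)))).
  simpl in K, ex, ey; rewrite ex, ey in K; symmetry; exact K.
Qed.

(** * Genericity of the levels and of their union *)

(** The point [None] of [KQ_obstruction] lies in every Q. Its image gives a harmless class to join
    for the parameters that weak injectivity adds. *)
Lemma limit_inhabited : exists q : MQ Obj, forall i, inQ i q.
Proof.
destruct (proj1 (age _) KQ_obstruction_KQ) as [_ [f [_ fr]]].
exists (f Obj None); intros i; apply (fr (Q i) (None, tt)); simpl; auto.
Qed.

(** Joining the class of a point of level [n] adds no class at any later level; for parameters of
    [Y] outside [bs], that point is [q]. *)
Lemma level_ext_obj (n : nat) (bs : list (MQ Par)) (y : MQ Par -> MQ Obj)
    (av : list (MQ Obj)) :
  (forall b, In b bs -> inQ n (y b)) ->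
  exists x, inQ n x /\ ~ In x av /\ forall b, In b bs -> Eq b x (y b).
Proof.
intros Hy; destruct limit_inhabited as [q Hq].
pose (y' := fun b => if excluded_middle_informative (In b bs) then y b else q).
assert (yy : forall b, In b bs -> y' b = y b).
{ intros b Hb; unfold y'; destruct (excluded_middle_informative (In b bs)); tauto. }
assert (Qy : forall b, inQ n (y' b)).
{ intros b; unfold y'; destruct (excluded_middle_informative (In b bs)); auto. }
assert (Xy : forall b, In (y' b) (q :: map y bs ++ av)).
{ intros b; unfold y'; destruct (excluded_middle_informative (In b bs)); [| now left].
  right; apply in_app_iff; left; now apply in_map. }
destruct (extend_obj (of_lists_finite (q :: map y bs ++ av) bs))
  as (Y & _ & XY & H).
destruct (H n (fun b z => Eq b (y' b) z)) as (x & Qx & nx & Hx).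
- intros b z z' _ _ _; destruct (limit_equivalence b) as [Er Es Et].
  split; intros; eauto.
- intros b i _ Hi _; left; exists (y' b); split; [apply XY, Xy | split].
  + apply inQ_mono with n; auto.
  + apply limit_equivalence.
- exists x; split; [now apply Qx | split].
  + intros Hin; apply nx; right; apply in_app_iff; now right.
  + intros b Hb; rewrite <- (yy b Hb); apply Hx; [exact Hb | apply Xy |].
    apply limit_equivalence.
Qed.

(** Opening a new class of [b] may fail, as points of [Y] outside the classes of [l] may use up the
    classes allowed at some level above [n]. Let [i0] be the least level of such a point. If it is
    at most [n], the point itself will do. Otherwise joining its class is safe from level [i0] on,
    while at the levels from [n] up to [i0] the classes of [l], at most [n] in number, contain
    everything and leave room for one more. *)
Lemma level_class (n : nat) (b : MQ Par) (l : list (MQ Obj)) :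
  inR n b -> (forall y, In y l -> inQ n y) -> length l <= n ->
  exists x, inQ n x /\ forall y, In y l -> ~ Eq b x y.
Proof.
intros Rb Ql Hl; destruct limit_inhabited as [q Hq].
destruct (limit_equivalence b) as [Er Es Et].
destruct (extend_obj (of_lists_finite (q :: l) [b])) as (Y & _ & XY & H).
assert (Yq : Y Obj q) by (apply XY; now left).
assert (Yl : forall y, In y l -> Y Obj y) by (intros y Hy; apply XY; now right).
pose (A := fun i => exists z, Y Obj z /\ inQ i z /\ forall y, In y l -> ~ Eq b z y).
assert (cover : forall i z, ~ A i -> Y Obj z -> inQ i z ->
  exists y, In y l /\ Eq b z y).
{ intros i z nA Yz Qz; apply NNPP; intros h; apply nA; exists z.
  split; [exact Yz | split; [exact Qz |]]; intros y Hy e; apply h; eauto. }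
(* The new point joins the class of a point of the least possible level, if there
   is one outside the classes of l. *)
assert (finish : forall c : MQ Obj -> Prop,
  (forall z z', Y Obj z -> Y Obj z' -> c z -> (c z' <-> Eq b z z')) ->
  (forall i, n <= i -> A i -> exists z, Y Obj z /\ inQ i z /\ c z) ->
  (forall y, In y l -> ~ c y) ->
  exists x, inQ n x /\ forall y, In y l -> ~ Eq b x y).
{ intros c Hc HA cl.
  (* For parameters other than [b], the point joins the class of [q]. *)
  destruct (H n (fun b' z => (b' = b /\ c z) \/ (b' <> b /\ Eq b' q z)))
    as (x & Qx & _ & Hx).
  - intros b' z z' _ Yz Yz' [[-> cz] | [nb ez]].
    + rewrite <- (Hc z z' Yz Yz' cz); tauto.
    + destruct (limit_equivalence b') as [Er' Es' Et'].
      split; [intros [[e _] | [_ e]]; [contradiction | eauto] |].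
      intros e; right; split; [exact nb | eauto].
  - intros b' i _ Hi _; destruct (classic (b' = b)) as [-> | nb].
    + destruct (classic (A i)) as [Ai | nA].
      * left; destruct (HA i Hi Ai) as (z & Yz & Qz & cz); exists z.
        split; [exact Yz | split; [exact Qz | tauto]].
      * right; exists l; split; [lia | split; [exact Yl |]].
        intros z Yz Qz; now apply (cover i).
    + left; exists q; split; [exact Yq | split; [apply Hq |]].
      right; split; [exact nb | apply limit_equivalence].
  - exists x; split; [now apply Qx |]; intros y Hy e.
    apply Hx in e; [| now left | now right].
    destruct e as [[_ e] | [e _]]; [exact (cl y Hy e) | now apply e]. }
destruct (classic (exists i, A i)) as [HA | nA].
- apply least_nat in HA as (i0 & (z0 & Yz0 & Qz0 & Hz0) & Hmin).
  destruct (le_lt_dec i0 n) as [Hi0 | Hi0].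
  { exists z0; split; [now apply inQ_mono with i0 | exact Hz0]. }
  apply (finish (fun z => Eq b z0 z)).
  + intros z z' _ _ e; split; eauto.
  + intros i Hi Ai; exists z0; split; [exact Yz0 | split; [| apply Er]].
    apply inQ_mono with i0; [| exact Qz0].
    destruct (le_lt_dec i0 i) as [h | h]; [exact h | destruct (Hmin i h Ai)].
  + exact Hz0.
- apply (finish (fun _ => False)); [tauto | | tauto].
  intros i _ Ai; destruct nA; eauto.
Qed.

Lemma level_few (n : nat) (b : MQ Par) (f : nat -> MQ Obj) (j : nat) :
  inR n b -> (forall i, inQ n (f i)) ->
  (forall i i', i < i' <= j -> ~ Eq b (f i) (f i')) -> j <= n.
Proof.
intros Rb Qf Hf; destruct (limit_equivalence b) as [Er Es Et].
destruct (@limit_imposes (of_lists (map f (seq 0 (S j))) [b]) n b)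
  as [l [Hl H]]; [apply of_lists_finite | now left | exact Rb |].
assert (H' : forall i, exists y, i <= j -> In y l /\ Eq b (f i) (proj1_sig y)).
{ intros i; destruct (le_lt_dec i j) as [h | h].
  - destruct (H (f i)) as [y Hy]; [| apply Qf | now exists y].
    apply (in_map f), in_seq; lia.
  - destruct (H (f 0)) as [y Hy]; [now left | apply Qf |].
    exists y; intros h'; lia. }
apply choice in H' as [g Hg].
assert (K : length (map g (seq 0 (S j))) <= length l).
{ apply NoDup_incl_length.
  - apply NoDup_map_NoDup_ForallPairs; [| apply seq_NoDup].
    assert (lt : forall i i', i < i' <= j -> g i <> g i').
    { intros i i' Hi e; apply (Hf i i' Hi).
      destruct (Hg i) as [_ h1], (Hg i') as [_ h2]; try lia.
      rewrite <- e in h2; eauto. }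
    intros i i' Hi Hi' e; apply in_seq in Hi, Hi'.
    destruct (Nat.lt_total i i') as [h | [h | h]]; [| exact h |].
    + destruct (lt i i'); [lia | exact e].
    + destruct (lt i' i); [lia | auto].
  - intros y Hy; apply in_map_iff in Hy as [i [<- Hi]]; apply in_seq in Hi.
    apply Hg; lia. }
rewrite length_map, length_seq in K; lia.
Qed.

(** Restates genericity through elements of [MQ]; functions on [sub A] are extended by an object of
    [A] or by the color 0. *)
Lemma generic_sub (P : nat -> Prop) (A : subset (reduct MQ)) :
  P 0 -> (exists o, A Obj o) ->
  (forall (b : MQ Par) (f : nat -> MQ Obj) (j : nat), A Par b ->
     (forall i, A Obj (f i)) ->
     (forall i i', i < i' <= j -> ~ Eq b (f i) (f i')) -> P j) ->
  (forall (b : MQ Par) (l : list (MQ Obj)), A Par b -> (forall y, In y l -> A Obj y) ->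
     P (length l) -> exists x, A Obj x /\ forall y, In y l -> ~ Eq b x y) ->
  (forall (bs : list (MQ Par)) (y : MQ Par -> MQ Obj) (av : list (MQ Obj)),
     (forall b, In b bs -> A Obj (y b)) ->
     exists x, A Obj x /\ ~ In x av /\ forall b, In b bs -> Eq b x (y b)) ->
  (forall (os : list (MQ Obj)) (c : MQ Obj -> nat) (av : list (MQ Par)),
     (forall x, P (c x)) ->
     exists b, A Par b /\ ~ In b av /\
       forall x y, In x os -> In y os -> (Eq b x y <-> c x = c y)) ->
  generic P (sub A).
Proof.
intros P0 [o Ao] Hfew Hclass Hobj Hpar.
assert (in_val : forall s (l : list (sub A s)) (x : sub A s),
  In x l -> In (proj1_sig x) (map (@proj1_sig _ _) l)).
{ intros s l x Hx; now apply in_map. }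
constructor.
- split.
  + intros [b Ab]; destruct (limit_equivalence b) as [Er Es Et].
    split; red; unfold E; simpl.
    * intros x; apply Er.
    * intros x y; apply Es.
    * intros x y z; apply Et.
  + intros [b Ab] f j Hf.
    apply (Hfew b (fun i => proj1_sig (f i)) j Ab); [| exact Hf].
    intros i; apply proj2_sig.
- constructor; exact (exist _ o Ao).
- exact P0.
- intros [b Ab] f j Pj.
  destruct (Hclass b (map (fun i => proj1_sig (f i)) (seq 0 j)) Ab) as (x & Ax & Hx).
  + intros y Hy; apply in_map_iff in Hy as [i [<- _]]; apply proj2_sig.
  + now rewrite length_map, length_seq.
  + exists (exist _ x Ax); intros i Hi; apply Hx.
    apply (in_map (fun i => proj1_sig (f i))), in_seq; lia.
- intros bs y av.
  pose (y' := fun b : MQ Par => match excluded_middle_informative (A Par b) with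
    | left h => proj1_sig (y (exist _ b h)) | right _ => o end).
  assert (yy : forall b : sub A Par, y' (proj1_sig b) = proj1_sig (y b)).
  { intros [b Ab]; unfold y'; simpl.
    destruct (excluded_middle_informative (A Par b)) as [h | h]; [| contradiction].
    now rewrite (proof_irrelevance _ h Ab). }
  destruct (Hobj (map (@proj1_sig _ _) bs) y' (map (@proj1_sig _ _) av))
    as (x & Ax & nx & Hx).
  + intros b _; unfold y'.
    destruct (excluded_middle_informative (A Par b)); [apply proj2_sig | exact Ao].
  + exists (exist _ x Ax); split.
    * intros h; apply nx; exact (in_val _ _ _ h).
    * intros b Hb; unfold E; simpl; rewrite <- yy; apply Hx, in_val, Hb.
- intros os c av Pc.
  pose (c' := fun x : MQ Obj => match excluded_middle_informative (A Obj x) with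
    | left h => c (exist _ x h) | right _ => 0 end).
  assert (cc : forall x : sub A Obj, c' (proj1_sig x) = c x).
  { intros [x Ax]; unfold c'; simpl.
    destruct (excluded_middle_informative (A Obj x)) as [h | h]; [| contradiction].
    now rewrite (proof_irrelevance _ h Ax). }
  destruct (Hpar (map (@proj1_sig _ _) os) c' (map (@proj1_sig _ _) av))
    as (b & Ab & nb & Hb).
  + intros x; unfold c'; destruct (excluded_middle_informative (A Obj x)); auto.
  + exists (exist _ b Ab); split.
    * intros h; apply nb; exact (in_val _ _ _ h).
    * intros x y Hx Hy; rewrite <- !cc; apply Hb; now apply in_val.
Qed.

(** Level [n] has n + 1 classes, hence more than [j] of them exactly when j is at most n. *)
Lemma generic_level (n : nat) : generic (fun j => j <= n) (M_ MQ n).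
Proof.
apply generic_sub.
- lia.
- destruct limit_inhabited as [q Hq]; exists q; apply Hq.
- intros b f j; apply level_few.
- intros b l; apply level_class.
- intros bs y av; apply level_ext_obj.
- intros os c av Hc.
  destruct (extend_par (of_lists_finite os av) Hc) as (b & Rb & nb & Hb).
  now exists b.
Qed.

(** Finitely many elements lie in a common level, which can be raised until it has classes
    enough. *)
Lemma generic_Mlim : generic (fun _ => True) (Mlim MQ).
Proof.
assert (common : forall l : list (MQ Obj), (forall x, In x l -> exists n, inQ n x) ->
  exists n, forall x, In x l -> inQ n x).
{ induction l as [|x l IH]; intros H; [exists 0; intros x [] |].
  destruct IH as [n Hn]; [intros y Hy; apply H; now right |].
  destruct (H x (or_introl eq_refl)) as [m Hm]; exists (m + n).
  intros y [<- | Hy]; [apply inQ_mono with m | apply inQ_mono with n]; auto; lia. }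
assert (bound : forall (c : MQ Obj -> nat) (l : list (MQ Obj)),
  exists n, forall x, In x l -> c x <= n).
{ intros c l; exists (list_max (map c l)); intros x Hx.
  assert (K := proj1 (list_max_le (map c l) _) (le_n _)).
  rewrite Forall_forall in K; apply K, in_map, Hx. }
apply generic_sub.
- exact I.
- destruct limit_inhabited as [q Hq]; exists q, 0; apply Hq.
- auto.
- intros b l [m Rb] Ql _; destruct (common l Ql) as [n Hn].
  (* This level contains [b] and [l] and allows more than [length l] classes. *)
  destruct (@level_class (m + n + length l) b l) as (x & Qx & Hx).
  + apply inR_mono with m; [lia | exact Rb].
  + intros y Hy; apply inQ_mono with n; [lia | auto].
  + lia.
  + exists x; split; [now exists (m + n + length l) | exact Hx].
- intros bs y av Qy; destruct (common (map y bs)) as [n Hn].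
  { intros x Hx; apply in_map_iff in Hx as [b [<- Hb]]; now apply Qy. }
  destruct (@level_ext_obj n bs y av) as (x & Qx & Hx).
  + intros b Hb; now apply Hn, in_map.
  + exists x; split; [now exists n | exact Hx].
- intros os c av _; destruct (bound c os) as [n Hn].
  (* [extend_par] wants a bound on all colors; truncating at a bound for [os] leaves the colors on
     [os] unchanged. *)
  destruct (extend_par (of_lists_finite os av) (n := n)
    (c := fun x => Nat.min (c x) n)) as (b & Rb & nb & Hb).
  + intros x; lia.
  + exists b; split; [now exists n | split; [exact nb |]].
    intros x y Hx Hy; rewrite (Hb x y Hx Hy).
    specialize (Hn x Hx) as h1; specialize (Hn y Hy) as h2; lia.
Qed.

End Limit.

(** * Directed covering systems of copies *)

Lemma Mlim_countable (MQ : structure LQ) :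
  countable_structure MQ -> countable_structure (Mlim MQ).
Proof.
intros H; apply (@countable_injective (Mlim MQ) (reduct MQ) (@sub_val _ _ _)).
- intros s x y; apply sub_val_injective.
- exact H.
Qed.

Lemma copies_isomorphic (MQ : structure LQ) (N N' : subset (Mlim MQ)) :
  isomorphic (sub N) (sub N') -> copies N -> copies N'.
Proof.
intros H [n Hn]; exists n; apply isomorphic_trans with (sub N); [| exact Hn].
now apply isomorphic_sym.
Qed.

Lemma image_isomorphic (M : structure Lfeq) (f : forall s, M s -> M s) (N : subset M) :
  automorphism f -> isomorphic (sub N) (sub (image (M := M) (N := M) f N)).
Proof.
intros [Hf _].
exists (fun s (x : sub N s) => exist (image (M := M) (N := M) f N (s := s))
  (f s (proj1_sig x)) (ex_intro _ (proj1_sig x) (conj (proj2_sig x) eq_refl))).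
split; [apply embedding_of_E |].
- intros s x y e; apply sub_val_injective; apply Hf.
  exact (f_equal (@proj1_sig _ _) e).
- intros p x y; exact (embedding_E Hf (proj1_sig p) (proj1_sig x) (proj1_sig y)).
- intros s [y [x [Nx <-]]]; exists (exist _ x Nx); now apply sub_val_injective.
Qed.

Lemma parts_copies (MQ : structure LQ) (N : subset (Mlim MQ)) : parts N -> copies N.
Proof.
intros [n ->]; exists n.
exists (fun s (x : sub (@part MQ n) s) =>
  exist (@level MQ n s) (proj1_sig (proj1_sig x)) (proj2_sig x)).
split; [apply embedding_of_E |].
- intros s x y e; apply sub_val_injective, sub_val_injective.
  exact (f_equal (@proj1_sig _ _) e).
- intros p x y; reflexivity.
- intros s [y Hy].
  exists (exist (@part MQ n s) (exist _ y (ex_intro _ n Hy)) Hy); reflexivity.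
Qed.

Section Directed.
Variable MQ : structure LQ.
Hypothesis hMQ : fraisse_limit KQ MQ.

Lemma countable_MQ : countable_structure MQ.
Proof. apply hMQ. Qed.

Lemma generic_lim : generic (fun _ => True) (Mlim MQ).
Proof. apply generic_Mlim; apply hMQ. Qed.

Lemma sub_countable (N : subset (Mlim MQ)) : countable_structure (sub N).
Proof.
apply (@countable_injective (sub N) (Mlim MQ) (@sub_val _ _ _)).
- intros s x y; apply sub_val_injective.
- apply Mlim_countable, countable_MQ.
Qed.

Lemma copies_generic (N : subset (Mlim MQ)) :
  copies N -> exists n, generic (fun j => j <= n) (sub N).
Proof.
intros [n Hn]; exists n; apply (generic_isomorphic Hn).
apply generic_level; apply hMQ.
Qed.

Lemma finite_bound (n : nat) : exists j, ~ j <= n.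
Proof. exists (S n); lia. Qed.

Variable H : collection (Mlim MQ).
Hypothesis HC : forall N, H N -> copies N.
Hypothesis HD : directed H.
Hypothesis HV : covering H.

Lemma cover_tuple (G : list feq_sort) (a : tuple (Mlim MQ) G) :
  exists N, H N /\ tall N a.
Proof.
induction G as [|s G IH].
- destruct HD as [[N HN] _]; exists N; split; [exact HN | exact I].
- destruct a as [x a], (IH a) as (N1 & H1 & Ha), (HV x) as (N2 & H2 & Hx).
  destruct HD as [_ D]; destruct (D N1 N2 H1 H2) as (N & HN & L1 & L2).
  exists N; split; [exact HN |]; split; [apply L2, Hx |].
  apply tall_tnth; intros t v; apply L1; rewrite tall_tnth in Ha; apply Ha.
Qed.

Lemma distinct_classes (m : nat) : exists (b : Mlim MQ Par) (f : nat -> Mlim MQ Obj),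
  forall i i', i < i' <= m -> ~ E b (f i) (f i').
Proof.
assert (gM := generic_lim).
destruct (gen_ext_par gM [] (c := fun _ => 0) []) as [b _]; [auto |].
exists b; destruct (proj1 (gen_fits gM) b) as [_ Es _].
induction m as [|m [f Hf]].
- destruct (gen_obj gM) as [o]; exists (fun _ => o); lia.
- destruct (gen_class gM b f (j := S m) I) as [x Hx].
  exists (fun i => if i =? S m then x else f i); intros i i' Hi.
  destruct (Nat.eqb_spec i (S m)); [lia |].
  destruct (Nat.eqb_spec i' (S m)).
  + intros r; apply (Hx i); [lia | now apply Es].
  + apply Hf; lia.
Qed.

(* The copies of M_n in a directed covering system have n arbitrarily large: they
   must eventually contain points in many classes. *)
Lemma eventually_generic (G : list feq_sort) (a : tuple (Mlim MQ) G) (m : nat)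
    (Q : subset (Mlim MQ) -> Prop) :
  (forall (N : subset (Mlim MQ)) n (a' : tuple (sub N) G), H N -> tmap (@sub_val Lfeq _ N) a' = a ->
     m <= n -> generic (fun j => j <= n) (sub N) -> Q N) ->
  eventually H a Q.
Proof.
intros HQ; destruct (distinct_classes m) as (b & f & Hf).
destruct (@context_of (Mlim MQ) (map f (seq 0 (S m))) [b]) as (D & d & H1 & H2).
destruct (cover_tuple (tapp a d)) as (N & HN & Had).
rewrite tall_tnth in Had.
assert (Ha : tall N a).
{ apply tall_tnth; intros s v.
  specialize (Had s (varl D v)); now rewrite tnth_varl in Had. }
assert (Hd : forall s (v : var D s), N s (tnth v d)).
{ intros s v; specialize (Had s (varr G v)); now rewrite tnth_varr in Had. }
exists N; split; [exact HN | split; [exact Ha |]].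
intros N' HN' L.
destruct (tuple_sub (N := N') (a := a)) as [a' Ha'].
{ apply tall_tnth; intros s v; rewrite tall_tnth in Ha; apply L, Ha. }
destruct (copies_generic (HC HN')) as [n gN].
apply (HQ N' n a' HN' Ha'); [| exact gN].
assert (Nb : N' Par b).
{ apply L; destruct (proj1 (H2 b) (or_introl eq_refl)) as [v <-]; apply Hd. }
assert (Nf : forall i, i <= m -> N' Obj (f i)).
{ intros i Hi; apply L; destruct (proj1 (H1 (f i))) as [v <-]; [| apply Hd].
  apply in_map, in_seq; lia. }
assert (K : forall i, exists x : sub N' Obj, i <= m -> proj1_sig x = f i).
{ intros i; destruct (le_lt_dec i m) as [h | h].
  - now exists (exist _ (f i) (Nf i h)).
  - exists (exist _ (f 0) (Nf 0 (Nat.le_0_l m))); intros h'; lia. }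
apply choice in K as [g Hg].
apply (proj2 (gen_fits gN) (exist _ b Nb) g m).
intros i i' Hi; unfold E; simpl; rewrite !Hg by lia; now apply Hf.
Qed.

(** Once the number of classes exceeds [length G + depth psi], the formula [psi] cannot tell it from
    infinity. *)
Lemma directed_truth : truth_convergence H.
Proof.
intros G psi a Hpsi; apply eventually_generic with (m := length G + depth psi).
intros N n a' HN Ha' Hn gN; exists a'; split; [exact Ha' |].
apply (back_and_forth generic_lim gN (a := a)); [| | exact Hpsi].
- intros j Hj; split; [intros _ | auto].
  exact (Nat.le_trans _ _ _ (Nat.lt_le_incl _ _ Hj) Hn).
- subst a; split.
  + intros s x x' y y' [u [<- <-]] [v [<- <-]]; rewrite !tnth_tmap.
    split; [apply sub_val_injective | intros e; exact (f_equal (@sub_val _ _ N s) e)].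
  + intros p p' x x' y y' [q [<- <-]] [u [<- <-]] [v [<- <-]].
    rewrite !tnth_tmap; reflexivity.
Qed.

Lemma eventually_impl (G : list feq_sort) (a : tuple (Mlim MQ) G)
    (Q Q' : subset (Mlim MQ) -> Prop) :
  (forall N, H N -> Q N -> Q' N) -> eventually H a Q -> eventually H a Q'.
Proof.
intros K (N & HN & Ha & HQ); exists N; split; [exact HN | split; [exact Ha |]].
auto.
Qed.

Lemma directed_stabilization : forking_stabilization H.
Proof.
intros G D pi b C.
assert (L : forall s : feq_sort, exists l : list (var D s),
  forall u, In u l <-> ~ C s (tnth u b)).
{ intros s; destruct (var_finite D s) as [us [Hus _]].
  exists (filter (fun u => if excluded_middle_informative (C s (tnth u b))
    then false else true) us); intros u; rewrite filter_In.
  specialize (Hus u); destruct (excluded_middle_informative (C s (tnth u b))).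
  - split; [intros [_ e]; discriminate | tauto].
  - tauto. }
destruct (L Obj) as [lo Hlo], (L Par) as [lp Hlp].
(* Non-forking of pi(x, b) over C only depends on the set of coordinates of b that
   lie in C, and is then a first-order property of b. *)
pose (F := fun M (d : tuple M (G ++ D)) => (forall phi, In phi pi -> sat phi d) /\
  (forall u, In u lo -> forall t : var G Obj,
     ~ tnth (varl D t) d = tnth (varr G u) d) /\
  (forall u, In u lp -> forall t : var G Par,
     ~ tnth (varl D t) d = tnth (varr G u) d)).
assert (def : definable (fun M (c : tuple M D) =>
  exists x : tuple M G, F M (tapp x c))).
{ apply (def_exs (F := F)); apply def_and; [| apply def_and].
  - apply def_list; intros phi; now exists phi.
  - apply def_list; intros u; apply def_var; intros t; apply def_not, def_eq.
  - apply def_list; intros u; apply def_var; intros t; apply def_not, def_eq. }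
destruct def as [theta Htheta].
assert (K : forall (N : subset (Mlim MQ)) n (b' : tuple (sub N) D), tmap (@sub_val Lfeq _ N) b' = b ->
  generic (fun j => j <= n) (sub N) ->
  (forks (trace N C) (ptype_at pi b') <-> ~ sat theta b')).
{ intros N n b' Hb' gN.
  rewrite (forks_ptype_at (trace N C) pi b' gN (sub_countable N) (finite_bound n)).
  rewrite (Htheta (sub N) b').
  assert (tr : forall s (u : var D s), trace N C (tnth u b') <-> C s (tnth u b)).
  { intros s u; rewrite <- Hb', tnth_tmap; reflexivity. }
  apply not_iff_compat; split; intros [x [Hx Hn]]; exists x.
  - split; [exact Hx |]; split; intros u Hu t; rewrite tnth_varl, tnth_varr; apply Hn.
    + rewrite tr; now apply Hlo.
    + rewrite tr; now apply Hlp.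
  - split; [exact Hx |]; destruct Hn as [Ho Hp].
    intros s t u nC; rewrite tr in nC; destruct s.
    + apply Hlo in nC; specialize (Ho u nC t); now rewrite tnth_varl, tnth_varr in Ho.
    + apply Hlp in nC; specialize (Hp u nC t); now rewrite tnth_varl, tnth_varr in Hp. }
(* Whichever of [theta] and its negation holds of [b] in the union is eventually true. *)
destruct (classic (sat (M := Mlim MQ) theta b)) as [T | T]; [right | left].
- apply directed_truth in T; revert T; apply eventually_impl.
  intros N HN (b' & Hb' & T); exists b'; split; [exact Hb' |].
  destruct (copies_generic (HC HN)) as [n gN]; rewrite (K N n b' Hb' gN); tauto.
- assert (T' : eventually_true H (fimp theta (fbot D)) b) by now apply directed_truth.
  revert T'; apply eventually_impl.
  intros N HN (b' & Hb' & T'); exists b'; split; [exact Hb' |].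
  destruct (copies_generic (HC HN)) as [n gN]; rewrite (K N n b' Hb' gN); exact T'.
Qed.

Lemma directed_indep (A B C : subset (Mlim MQ)) :
  indep_lim H A C B <-> forall s x, A s x -> acl B x -> acl C x.
Proof.
split.
- intros Hi s x Ax Bx; apply NNPP; intros nC.
  destruct (Hi [s] (x, tt) (conj Ax I)) as (N & HN & _ & K).
  destruct (K N HN) as (a' & Ha' & nF); [intros t y Ny; exact Ny |].
  destruct (copies_generic (HC HN)) as [n gN].
  apply nF, (forks_tp _ _ _ gN (sub_countable N) (finite_bound n)).
  exists s, (vz s []).
  assert (e : x = proj1_sig (tnth (vz s []) a')) by exact (f_equal fst (eq_sym Ha')).
  subst x; split; [left; exact Bx | exact nC].
- intros Hi G a Ha; apply eventually_generic with (m := 0).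
  intros N n a' HN Ha' _ gN; exists a'; split; [exact Ha' |].
  rewrite (forks_tp _ _ a' gN (sub_countable N) (finite_bound n)).
  intros (s & t & Ht & nC); apply nC; destruct Ht as [Ht | Ht]; [| exact Ht].
  apply (Hi s _); [| exact Ht].
  rewrite tall_tnth in Ha; specialize (Ha s t); rewrite <- Ha', tnth_tmap in Ha.
  exact Ha.
Qed.

(** A common element of [A] and [acl B] outside [acl C] is both [a] and [b], and the formula equates
    the two. *)
Lemma directed_finite_character : strong_finite_character H.
Proof.
intros A B C nI.
assert (K : exists s x, A s x /\ acl B x /\ ~ acl C x).
{ apply NNPP; intros n; apply nI, directed_indep; intros s x Ax Bx.
  apply NNPP; intros nC; apply n; now exists s, x. }
destruct K as (s & x & Ax & Bx & nC).
exists [s], [s], [], (@feq Lfeq [s; s] s (vz s [s]) (vs s (vz s []))).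
exists (x, tt), (x, tt), tt.
split; [now split | split; [now split | split; [exact I | split; [reflexivity |]]]].
apply eventually_generic with (m := 0).
intros N n b' HN Hb' _ gN; exists b'; split; [exact Hb' |].
apply (forks_ptype_at (G := [s]) _ _ b' gN (sub_countable N) (finite_bound n)).
intros [y [Hy Hn]]; apply (Hn s (vz s []) (vz s [])).
- assert (e : x = proj1_sig (tnth (vz s []) b')) by exact (f_equal fst (eq_sym Hb')).
  subst x; exact nC.
- exact (Hy _ (or_introl eq_refl)).
Qed.

Lemma directed_acl : acl_stabilization H.
Proof.
intros A _; destruct HD as [[N0 HN0] _]; exists N0; split; [exact HN0 |].
intros N HN _ s x; destruct (copies_generic (HC HN)) as [n gN].
symmetry; apply (acl_generic _ _ gN (sub_countable N)).
Qed.

(** Equality of types in the union gives equality of quantifier-free types, which the substructure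
    [N] inherits and where quantifier elimination makes it equality of types. *)
Lemma directed_homogeneity : homogeneity H.
Proof.
intros N A G a b HN Hab; destruct (copies_generic (HC HN)) as [n gN].
apply (piso_same_type gN); intros D c Hc.
assert (K : piso (pairs (tapp (tmap (@sub_val _ _ N) a) (tmap (@sub_val _ _ N) c))
  (tapp (tmap (@sub_val _ _ N) b) (tmap (@sub_val _ _ N) c)))).
{ apply (same_type_piso Hab); rewrite tall_tnth in *; intros s v.
  rewrite tnth_tmap; apply Hc. }
rewrite <- !tmap_tapp in K.
assert (P : forall s x x', pairs (tapp a c) (tapp b c) (s := s) x x' ->
  pairs (tmap (@sub_val _ _ N) (tapp a c)) (tmap (@sub_val _ _ N) (tapp b c))
    (sub_val x) (sub_val x')).
{ intros s x x' [v [<- <-]]; exists v; now rewrite !tnth_tmap. }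
split.
- intros s x x' y y' Hx Hy; apply P in Hx, Hy.
  assert (Q := proj1 K s _ _ _ _ Hx Hy); split; intros e.
  + apply sub_val_injective, Q; now rewrite e.
  + apply sub_val_injective, Q; now rewrite e.
- intros p p' x x' y y' Hp Hx Hy; apply P in Hp, Hx, Hy.
  exact (proj2 K _ _ _ _ _ _ Hp Hx Hy).
Qed.

Lemma directed_nice_filtration : nice_filtration (copies (MQ := MQ)) H.
Proof.
exact (conj HC (conj HD (conj HV (conj directed_truth (conj directed_stabilization
  (conj directed_finite_character (conj directed_acl directed_homogeneity))))))).
Qed.

End Directed.

(** * The generic parameterized equivalence relation *)

Lemma finite_countable (L : language) (M : structure L) :
  finite_structure M -> countable_structure M.
Proof.
intros [l Hl].
assert (H : forall x, exists i, nth_error l i = Some x).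
{ intros x; apply In_nth_error, Hl. }
apply choice in H as [f Hf]; exists f; intros x y e.
assert (K := Hf x); rewrite e, Hf in K; congruence.
Qed.

Lemma Kfeq_fits (M : structure Lfeq) : Kfeq M -> fits (fun _ => True) M.
Proof. intros [_ H]; now split. Qed.

(** Both the age and the extension property come from [countable_extend] into the generic structure
    [Mlim MQ]; here weak injectivity holds with Y = X. *)
Lemma Mlim_fraisse_limit (MQ : structure LQ) :
  fraisse_limit KQ MQ -> fraisse_limit Kfeq (Mlim MQ).
Proof.
intros hMQ; assert (gM := generic_lim hMQ).
split; [apply Mlim_countable, hMQ | split].
- intros A; split.
  + intros KA; split; [apply KA |].
    destruct (@countable_extend (fun _ => True) A (Mlim MQ) [] tt tt)
      as (h & Hh & _).
    * apply finite_countable, KA.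
    * now apply Kfeq_fits.
    * exact gM.
    * split.
      -- intros s x x' y y' [v _]; destruct (var_nil v).
      -- intros p p' x x' y y' [v _]; destruct (var_nil v).
    * now exists h.
  + intros [HA [f Hf]]; split; [exact HA |]; intros b.
    destruct (proj1 (gen_fits gM) (f Par b)) as [Er Es Et].
    split; red.
    * intros x; apply (embedding_E Hf), Er.
    * intros x y h; apply (embedding_E Hf), Es, (embedding_E Hf), h.
    * intros x y z h1 h2; apply (embedding_E Hf); apply Et with (f Obj y);
        now apply (embedding_E Hf).
- intros X HX; exists X; split; [exact HX | split; [intros s x h; exact h |]].
  intros Z g KZ Hg.
  destruct (finite_sub HX) as [l Hl].
  destruct (@finite_lists (sub X) l) as (os & bs & H1 & H2).
  destruct (@context_of (sub X) os bs) as (G & e & Ho & Hb).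
  assert (all : forall s (x : sub X s), exists v : var G s, tnth v e = x).
  { intros [|] x; [apply Ho, H1, Hl | apply Hb, H2, Hl]. }
  destruct (@countable_extend (fun _ => True) Z (Mlim MQ) G (tmap g e)
    (tmap (@sub_val _ _ X) e)) as (h & Hh & he).
  + apply finite_countable, KZ.
  + now apply Kfeq_fits.
  + exact gM.
  + split.
    * intros s x x' y y' [u [<- <-]] [v [<- <-]]; rewrite !tnth_tmap.
      split; intros K.
      -- apply Hg in K; exact (f_equal (@sub_val _ _ X s) K).
      -- apply sub_val_injective in K; exact (f_equal (g s) K).
    * intros p p' x x' y y' [q [<- <-]] [u [<- <-]] [v [<- <-]].
      rewrite !tnth_tmap, <- (embedding_E Hg); reflexivity.
  + exists h; split; [exact Hh |]; intros s x _.
    destruct (all s x) as [v <-]; specialize (he s v).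
    rewrite !tnth_tmap in he; exact he.
Qed.

Unset Implicit Arguments.

Theorem theorem3p9 (MQ : structure LQ) (hMQ : fraisse_limit KQ MQ) :
  models (Mlim MQ) Tfeq /\ approximates (copies (MQ := MQ)) (parts (MQ := MQ)).
Proof.
split; [intros phi Hphi; now apply Hphi, Mlim_fraisse_limit |].
assert (age := proj1 (proj2 hMQ)).
assert (cov : covering (parts (MQ := MQ))).
{ intros s [x [n Hx]]; exists (@part MQ n); split; [now exists n | exact Hx]. }
assert (filt : nice_filtration (copies (MQ := MQ)) (parts (MQ := MQ))).
{ apply (directed_nice_filtration hMQ); [apply parts_copies | | exact cov].
  split; [exists (@part MQ 0); now exists 0 |].
  intros N1 N2 [n1 ->] [n2 ->]; exists (@part MQ (n1 + n2)).
  split; [now exists (n1 + n2) |].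
  split; intros [|] [x Hx0]; unfold part; simpl.
  - apply (inQ_mono age); lia.
  - apply (inR_mono age); lia.
  - apply (inQ_mono age); lia.
  - apply (inR_mono age); lia. }
split; [| exact filt].
split; [| split; [| split; [| split]]].
- intros s x; destruct (cov s x) as [N [HN Nx]]; exists N; split; [| exact Nx].
  now apply parts_copies.
- intros f N Hf; apply copies_isomorphic; now apply image_isomorphic.
- intros H1 H2 (C1 & D1 & V1 & _) (C2 & D2 & V2 & _) A B C.
  rewrite (directed_indep hMQ C1 D1 V1), (directed_indep hMQ C2 D2 V2); reflexivity.
- now exists (parts (MQ := MQ)).
(* The image of a filtration is again a directed covering system of copies, which is all that
   [directed_nice_filtration] asks. *)
- intros H f Hf (HC & [[N0 HN0] HD] & HV & _).
  apply (directed_nice_filtration hMQ).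
  + intros N [N' [HN' ->]]; apply (copies_isomorphic (N := N')); [| now apply HC].
    now apply image_isomorphic.
  + split; [exists (image (M := Mlim MQ) (N := Mlim MQ) f N0); now exists N0 |].
    intros N1 N2 [N1' [H1 ->]] [N2' [H2 ->]].
    destruct (HD N1' N2' H1 H2) as (N & HN & L1 & L2).
    exists (image (M := Mlim MQ) (N := Mlim MQ) f N); split; [now exists N |].
    split; intros s y [x [Nx <-]]; exists x; auto.
  + intros s y; destruct (proj2 Hf s y) as [x <-], (HV s x) as (N & HN & Nx).
    exists (image (M := Mlim MQ) (N := Mlim MQ) f N); split; [now exists N |].
    now exists x.
Qed.
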